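(* Let $f_1,f_2$ be meromorphic almost periodic functions on a horizontal strip $S$. Then the product $f_1f_2$ is a meromorphic almost periodic function on $S$ if and only if the zeros and the poles of the meromorphic function $f_1f_2$ are separated inside $S$.
   Context: A (horizontal) strip is a set $S=\{z\in\mathbb C: a<\operatorname{Im} z<b\}$ with $-\infty\le a<b\le\infty$. For $S'=\{z: \alpha<\operatorname{Im} z<\beta\}$, the notation $S'\subset\subset S$ means $a<\alpha<\beta<b$. $\rho$ denotes the spherical metric on $\overline{\mathbb C}=\mathbb C\cup\{\infty\}$. A set $E\subset\mathbb R$ is relatively dense if there is $L>0$ such that every segment $[t,t+L]$, $t\in\mathbb R$, meets $E$. A meromorphic function $f$ on $S$ is called a meromorphic almost periodic function on $S$ if for every $S'\subset\subset S$ and every $\varepsilon>0$ the set $\{\tau\in\mathbb R:\rho(f(z+\tau),f(z))<\varepsilon\ \ \forall z\in S'\}$ is relatively dense in $\mathbb R$. Two sets $N,P\subset S$ are separated inside $S$ if for every $S'\subset\subset S$ one has $\inf\{|z-z'|: z\in N\cap S',\ z'\in P\cap S'\}>0$ (the infimum over the empty set being $+\infty$). The product is the product of meromorphic functions (common zeros/poles of the factors being cancelled). *)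

(* Defs.v *)
From Stdlib Require Import Reals ClassicalEpsilon.
From Coquelicot Require Import Coquelicot.

Open Scope R_scope.

(** * The Riemann sphere *)

Inductive sphere : Type :=
  | Fin : C -> sphere
  | Infty : sphere.

(* The value 0 at infinity is junk; it is only used where the argument is
   finite on the (punctured) neighbourhood that matters. *)
Definition fin_part (w : sphere) : C :=
  match w with Fin u => u | Infty => 0%C end.

(* Chordal form of the spherical metric: the Euclidean distance in R^3 between
   the stereographic projections onto the unit sphere. *)
Definition rho (w1 w2 : sphere) : R :=
  match w1, w2 with
  | Fin u, Fin v =>
      2 * Cmod (u - v)%C / (sqrt (1 + Cmod u ^ 2) * sqrt (1 + Cmod v ^ 2))
  | Fin u, Infty | Infty, Fin u => 2 / sqrt (1 + Cmod u ^ 2)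
  | Infty, Infty => 0
  end.

Definition sphere_locally (l : sphere) (P : sphere -> Prop) : Prop :=
  exists eps : posreal, forall w : sphere, rho w l < eps -> P w.

Definition is_lim_sphere (f : C -> sphere) (z : C) (l : sphere) : Prop :=
  filterlim f (locally' z) (sphere_locally l).

(** * Meromorphic functions *)

(* Functions are total on C; only their values on the domain D (an open set)
   are meaningful. *)
Definition holomorphic_at (f : C -> sphere) (z : C) : Prop :=
  locally z (fun w : C => f w <> Infty) /\
  ex_derive (fun w : C => fin_part (f w)) z.

Definition pole_at (f : C -> sphere) (z : C) : Prop :=
  f z = Infty /\
  locally' z (fun w : C => f w <> Infty) /\
  is_lim_sphere f z Infty.

Definition meromorphic_on (D : C -> Prop) (f : C -> sphere) : Prop :=
  forall z : C, D z -> holomorphic_at f z \/ pole_at f z.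

Definition zeros (D : C -> Prop) (f : C -> sphere) (z : C) : Prop :=
  D z /\ f z = Fin 0%C.

Definition poles (D : C -> Prop) (f : C -> sphere) (z : C) : Prop :=
  D z /\ f z = Infty.

(* Where both factors are finite this is the pointwise product; at a pole of a
   factor it is the limit of the pointwise product on the sphere, so that zeros
   of one factor cancel poles of the other. *)
Definition mero_mult (f g : C -> sphere) (z : C) : sphere :=
  match f z, g z with
  | Fin u, Fin v => Fin (u * v)%C
  | _, _ =>
      epsilon (inhabits Infty)
        (is_lim_sphere (fun w : C => Fin (fin_part (f w) * fin_part (g w))%C) z)
  end.

(** * Strips and almost periodicity *)

Definition strip (a b : Rbar) (z : C) : Prop :=
  Rbar_lt a (Im z) /\ Rbar_lt (Im z) b.

(* The bounds of a compactly included substrip are automatically finite. *)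
Definition substrip (alpha beta : R) (a b : Rbar) : Prop :=
  Rbar_lt a alpha /\ alpha < beta /\ Rbar_lt beta b.

Definition relatively_dense (E : R -> Prop) : Prop :=
  exists L : R, 0 < L /\
    forall t : R, exists tau : R, t <= tau <= t + L /\ E tau.

Definition mero_almost_periodic (a b : Rbar) (f : C -> sphere) : Prop :=
  meromorphic_on (strip a b) f /\
  forall alpha beta : R, substrip alpha beta a b ->
  forall eps : R, 0 < eps ->
    relatively_dense (fun tau : R =>
      forall z : C, strip alpha beta z ->
        rho (f (z + RtoC tau)%C) (f z) < eps).

(* Glb_Rbar of the empty set is p_infty. *)
Definition separated_inside (a b : Rbar) (N P : C -> Prop) : Prop :=
  forall alpha beta : R, substrip alpha beta a b ->
    Rbar_lt 0 (Glb_Rbar (fun d : R => exists z z' : C,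
      (N z /\ strip alpha beta z) /\ (P z' /\ strip alpha beta z') /\
      d = Cmod (z - z')%C)).

(* Main.v *)
Require Import Defs.
From Stdlib Require Import Reals.
From Coquelicot Require Import Coquelicot.
From Stdlib Require Import Lra Lia List Classical ClassicalEpsilon.

Local Open Scope R_scope.

(** Let [F] be the product of [f1] and [f2].

    If [F] is almost periodic, it is uniformly continuous on substrips for the
    spherical metric ([almost_periodic_uniformly_continuous]); as 0 and infinity
    are at distance 2 on the sphere, a zero and a pole of [F] cannot be close.

    Conversely, [F] is meromorphic because locally both factors are quotients of
    holomorphic functions ([meromorphic_mult]), and [f1], [f2] have a relatively
    dense set of common almost periods [tau] ([common_almost_periods]). For such a
    [tau] the values of [F] at [z + tau] and at [z] are obviously close where [f1]
    and [f2] stay away from 0 and infinity. The heart of the matter is that every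
    point [z0] of the substrip is the centre of a small square on whose boundary
    [f1] and [f2] do stay away from 0 and infinity, with bounds that do not depend
    on [z0] ([uniform_contours]). If the squares are small, separation says
    that inside each of them [F] omits 0 or infinity, and so does its translate by
    [tau]; then the difference of the two functions, or of their inverses, or the
    difference of their quotient and 1, is holomorphic inside the square, and the
    maximum principle carries the closeness from the boundary to [z0]
    ([contour_comparison]).

    The uniform contours come from a quantitative form of the identity theorem.
    A holomorphic function bounded by 1 on a square which is very small at [N]
    well-separated points of a smaller concentric square is at most about
    [(/ 2) ^ N] on the latter ([small_at_points]). This has two uses. As a small
    square contains many well-separated points, smallness propagates from a
    square to its double, hence along chains of squares; and since a nonzero
    value of an almost periodic function recurs in all rectangles of some fixed
    size, the function cannot be very small on any square of a given size
    ([nowhere_small]). Consequently it cannot be very small somewhere on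
    each of [N] concentric squares, so some of these are good contours
    ([contour_among_many]).

    The complex analysis used is the maximum principle and the removability of
    isolated singularities of continuous functions. Both follow from Cauchy's
    formula on rectangles, which follows from Goursat's theorem. Near a pole one
    works with the inverse function, inversion being an isometry of the sphere. *)

(** * Complex differentiability *)

Lemma Cmod_sub_sym (z w : C) : Cmod (z - w)%C = Cmod (w - z)%C.
Proof. rewrite <- (Cmod_opp (z - w)%C). f_equal. ring. Qed.

Lemma Cmod_le_abs (z : C) : Cmod z <= Rabs (Re z) + Rabs (Im z).
Proof.
destruct z as [x y]. unfold Cmod, Re, Im; simpl fst; simpl snd.
apply Rsqr_incr_0_var.
2: generalize (Rabs_pos x) (Rabs_pos y); lra.
rewrite Rsqr_sqrt by nra. unfold Rsqr.
rewrite <- (pow2_abs x), <- (pow2_abs y).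
generalize (Rabs_pos x) (Rabs_pos y); nra.
Qed.

Lemma im_le_Cmod (z : C) : Rabs (Im z) <= Cmod z.
Proof. eapply Rle_trans; [ | apply Rmax_Cmod]. apply Rmax_r. Qed.

Lemma Cmod_shift_right (z : C) (r : R) : 0 < r ->
  Cmod (z + RtoC r - z)%C = r /\ (z + RtoC r)%C <> z.
Proof.
intros Hr.
assert (E : Cmod (z + RtoC r - z)%C = r).
{ replace (z + RtoC r - z)%C with (RtoC r) by ring. rewrite Cmod_R. apply Rabs_pos_eq. lra. }
split; auto. intros Ez. rewrite Ez in E. replace (z - z)%C with (RtoC 0) in E by ring.
rewrite Cmod_0 in E. lra.
Qed.

Lemma locally_Cmod (z : C) (P : C -> Prop) :
  locally z P <-> exists d, 0 < d /\ forall w, Cmod (w - z)%C < d -> P w.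
Proof.
split.
- intros [e He]. exists e. split; [apply cond_pos | ].
  intros w Hw. apply He. apply C_NormedModule_mixin_compat1. exact Hw.
- intros (d & Hd & H).
  assert (Hd2 : 0 < d / 2) by lra.
  exists (mkposreal _ Hd2). intros w Hw. apply H.
  generalize (C_NormedModule_mixin_compat2 z w (mkposreal _ Hd2) Hw). simpl.
  intros H1. eapply Rlt_le_trans; [exact H1 | ].
  assert (sqrt 2 <= 2).
  { rewrite <- (sqrt_Rsqr 2) at 2 by lra. apply sqrt_le_1_alt. unfold Rsqr; lra. }
  nra.
Qed.

Lemma continuous_Cmod (f : C -> C) (z : C) :
  continuous f z <-> forall e, 0 < e -> exists d, 0 < d /\
    forall w, Cmod (w - z)%C < d -> Cmod (f w - f z)%C < e.
Proof.
unfold continuous, filterlim, filter_le, filtermap. split.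
- intros H e He. apply locally_Cmod.
  apply (H (fun y => Cmod (y - f z)%C < e)). apply locally_Cmod.
  exists e. auto.
- intros H P HP. apply locally_Cmod in HP. destruct HP as (e & He & HP).
  apply locally_Cmod. destruct (H e He) as (d & Hd & H'). exists d.
  split; auto.
Qed.

Lemma continuous_Cplus (f g : C -> C) (z : C) :
  continuous f z -> continuous g z -> continuous (fun w => f w + g w)%C z.
Proof. intros Hf Hg. exact (continuous_plus (V := C_NormedModule) f g z Hf Hg). Qed.

Lemma continuous_Cconst (c z : C) : continuous (fun _ : C => c) z.
Proof. apply continuous_const. Qed.

Lemma continuous_Cid (z : C) : continuous (fun w : C => w) z.
Proof. apply continuous_id. Qed.

Lemma continuous_Cmult (f g : C -> C) (z : C) :
  continuous f z -> continuous g z -> continuous (fun w => f w * g w)%C z.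
Proof.
rewrite !continuous_Cmod. intros Hf Hg e He.
set (A := Cmod (f z) + Cmod (g z) + 1).
assert (HA : 1 <= A) by (unfold A; generalize (Cmod_ge_0 (f z)) (Cmod_ge_0 (g z)); lra).
set (e' := Rmin 1 (e / (3 * A))).
assert (He1 : 0 < e / (3 * A)) by (apply Rdiv_lt_0_compat; lra).
assert (He' : 0 < e') by (unfold e'; apply Rmin_pos; lra).
destruct (Hf e' He') as (d1 & Hd1 & H1). destruct (Hg e' He') as (d2 & Hd2 & H2).
exists (Rmin d1 d2). split; [apply Rmin_pos; auto | ].
intros w Hw.
assert (K1 : Cmod (f w - f z)%C < e') by (apply H1; eapply Rlt_le_trans; [exact Hw | apply Rmin_l]).
assert (K2 : Cmod (g w - g z)%C < e') by (apply H2; eapply Rlt_le_trans; [exact Hw | apply Rmin_r]).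
replace (f w * g w - f z * g z)%C with
  ((f w - f z) * (g w - g z) + (f z * (g w - g z) + (f w - f z) * g z))%C by ring.
eapply Rle_lt_trans; [apply Cmod_triangle | ].
eapply Rle_lt_trans; [apply Rplus_le_compat_l, Cmod_triangle | ].
rewrite !Cmod_mult.
assert (E1 : e' <= 1) by apply Rmin_l.
assert (E2 : e' * (3 * A) <= e).
{ apply Rle_trans with (e / (3 * A) * (3 * A)).
  - apply Rmult_le_compat_r; [lra | apply Rmin_r].
  - right. field. lra. }
generalize (Cmod_ge_0 (f z)) (Cmod_ge_0 (g z)) (Cmod_ge_0 (f w - f z)%C)
  (Cmod_ge_0 (g w - g z)%C). unfold A in *. nra.
Qed.

Lemma continuous_Cinv (f : C -> C) (z : C) :
  continuous f z -> f z <> 0%C -> continuous (fun w => / f w)%C z.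
Proof.
rewrite !continuous_Cmod. intros Hf Hz e He.
assert (Hp : 0 < Cmod (f z)) by (apply Cmod_gt_0; exact Hz).
set (p := Cmod (f z)) in *.
set (e' := Rmin (p / 2) (e * p * p / 2)).
assert (He' : 0 < e').
{ unfold e'; apply Rmin_pos; [lra | ]. assert (0 < e * p) by nra. nra. }
destruct (Hf e' He') as (d & Hd & H). exists d. split; auto.
intros w Hw. specialize (H w Hw).
assert (E1 : e' <= p / 2) by apply Rmin_l.
assert (E2 : e' <= e * p * p / 2) by apply Rmin_r.
assert (Hq : p / 2 < Cmod (f w)).
{ assert (p <= Cmod (f w) + Cmod (f w - f z)%C).
  { unfold p. rewrite (Cmod_sub_sym (f w)).
    replace (f z) with (f w + (f z - f w))%C at 1 by ring. apply Cmod_triangle. }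
  lra. }
assert (Hw0 : f w <> 0%C).
{ intros E. rewrite E, Cmod_0 in Hq. lra. }
replace (/ f w - / f z)%C with ((f z - f w) / (f w * f z))%C by (field; auto).
rewrite Cmod_div by (apply Cmult_neq_0; auto).
rewrite Cmod_mult. fold p. rewrite Cmod_sub_sym.
apply Rmult_lt_reg_r with (Cmod (f w) * p); [nra | ].
unfold Rdiv. rewrite Rmult_assoc, Rinv_l by nra.
assert (e * (p / 2 * p) <= e * (Cmod (f w) * p)) by (apply Rmult_le_compat_l; nra).
lra.
Qed.

(** The difference quotient, completed by the derivative: in this form the
    rules of calculus and the continuity of differentiable functions are
    purely algebraic. *)
Lemma ex_derive_quotient (f : C -> C) (z : C) :
  ex_derive (K := C_AbsRing) (V := C_NormedModule) f z <->
  exists phi : C -> C, continuous phi z /\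
    forall w, f w = (f z + (w - z) * phi w)%C.
Proof.
split.
- intros [l [_ Hl]].
  specialize (Hl z (fun P H => H)).
  exists (fun w => if Ceq_dec w z then l else ((f w - f z) / (w - z))%C).
  split.
  + apply continuous_Cmod. intros e He.
    assert (He2 : 0 < e / 2) by lra.
    specialize (Hl (mkposreal _ He2)).
    destruct Hl as [d Hl].
    exists d. split; [apply cond_pos | ]. intros w Hw.
    destruct (Ceq_dec z z) as [_ | n]; [ | now elim n].
    destruct (Ceq_dec w z) as [-> | n].
    * replace (l - l)%C with (RtoC 0) by ring. rewrite Cmod_0. exact He.
    * specialize (Hl w Hw). simpl in Hl.
      change (Cmod (f w - f z - (w - z) * l)%C <= e / 2 * Cmod (w - z)%C) in Hl.
      assert (Hwz : (w - z)%C <> 0%C) by (intros E; apply n, Ceq_minus, E).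
      replace ((f w - f z) / (w - z) - l)%C with
        ((f w - f z - (w - z) * l) / (w - z))%C by (field; exact Hwz).
      assert (Hp : 0 < Cmod (w - z)%C) by (apply Cmod_gt_0; exact Hwz).
      rewrite Cmod_div by exact Hwz.
      apply Rle_lt_trans with (e / 2); [ | lra].
      apply Rmult_le_reg_r with (Cmod (w - z)%C); [exact Hp | ].
      unfold Rdiv at 1. rewrite Rmult_assoc, Rinv_l by lra. lra.
  + intros w. destruct (Ceq_dec w z) as [-> | n]; [ring | ].
    field. intros E; apply n, Ceq_minus, E.
- intros (phi & Hc & Hphi). exists (phi z).
  split.
  + apply (is_linear_scal_l (K := C_AbsRing) (V := C_NormedModule)).
  + intros x Hx.
    assert (x = z).
    { symmetry. apply (is_filter_lim_locally_unique (V := AbsRing_NormedModule C_AbsRing)).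
      exact Hx. }
    subst x. intros e.
    rewrite continuous_Cmod in Hc. destruct (Hc e (cond_pos e)) as (d & Hd & H).
    exists (mkposreal _ Hd). intros w Hw.
    change (Cmod (f w - f z - (w - z) * phi z)%C <= e * Cmod (w - z)%C).
    rewrite (Hphi w).
    replace (f z + (w - z) * phi w - f z - (w - z) * phi z)%C with
      ((phi w - phi z) * (w - z))%C by ring.
    rewrite Cmod_mult. apply Rmult_le_compat_r; [apply Cmod_ge_0 | ].
    left. auto.
Qed.

Lemma ex_derive_Ccontinuous (f : C -> C) (z : C) :
  ex_derive f z -> continuous f z.
Proof.
intros H. apply ex_derive_quotient in H. destruct H as (phi & Hc & H).
apply continuous_ext with (fun w => f z + (w + - z) * phi w)%C.
- intros w. symmetry. exact (H w).
- apply continuous_Cplus; [apply continuous_Cconst | ].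
  apply continuous_Cmult; [ | exact Hc].
  apply continuous_Cplus; [apply continuous_Cid | apply continuous_Cconst].
Qed.

Lemma ex_derive_Cconst (c z : C) : ex_derive (fun _ : C => c) z.
Proof.
apply ex_derive_quotient. exists (fun _ => 0%C).
split; [apply continuous_Cconst | intros w; ring].
Qed.

Lemma ex_derive_Cid (z : C) : ex_derive (fun w : C => w) z.
Proof.
apply ex_derive_quotient. exists (fun _ => 1%C).
split; [apply continuous_Cconst | intros w; ring].
Qed.

Lemma ex_derive_Cplus (f g : C -> C) (z : C) :
  ex_derive f z -> ex_derive g z -> ex_derive (fun w => f w + g w)%C z.
Proof.
intros H1 H2. apply ex_derive_quotient in H1, H2. apply ex_derive_quotient.
destruct H1 as (p & Hp & H1), H2 as (q & Hq & H2).
exists (fun w => p w + q w)%C. split; [now apply continuous_Cplus | ].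
intros w. rewrite (H1 w), (H2 w). ring.
Qed.

Lemma ex_derive_Cmult (f g : C -> C) (z : C) :
  ex_derive f z -> ex_derive g z -> ex_derive (fun w => f w * g w)%C z.
Proof.
intros H1 H2.
assert (Hc := ex_derive_Ccontinuous _ _ H2).
apply ex_derive_quotient in H1, H2. apply ex_derive_quotient.
destruct H1 as (p & Hp & H1), H2 as (q & Hq & H2).
exists (fun w => p w * g w + f z * q w)%C. split.
- apply continuous_Cplus; apply continuous_Cmult; auto using continuous_Cconst.
- intros w. rewrite (H1 w), (H2 w). ring.
Qed.

Lemma ex_derive_Cminus (f g : C -> C) (z : C) :
  ex_derive f z -> ex_derive g z -> ex_derive (fun w => f w - g w)%C z.
Proof.
intros H1 H2.
apply ex_derive_ext with (fun w => f w + (RtoC (-1)) * g w)%C.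
- intros w. change (f w + (RtoC (-1)) * g w = f w - g w)%C.
  replace (RtoC (-1)) with (- (1))%C by (rewrite <- RtoC_opp; f_equal; lra). ring.
- apply ex_derive_Cplus; auto. apply ex_derive_Cmult; auto using ex_derive_Cconst.
Qed.

Lemma ex_derive_ext_near (f g : C -> C) (z : C) :
  locally z (fun w => f w = g w) -> ex_derive f z -> ex_derive g z.
Proof.
intros H. apply ex_derive_ext_loc. apply locally_C. exact H.
Qed.

Lemma locally_ne0 (f : C -> C) (z : C) :
  continuous f z -> f z <> 0%C -> locally z (fun w => f w <> 0%C).
Proof.
intros Hf Hz. rewrite continuous_Cmod in Hf.
destruct (Hf (Cmod (f z))) as (d & Hd & H); [now apply Cmod_gt_0 | ].
apply locally_Cmod. exists d. split; auto. intros w Hw E.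
specialize (H w Hw). rewrite E in H.
replace (0 - f z)%C with (- f z)%C in H by ring. rewrite Cmod_opp in H. lra.
Qed.

Lemma ex_derive_Cinv (f : C -> C) (z : C) :
  ex_derive f z -> f z <> 0%C -> ex_derive (fun w => / f w)%C z.
Proof.
intros H1 Hz.
assert (Hc := ex_derive_Ccontinuous _ _ H1).
assert (H0 := locally_ne0 f z Hc Hz).
apply ex_derive_quotient in H1. destruct H1 as (p & Hp & H1).
apply ex_derive_ext_near with
  (fun w => / f z + (w - z) * - (p w * (/ f z * / f w)))%C.
- generalize H0. apply filter_imp. intros w Hw.
  assert (E : (p w * (w - z))%C = (f w - f z)%C) by (rewrite (H1 w); ring).
  transitivity (/ f z - (p w * (w - z)) * (/ f z * / f w))%C; [ring | ].
  rewrite E. field. auto.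
- apply ex_derive_quotient.
  exists (fun w => - (p w * (/ f z * / f w)))%C. split.
  + apply continuous_ext with (fun w => (- (1)) * (p w * (/ f z * / f w)))%C.
    * intros w. change (- (1) * (p w * (/ f z * / f w)) = - (p w * (/ f z * / f w)))%C. ring.
    * apply continuous_Cmult; [apply continuous_Cconst | ].
      apply continuous_Cmult; auto.
      apply continuous_Cmult; [apply continuous_Cconst | ].
      now apply continuous_Cinv.
  + intros w. replace (z - z)%C with (RtoC 0) by ring.
    ring.
Qed.

Lemma ex_derive_Cdiv (f g : C -> C) (z : C) :
  ex_derive f z -> ex_derive g z -> g z <> 0%C ->
  ex_derive (fun w => f w / g w)%C z.
Proof.
intros Hf Hg Hz. apply ex_derive_Cmult; auto. now apply ex_derive_Cinv.
Qed.

Ltac C_derivable :=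
  match goal with
  | |- ex_derive (fun _ => ?c) _ => apply ex_derive_Cconst
  | |- ex_derive (fun w => w) _ => apply ex_derive_Cid
  | |- ex_derive (fun w => Cplus (@?f w) (@?g w)) _ =>
      apply (ex_derive_Cplus f g); C_derivable
  | |- ex_derive (fun w => Cminus (@?f w) (@?g w)) _ =>
      apply (ex_derive_Cminus f g); C_derivable
  | |- ex_derive (fun w => Cmult (@?f w) (@?g w)) _ =>
      apply (ex_derive_Cmult f g); C_derivable
  | |- ex_derive (fun w => Cdiv (@?f w) (@?g w)) _ =>
      apply (ex_derive_Cdiv f g); [C_derivable | C_derivable | ]
  | |- ex_derive (fun w => Cinv (@?f w)) _ =>
      apply (ex_derive_Cinv f); [C_derivable | ]
  | _ => auto
  end.

(** * Integrals along the sides of a rectangle *)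

Definition hline_integral (g : C -> C) (a b y : R) : C :=
  RInt (V := C_R_CompleteNormedModule) (fun t => g (t, y)) a b.

Definition vline_integral (g : C -> C) (x c d : R) : C :=
  RInt (V := C_R_CompleteNormedModule) (fun t => g (x, t)) c d.

Lemma continuous_on_hline (g : C -> C) (x y : R) :
  continuous g (x, y) ->
  continuous (T := R_UniformSpace) (U := C_UniformSpace) (fun t : R => g (t, y)) x.
Proof.
intros H P HP. specialize (H P HP).
destruct H as [e H]. exists e. intros t Ht. apply H.
split; [exact Ht | apply ball_center].
Qed.

Lemma continuous_on_vline (g : C -> C) (x y : R) :
  continuous g (x, y) ->
  continuous (T := R_UniformSpace) (U := C_UniformSpace) (fun t : R => g (x, t)) y.
Proof.
intros H P HP. specialize (H P HP).
destruct H as [e H]. exists e. intros t Ht. apply H.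
split; [apply ball_center | exact Ht].
Qed.

Section SegmentIntegrals.

Variables (g : R -> C) (a b : R).
Hypothesis ab : a <= b.

Let V := C_R_CompleteNormedModule.

Lemma ex_RInt_segment :
  (forall t, a <= t <= b -> continuous (T := R_UniformSpace) (U := C_UniformSpace) g t) -> ex_RInt (V := V) g a b.
Proof.
intros H. apply ex_RInt_continuous. rewrite Rmin_left, Rmax_right by auto. exact H.
Qed.

Lemma Cmod_RInt_le (M : R) :
  (forall t, a <= t <= b -> continuous (T := R_UniformSpace) (U := C_UniformSpace) g t) ->
  (forall t, a <= t <= b -> Cmod (g t) <= M) ->
  Cmod (RInt (V := V) g a b) <= (b - a) * M.
Proof.
intros Hc HM.
rewrite Cmod_norm.
apply (norm_RInt_le_const (V := V) g a b (RInt (V := V) g a b) M ab).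
{ intros t Ht. rewrite <- Cmod_norm. auto. }
apply RInt_correct, ex_RInt_segment, Hc.
Qed.

Lemma RInt_Cmult_l (c : C) :
  (forall t, a <= t <= b -> continuous (T := R_UniformSpace) (U := C_UniformSpace) g t) ->
  RInt (V := V) (fun t => c * g t)%C a b = (c * RInt (V := V) g a b)%C.
Proof.
intros Hc. apply is_RInt_unique.
assert (H := RInt_correct (V := V) g a b (ex_RInt_segment Hc)).
destruct (RInt (V := V) g a b) as [u v].
assert (H1 := is_RInt_fct_extend_fst _ _ _ _ H).
assert (H2 := is_RInt_fct_extend_snd _ _ _ _ H).
simpl in H1, H2. destruct c as [p q].
apply (is_RInt_fct_extend_pair (U := R_NormedModule) (V := R_NormedModule)
  (fun t => Cmult (p, q) (g t))); simpl.
- apply (is_RInt_minus (V := R_NormedModule) (fun t => p * fst (g t)) (fun t => q * snd (g t)));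
  apply (is_RInt_scal (V := R_NormedModule)); assumption.
- apply (is_RInt_plus (V := R_NormedModule) (fun t => p * snd (g t)) (fun t => q * fst (g t)));
  apply (is_RInt_scal (V := R_NormedModule)); assumption.
Qed.

End SegmentIntegrals.

Definition crect (a b c d : R) (z : C) : Prop := a <= Re z <= b /\ c <= Im z <= d.

Definition boundary_integral (g : C -> C) (a b c d : R) : C :=
  (hline_integral g a b c + Ci * vline_integral g b c d - hline_integral g a b d - Ci * vline_integral g a c d)%C.

Definition ccont_on (D : C -> Prop) (g : C -> C) : Prop :=
  forall z, D z -> continuous g z.

Definition brect (a b c d : R) (z : C) : Prop :=
  crect a b c d z /\ (Re z = a \/ Re z = b \/ Im z = c \/ Im z = d).

Section BoundaryIntegrals.

Variables (g h : C -> C) (a b c d : R).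
Hypotheses (ab : a <= b) (cd : c <= d).
Hypothesis Hg : ccont_on (brect a b c d) g.
Hypothesis Hh : ccont_on (brect a b c d) h.

Lemma hline_integral_plus (y : R) : y = c \/ y = d ->
  hline_integral (fun z => g z + h z)%C a b y = (hline_integral g a b y + hline_integral h a b y)%C.
Proof.
intros Hy.
apply (RInt_plus (V := C_R_CompleteNormedModule)); apply ex_RInt_segment; try lra;
intros t Ht; apply continuous_on_hline; [apply Hg | apply Hh];
repeat split; simpl; lra.
Qed.

Lemma vline_integral_plus (x : R) : x = a \/ x = b ->
  vline_integral (fun z => g z + h z)%C x c d = (vline_integral g x c d + vline_integral h x c d)%C.
Proof.
intros Hy.
apply (RInt_plus (V := C_R_CompleteNormedModule)); apply ex_RInt_segment; try lra;
intros t Ht; apply continuous_on_vline; [apply Hg | apply Hh];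
repeat split; simpl; lra.
Qed.

Lemma hline_integral_scal (k : C) (y : R) : y = c \/ y = d ->
  hline_integral (fun z => k * g z)%C a b y = (k * hline_integral g a b y)%C.
Proof.
intros Hy. apply (RInt_Cmult_l (fun t => g (t, y))); auto.
intros t Ht; apply continuous_on_hline, Hg; repeat split; simpl; lra.
Qed.

Lemma vline_integral_scal (k : C) (x : R) : x = a \/ x = b ->
  vline_integral (fun z => k * g z)%C x c d = (k * vline_integral g x c d)%C.
Proof.
intros Hy. apply (RInt_Cmult_l (fun t => g (x, t))); auto.
intros t Ht; apply continuous_on_vline, Hg; repeat split; simpl; lra.
Qed.

Lemma boundary_integral_plus : boundary_integral (fun z => g z + h z)%C a b c d = (boundary_integral g a b c d + boundary_integral h a b c d)%C.
Proof. unfold boundary_integral. rewrite !hline_integral_plus, !vline_integral_plus by auto. ring. Qed.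

Lemma boundary_integral_scal (k : C) : boundary_integral (fun z => k * g z)%C a b c d = (k * boundary_integral g a b c d)%C.
Proof. unfold boundary_integral. rewrite !hline_integral_scal, !vline_integral_scal by auto. ring. Qed.

Lemma boundary_integral_bound (M : R) :
  (forall z, brect a b c d z -> Cmod (g z) <= M) ->
  Cmod (boundary_integral g a b c d) <= 2 * ((b - a) + (d - c)) * M.
Proof.
intros HM.
assert (Eh : forall y, y = c \/ y = d -> Cmod (hline_integral g a b y) <= (b - a) * M).
{ intros y Hy. apply (Cmod_RInt_le (fun t => g (t, y))); auto.
  - intros t Ht; apply continuous_on_hline, Hg; repeat split; simpl; lra.
  - intros t Ht; apply HM; repeat split; simpl; lra. }
assert (Ev : forall x, x = a \/ x = b -> Cmod (Ci * vline_integral g x c d)%C <= (d - c) * M).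
{ intros y Hy. rewrite Cmod_mult, Cmod_Ci, Rmult_1_l.
  apply (Cmod_RInt_le (fun t => g (y, t))); auto.
  - intros t Ht; apply continuous_on_vline, Hg; repeat split; simpl; lra.
  - intros t Ht; apply HM; repeat split; simpl; lra. }
unfold boundary_integral, Cminus.
assert (H1 := Eh c ltac:(auto)). assert (H2 := Eh d ltac:(auto)).
assert (H3 := Ev a ltac:(auto)). assert (H4 := Ev b ltac:(auto)).
eapply Rle_trans; [apply Cmod_triangle | ]. rewrite Cmod_opp.
eapply Rle_trans; [apply Rplus_le_compat_r, Cmod_triangle | ]. rewrite Cmod_opp.
eapply Rle_trans; [apply Rplus_le_compat_r, Rplus_le_compat_r, Cmod_triangle | ].
lra.
Qed.

End BoundaryIntegrals.

Section Subdivision.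

Variables (g : C -> C) (a b c d : R).
Hypotheses (ab : a <= b) (cd : c <= d).
Hypothesis Hg : ccont_on (crect a b c d) g.

Lemma hline_integral_split (m y : R) : a <= m <= b -> c <= y <= d ->
  hline_integral g a b y = (hline_integral g a m y + hline_integral g m b y)%C.
Proof.
intros Hm Hy. symmetry.
apply (RInt_Chasles (V := C_R_CompleteNormedModule)); apply ex_RInt_segment; try lra;
intros t Ht; apply continuous_on_hline, Hg; split; simpl; lra.
Qed.

Lemma vline_integral_split (m x : R) : c <= m <= d -> a <= x <= b ->
  vline_integral g x c d = (vline_integral g x c m + vline_integral g x m d)%C.
Proof.
intros Hm Hy. symmetry.
apply (RInt_Chasles (V := C_R_CompleteNormedModule)); apply ex_RInt_segment; try lra;
intros t Ht; apply continuous_on_vline, Hg; split; simpl; lra.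
Qed.

Lemma boundary_integral_vsplit (m : R) : a <= m <= b ->
  boundary_integral g a b c d = (boundary_integral g a m c d + boundary_integral g m b c d)%C.
Proof. intros Hm. unfold boundary_integral. rewrite !(hline_integral_split m) by lra. ring. Qed.

Lemma boundary_integral_hsplit (m : R) : c <= m <= d ->
  boundary_integral g a b c d = (boundary_integral g a b c m + boundary_integral g a b m d)%C.
Proof. intros Hm. unfold boundary_integral. rewrite !(vline_integral_split m) by lra. ring. Qed.

End Subdivision.

Lemma boundary_integral_ext (g h : C -> C) (a b c d : R) : a <= b -> c <= d ->
  (forall z, brect a b c d z -> g z = h z) ->
  boundary_integral g a b c d = boundary_integral h a b c d.
Proof.
intros ab cd H.
assert (Eh : forall y, y = c \/ y = d -> hline_integral g a b y = hline_integral h a b y).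
{ intros y Hy. apply (RInt_ext (V := C_R_CompleteNormedModule)).
  rewrite Rmin_left, Rmax_right by auto.
  intros t Ht. apply H; repeat split; simpl; lra. }
assert (Ev : forall x, x = a \/ x = b -> vline_integral g x c d = vline_integral h x c d).
{ intros y Hy. apply (RInt_ext (V := C_R_CompleteNormedModule)).
  rewrite Rmin_left, Rmax_right by auto.
  intros t Ht. apply H; repeat split; simpl; lra. }
unfold boundary_integral. rewrite !Eh, !Ev by auto. reflexivity.
Qed.

(** * Goursat's theorem *)

Record quad := Quad { ql : R; qr : R; qb : R; qt : R }.

Lemma nested_intervals (u v : nat -> R) :
  (forall n, u n <= u (S n)) -> (forall n, v (S n) <= v n) ->
  (forall n, u n <= v n) -> exists x, forall n, u n <= x <= v n.
Proof.
intros Hu Hv Huv.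
assert (Hu' : forall n k, u n <= u (n + k)%nat).
{ intros n k. induction k. - rewrite Nat.add_0_r; lra.
  - rewrite Nat.add_succ_r. specialize (Hu (n + k)%nat). lra. }
assert (Hv' : forall n k, v (n + k)%nat <= v n).
{ intros n k. induction k. - rewrite Nat.add_0_r; lra.
  - rewrite Nat.add_succ_r. specialize (Hv (n + k)%nat). lra. }
assert (Hall : forall n m, u n <= v m).
{ intros n m. specialize (Hu' n m). specialize (Hv' m n).
  specialize (Huv (n + m)%nat). rewrite (Nat.add_comm m n) in Hv'. lra. }
destruct (completeness (fun x => exists n, x = u n)) as [x [Hx1 Hx2]].
- exists (v O). intros y [n ->]. apply Hall.
- exists (u O). now exists O.
- exists x. intros n. split.
  + apply Hx1. now exists n.
  + apply Hx2. intros y [k ->]. apply Hall.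
Qed.

Lemma halving_small (l d : R) : 0 < d -> exists n, l * (/ 2) ^ n < d.
Proof.
intros Hd.
destruct (Rle_lt_dec l 0) as [Hl | Hl].
- exists O. simpl. lra.
- destruct (pow_lt_1_zero (/ 2)) with (y := d / l) as [n Hn].
  + rewrite Rabs_pos_eq; lra.
  + now apply Rdiv_lt_0_compat.
  + exists n. specialize (Hn n (Nat.le_refl n)).
    rewrite Rabs_pos_eq in Hn by (apply pow_le; lra).
    apply Rmult_lt_compat_l with (r := l) in Hn; auto.
    replace (l * (d / l)) with d in Hn by (field; lra). exact Hn.
Qed.

(** Cousin's principle in the plane: if the conclusion failed, bisection would
    give shrinking bad rectangles around a limit point. *)
Lemma rectangle_cousin (P : R -> R -> R -> R -> Prop) (a b c d : R) :
  a <= b -> c <= d ->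
  (forall a b c d, a <= b -> c <= d ->
     P a ((a + b) / 2) c ((c + d) / 2) -> P ((a + b) / 2) b c ((c + d) / 2) ->
     P a ((a + b) / 2) ((c + d) / 2) d -> P ((a + b) / 2) b ((c + d) / 2) d ->
     P a b c d) ->
  (forall x y, a <= x <= b -> c <= y <= d -> exists e, 0 < e /\
     forall a' b' c' d', a <= a' <= x -> x <= b' <= b -> c <= c' <= y -> y <= d' <= d ->
       b' - a' < e -> d' - c' < e -> P a' b' c' d') ->
  P a b c d.
Proof.
intros ab cd Hsub Hloc. apply NNPP. intros HnP.
set (bad := fun q => (a <= ql q /\ ql q <= qr q /\ qr q <= b /\
  c <= qb q /\ qb q <= qt q /\ qt q <= d) /\ ~ P (ql q) (qr q) (qb q) (qt q)).
set (half := fun q q' => bad q' /\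
  (ql q <= ql q' /\ qr q' <= qr q /\ qb q <= qb q' /\ qt q' <= qt q) /\
  (qr q' - ql q' = (qr q - ql q) / 2 /\ qt q' - qb q' = (qt q - qb q) / 2)).
assert (Hstep : forall q, bad q -> exists q', half q q').
{ intros [a' b' c' d'] [(H1 & H2 & H3 & H4 & H5 & H6) H7]. simpl in *.
  apply NNPP. intros Hno. apply H7. apply Hsub; auto.
  all: apply NNPP; intros H8; apply Hno.
  - exists (Quad a' ((a' + b') / 2) c' ((c' + d') / 2)).
    unfold half, bad; simpl; repeat split; auto; lra.
  - exists (Quad ((a' + b') / 2) b' c' ((c' + d') / 2)).
    unfold half, bad; simpl; repeat split; auto; lra.
  - exists (Quad a' ((a' + b') / 2) ((c' + d') / 2) d').
    unfold half, bad; simpl; repeat split; auto; lra.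
  - exists (Quad ((a' + b') / 2) b' ((c' + d') / 2) d').
    unfold half, bad; simpl; repeat split; auto; lra. }
set (next := fun q => epsilon (inhabits q) (half q)).
set (q := fix q n := match n with O => Quad a b c d | S n => next (q n) end).
assert (Hbad : forall n, bad (q n)).
{ induction n as [ | n IH]; simpl.
  - unfold bad; simpl; repeat split; auto; lra.
  - destruct (epsilon_spec (inhabits (q n)) (half (q n)) (Hstep _ IH)) as [H _]. exact H. }
assert (Hhalf : forall n, half (q n) (q (S n))).
{ intros n. simpl. apply epsilon_spec, Hstep, Hbad. }
destruct (nested_intervals (fun n => ql (q n)) (fun n => qr (q n))) as [x Hx].
{ intros n. destruct (Hhalf n) as (_ & H & _). lra. }
{ intros n. destruct (Hhalf n) as (_ & H & _). lra. }
{ intros n. destruct (Hbad n) as (H & _). lra. }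
destruct (nested_intervals (fun n => qb (q n)) (fun n => qt (q n))) as [y Hy].
{ intros n. destruct (Hhalf n) as (_ & H & _). lra. }
{ intros n. destruct (Hhalf n) as (_ & H & _). lra. }
{ intros n. destruct (Hbad n) as (H & _). lra. }
destruct (Hloc x y (Hx O) (Hy O)) as (e & He & HP).
assert (Hw : forall n, qr (q n) - ql (q n) = (b - a) * (/ 2) ^ n).
{ induction n as [ | n IH]; [simpl; lra | ].
  destruct (Hhalf n) as (_ & _ & H & _). rewrite H, IH. simpl pow. lra. }
assert (Hh : forall n, qt (q n) - qb (q n) = (d - c) * (/ 2) ^ n).
{ induction n as [ | n IH]; [simpl; lra | ].
  destruct (Hhalf n) as (_ & _ & _ & H). rewrite H, IH. simpl pow. lra. }
destruct (halving_small ((b - a) + (d - c)) e He) as [n Hn].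
destruct (Hbad n) as (H1 & H2). apply H2.
assert (0 < (/ 2) ^ n) by (apply pow_lt; lra).
apply HP; try (specialize (Hx n); specialize (Hy n); lra).
- rewrite Hw. nra.
- rewrite Hh. nra.
Qed.

Lemma hline_integral_const (k : C) (a b y : R) : hline_integral (fun _ => k) a b y = (RtoC (b - a) * k)%C.
Proof.
unfold hline_integral. rewrite <- scal_R_Cmult.
apply (RInt_const (V := C_R_CompleteNormedModule)).
Qed.

Lemma vline_integral_const (k : C) (x c d : R) : vline_integral (fun _ => k) x c d = (RtoC (d - c) * k)%C.
Proof.
unfold vline_integral. rewrite <- scal_R_Cmult.
apply (RInt_const (V := C_R_CompleteNormedModule)).
Qed.

Lemma boundary_integral_const (k : C) (a b c d : R) : boundary_integral (fun _ => k) a b c d = 0%C.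
Proof. unfold boundary_integral. rewrite !hline_integral_const, !vline_integral_const. ring. Qed.

Lemma hline_integral_id_shift (a b c d : R) : a <= b ->
  hline_integral (fun z => z) a b d = (hline_integral (fun z => z) a b c + RtoC (b - a) * (Ci * RtoC (d - c)))%C.
Proof.
intros ab. rewrite <- (hline_integral_const _ a b c).
rewrite <- (hline_integral_plus (fun z => z) (fun _ => Ci * RtoC (d - c))%C a b c c ab (Rle_refl c)).
- apply (RInt_ext (V := C_R_CompleteNormedModule)). intros t _.
  unfold Ci, RtoC, Cplus, Cmult; simpl. apply f_equal2; ring.
- intros z _. apply continuous_Cid.
- intros z _. apply continuous_Cconst.
- now left.
Qed.

Lemma vline_integral_id_shift (a b c d : R) : c <= d ->
  vline_integral (fun z => z) b c d = (vline_integral (fun z => z) a c d + RtoC (d - c) * RtoC (b - a))%C.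
Proof.
intros cd. rewrite <- (vline_integral_const _ a c d).
rewrite <- (vline_integral_plus (fun z => z) (fun _ => RtoC (b - a))%C a a c d (Rle_refl a) cd).
- apply (RInt_ext (V := C_R_CompleteNormedModule)). intros t _.
  unfold Ci, RtoC, Cplus, Cmult; simpl. apply f_equal2; ring.
- intros z _. apply continuous_Cid.
- intros z _. apply continuous_Cconst.
- now left.
Qed.

Lemma boundary_integral_affine (p q : C) (a b c d : R) : a <= b -> c <= d ->
  boundary_integral (fun z => p + q * z)%C a b c d = 0%C.
Proof.
intros ab cd.
rewrite (boundary_integral_plus (fun _ => p) (fun z => q * z)%C); auto.
2: intros z _; apply continuous_Cconst.
2: intros z _; apply continuous_Cmult; [apply continuous_Cconst | apply continuous_Cid].
rewrite boundary_integral_const, (boundary_integral_scal (fun z => z)); auto.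
2: intros z _; apply continuous_Cid.
unfold boundary_integral. rewrite (hline_integral_id_shift a b c d ab), (vline_integral_id_shift a b c d cd). ring.
Qed.

(** On a rectangle of perimeter [2 s] around [z], the integral of [f] differs
    from that of its affine approximation at [z], which vanishes, by [o(s ^ 2)];
    and a bound [e * s ^ 2] passes from quarters to the whole. *)
Theorem goursat (f : C -> C) (a b c d : R) : a <= b -> c <= d ->
  (forall z, crect a b c d z -> ex_derive f z) -> boundary_integral f a b c d = 0%C.
Proof.
intros ab cd Hf.
assert (Hc : ccont_on (crect a b c d) f).
{ intros z Hz. apply ex_derive_Ccontinuous. auto. }
assert (key : forall e, 0 < e -> Cmod (boundary_integral f a b c d) <= e * (((b - a) + (d - c)) ^ 2)).
{ intros e He.
  set (P := fun a' b' c' d' => a <= a' -> b' <= b -> c <= c' -> d' <= d ->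
     Cmod (boundary_integral f a' b' c' d') <= e * (((b' - a') + (d' - c')) ^ 2)).
  apply (rectangle_cousin P a b c d ab cd); unfold P; try lra.
  - clear P. intros a' b' c' d' ab' cd' H1 H2 H3 H4 La Lb Lc Ld.
    set (m := (a' + b') / 2) in *. set (n := (c' + d') / 2) in *.
    assert (Em : m = (a' + b') / 2) by reflexivity.
    assert (En : n = (c' + d') / 2) by reflexivity.
    clearbody m n.
    assert (Hcc : forall u v w x, a <= u -> v <= b -> c <= w -> x <= d -> ccont_on (crect u v w x) f).
    { intros u v w x ? ? ? ? z [Hz1 Hz2]. apply Hc. split; lra. }
    rewrite (boundary_integral_vsplit f a' b' c' d') with (m := m); try lra; [ | apply Hcc; lra].
    rewrite (boundary_integral_hsplit f a' m c' d') with (m := n); try lra; [ | apply Hcc; lra].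
    rewrite (boundary_integral_hsplit f m b' c' d') with (m := n); try lra; [ | apply Hcc; lra].
    specialize (H1 ltac:(lra) ltac:(lra) ltac:(lra) ltac:(lra)).
    specialize (H2 ltac:(lra) ltac:(lra) ltac:(lra) ltac:(lra)).
    specialize (H3 ltac:(lra) ltac:(lra) ltac:(lra) ltac:(lra)).
    specialize (H4 ltac:(lra) ltac:(lra) ltac:(lra) ltac:(lra)).
    eapply Rle_trans; [apply Cmod_triangle | ].
    eapply Rle_trans; [apply Rplus_le_compat; apply Cmod_triangle | ].
    set (s := (b' - a') + (d' - c')).
    replace (m - a' + (n - c')) with (s / 2) in H1 by (unfold s; lra).
    replace (b' - m + (n - c')) with (s / 2) in H2 by (unfold s; lra).
    replace (m - a' + (d' - n)) with (s / 2) in H3 by (unfold s; lra).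
    replace (b' - m + (d' - n)) with (s / 2) in H4 by (unfold s; lra).
    replace (e * s ^ 2) with (e * (s / 2) ^ 2 * 4) by field.
    lra.
  - intros x y Hx Hy. set (z := (x, y) : C).
    assert (Hz : ex_derive f z) by (apply Hf; split; simpl; lra).
    apply ex_derive_quotient in Hz. destruct Hz as (phi & Hphi & Hq).
    rewrite continuous_Cmod in Hphi.
    destruct (Hphi (e / 2)) as (r & Hr & Hphi'); [lra | ].
    exists (r / 2). split; [lra | ].
    intros a' b' c' d' Ha Hb Hc' Hd' H1 H2 _ _ _ _.
    assert (Hcc : ccont_on (brect a' b' c' d') f).
    { intros w [[Hz1 Hz2] _]. apply Hc. split; lra. }
    set (s := (b' - a') + (d' - c')).
    set (aff := fun w => ((f z - z * phi z) + phi z * w)%C).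
    assert (Ha' : ccont_on (brect a' b' c' d') (fun w => - (1) * aff w)%C).
    { intros w _. apply ex_derive_Ccontinuous. unfold aff.
      C_derivable. }
    assert (E : boundary_integral (fun w => f w + - (1) * aff w)%C a' b' c' d' = boundary_integral f a' b' c' d').
    { rewrite boundary_integral_plus; auto; try lra. rewrite boundary_integral_scal; try lra.
      - unfold aff. rewrite boundary_integral_affine by lra. ring.
      - intros w _. apply ex_derive_Ccontinuous. unfold aff.
        C_derivable. }
    rewrite <- E.
    replace (e * s ^ 2) with (2 * s * (e / 2 * s)) by field.
    apply boundary_integral_bound; try lra.
    + intros w Hw. apply continuous_Cplus; auto.
    + intros w [[Hw1 Hw2] _].
      assert (Hwz : Cmod (w - z)%C <= s).
      { eapply Rle_trans; [apply Cmod_le_abs | ].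
        destruct w as [w1 w2]; simpl in *. unfold Rminus in *.
        assert (Rabs (w1 + - x) <= b' - a') by (apply Rabs_le; lra).
        assert (Rabs (w2 + - y) <= d' - c') by (apply Rabs_le; lra).
        unfold s; lra. }
      replace (f w + - (1) * aff w)%C with ((phi w - phi z) * (w - z))%C
        by (unfold aff; rewrite (Hq w); ring).
      rewrite Cmod_mult. apply Rmult_le_compat; try apply Cmod_ge_0; auto.
      left. apply Hphi'. unfold s in Hwz; lra. }
apply Cmod_eq_0. apply Rle_antisym; [ | apply Cmod_ge_0].
apply le_epsilon. intros e He.
set (S := ((b - a) + (d - c)) ^ 2) in *.
assert (HS : 0 <= S) by (unfold S; nra).
assert (Hp : 0 < e / (S + 1)) by (apply Rdiv_lt_0_compat; lra).
eapply Rle_trans; [apply (key _ Hp) | ].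
rewrite Rplus_0_l. apply Rmult_le_reg_r with (S + 1); [lra | ].
replace (e / (S + 1) * S * (S + 1)) with (e * S) by (field; lra). nra.
Qed.

Lemma crect_close (a b c d x y : R) (w : C) : a <= x <= b -> c <= y <= d ->
  crect a b c d w -> Cmod (w - (x, y))%C <= (b - a) + (d - c).
Proof.
intros Hx Hy [H1 H2]. eapply Rle_trans; [apply Cmod_le_abs | ].
destruct w as [u v]; simpl in *.
unfold Rabs. destruct (Rcase_abs _), (Rcase_abs _); lra.
Qed.

(** Compactness of rectangles, for properties depending on a precision. *)
Lemma rectangle_uniform (Q : C -> R -> Prop) (a b c d : R) : a <= b -> c <= d ->
  (forall z e e', 0 < e' <= e -> Q z e -> Q z e') ->
  (forall p, crect a b c d p -> exists e, 0 < e /\ exists r, 0 < r /\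
     forall z, Cmod (z - p)%C < r -> Q z e) ->
  exists e, 0 < e /\ forall z, crect a b c d z -> Q z e.
Proof.
intros ab cd Hmono Hloc.
apply (rectangle_cousin (fun a' b' c' d' => exists e, 0 < e /\
  forall z, crect a' b' c' d' z -> Q z e) a b c d ab cd).
- clear - Hmono. intros a b c d ab cd (e1 & P1 & H1) (e2 & P2 & H2) (e3 & P3 & H3) (e4 & P4 & H4).
  set (e := Rmin (Rmin e1 e2) (Rmin e3 e4)).
  assert (He : 0 < e) by (repeat apply Rmin_pos; auto).
  assert (L : e <= Rmin e1 e2 /\ e <= Rmin e3 e4) by (split; [apply Rmin_l | apply Rmin_r]).
  generalize (Rmin_l e1 e2) (Rmin_r e1 e2) (Rmin_l e3 e4) (Rmin_r e3 e4). intros M1 M2 M3 M4.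
  exists e. split; auto. intros z [Hx Hy].
  destruct (Rle_dec (Re z) ((a + b) / 2)), (Rle_dec (Im z) ((c + d) / 2)).
  + apply Hmono with e1; [lra | apply H1; split; lra].
  + apply Hmono with e3; [lra | apply H3; split; lra].
  + apply Hmono with e2; [lra | apply H2; split; lra].
  + apply Hmono with e4; [lra | apply H4; split; lra].
- intros x y Hx Hy. destruct (Hloc (x, y)) as (e & He & r & Hr & H); [split; simpl; lra | ].
  exists (r / 2). split; [lra | ]. intros a' b' c' d' Ha Hb Hc Hd H1 H2.
  exists e. split; auto. intros z Hz. apply H.
  eapply Rle_lt_trans; [apply (crect_close a' b' c' d'); auto; lra | lra].
Qed.

Lemma crect_bounded (f : C -> C) (a b c d : R) : a <= b -> c <= d ->
  ccont_on (crect a b c d) f -> exists M, forall z, crect a b c d z -> Cmod (f z) <= M.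
Proof.
intros ab cd Hf.
(* A bound [M] is encoded as the precision [/ M]. *)
destruct (rectangle_uniform (fun z e => Cmod (f z) <= / e) a b c d ab cd) as (e & He & H).
- intros z e e' He H. eapply Rle_trans; [exact H | apply Rinv_le_contravar; lra].
- intros p Hp. assert (Hc := Hf p Hp). rewrite continuous_Cmod in Hc.
  destruct (Hc 1 Rlt_0_1) as (r & Hr & H).
  assert (H0 := Cmod_ge_0 (f p)).
  exists (/ (1 + Cmod (f p))). split; [apply Rinv_0_lt_compat; lra | ].
  exists r. split; auto. intros z Hz. rewrite Rinv_inv.
  replace (f z) with ((f z - f p) + f p)%C by ring.
  eapply Rle_trans; [apply Cmod_triangle | ]. specialize (H z Hz). lra.
- now exists (/ e).
Qed.

Lemma boundary_integral_degenerate_v (g : C -> C) (a c d : R) : boundary_integral g a a c d = 0%C.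
Proof.
unfold boundary_integral, hline_integral. rewrite !(RInt_point (V := C_R_CompleteNormedModule)).
unfold Cminus. change (@zero C_R_CompleteNormedModule) with (RtoC 0). ring.
Qed.

Lemma boundary_integral_degenerate_h (g : C -> C) (a b c : R) : boundary_integral g a b c c = 0%C.
Proof.
unfold boundary_integral, vline_integral. rewrite !(RInt_point (V := C_R_CompleteNormedModule)).
unfold Cminus. change (@zero C_R_CompleteNormedModule) with (RtoC 0). ring.
Qed.

Definition clamp (a b x : R) : R := Rmax a (Rmin b x).

Lemma clamp_spec (a b x : R) : a <= b ->
  a <= clamp a b x <= b /\ (clamp a b x = a \/ clamp a b x <= x)
  /\ (clamp a b x = b \/ x <= clamp a b x).
Proof.
intros ab. unfold clamp, Rmax, Rmin.
destruct (Rle_dec b x); destruct (Rle_dec a _); lra.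
Qed.

Lemma clamp_lip (a b x y : R) : x <= y ->
  clamp a b x <= clamp a b y /\ clamp a b y - clamp a b x <= y - x.
Proof.
intros H. unfold clamp, Rmax, Rmin.
destruct (Rle_dec b x), (Rle_dec b y);
  repeat (destruct (Rle_dec a _)); lra.
Qed.

(** Around an exceptional point the rectangle is cut into a small rectangle,
    on whose boundary the integral is at most the perimeter times a bound of
    [f], and four others that avoid the point. *)
Theorem goursat_exceptional (f : C -> C) (l : list C) : forall a b c d, a <= b -> c <= d ->
  ccont_on (crect a b c d) f ->
  (forall z, crect a b c d z -> ~ In z l -> ex_derive f z) -> boundary_integral f a b c d = 0%C.
Proof.
induction l as [ | w l IH]; intros a b c d ab cd Hc Hf.
{ apply goursat; auto. }
destruct (crect_bounded f a b c d ab cd Hc) as [M HM].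
assert (key : forall s, 0 < s -> Cmod (boundary_integral f a b c d) <= 8 * s * M).
{ intros s Hs.
  (* Clamping handles the positions of [w] near the sides or outside. *)
  set (x1 := clamp a b (Re w - s)). set (x2 := clamp a b (Re w + s)).
  set (y1 := clamp c d (Im w - s)). set (y2 := clamp c d (Im w + s)).
  destruct (clamp_spec a b (Re w - s) ab) as (X1 & X2 & X3).
  destruct (clamp_spec a b (Re w + s) ab) as (X4 & X5 & X6).
  destruct (clamp_lip a b (Re w - s) (Re w + s)) as (X7 & X8); [lra | ].
  destruct (clamp_spec c d (Im w - s) cd) as (Y1 & Y2 & Y3).
  destruct (clamp_spec c d (Im w + s) cd) as (Y4 & Y5 & Y6).
  destruct (clamp_lip c d (Im w - s) (Im w + s)) as (Y7 & Y8); [lra | ].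
  fold x1 in X1, X2, X3, X7, X8. fold x2 in X4, X5, X6, X7, X8.
  fold y1 in Y1, Y2, Y3, Y7, Y8. fold y2 in Y4, Y5, Y6, Y7, Y8.
  clearbody x1 x2 y1 y2.
  assert (Hcc : forall u v p q, a <= u -> v <= b -> c <= p -> q <= d -> ccont_on (crect u v p q) f).
  { intros u v p q ? ? ? ? z [Hz1 Hz2]. apply Hc. split; lra. }
  assert (Hz : forall u v p q, a <= u <= v -> v <= b -> c <= p <= q -> q <= d ->
    (v < Re w \/ Re w < u \/ q < Im w \/ Im w < p) -> boundary_integral f u v p q = 0%C).
  { intros u v p q ? ? ? ? Hw. apply IH; try lra.
    - apply Hcc; lra.
    - intros z [Hz1 Hz2] Hin. apply Hf; [split; lra | ].
      intros [E | E]; [ | now apply Hin]. subst z. lra. }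
  rewrite (boundary_integral_vsplit f a b c d cd Hc x1) by lra.
  assert (E1 : boundary_integral f a x1 c d = 0%C).
  { destruct X2 as [-> | X2]; [apply boundary_integral_degenerate_v | apply Hz; lra]. }
  rewrite E1.
  rewrite (boundary_integral_vsplit f x1 b c d) with (m := x2); try lra; [ | apply Hcc; lra].
  assert (E2 : boundary_integral f x2 b c d = 0%C).
  { destruct X6 as [-> | X6]; [apply boundary_integral_degenerate_v | apply Hz; lra]. }
  rewrite E2.
  rewrite (boundary_integral_hsplit f x1 x2 c d) with (m := y1); try lra; [ | apply Hcc; lra].
  assert (E3 : boundary_integral f x1 x2 c y1 = 0%C).
  { destruct Y2 as [-> | Y2]; [apply boundary_integral_degenerate_h | apply Hz; lra]. }
  rewrite E3.
  rewrite (boundary_integral_hsplit f x1 x2 y1 d) with (m := y2); try lra; [ | apply Hcc; lra].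
  assert (E4 : boundary_integral f x1 x2 y2 d = 0%C).
  { destruct Y6 as [-> | Y6]; [apply boundary_integral_degenerate_h | apply Hz; lra]. }
  rewrite E4.
  replace (0 + (0 + (boundary_integral f x1 x2 y1 y2 + 0) + 0))%C with (boundary_integral f x1 x2 y1 y2) by ring.
  assert (HM0 : 0 <= M).
  { eapply Rle_trans; [apply Cmod_ge_0 | apply (HM (a, c))]. split; simpl; lra. }
  apply Rle_trans with (2 * ((x2 - x1) + (y2 - y1)) * M).
  - apply boundary_integral_bound; try lra.
    + intros z [Hz' _]. revert z Hz'. apply Hcc; lra.
    + intros z [[Hz1 Hz2] _]. apply HM. split; lra.
  - apply Rmult_le_compat_r; lra. }
apply Cmod_eq_0. apply Rle_antisym; [ | apply Cmod_ge_0].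
apply le_epsilon. intros e He.
assert (HM0 : 0 <= M).
{ eapply Rle_trans; [apply Cmod_ge_0 | apply (HM (a, c))]. split; simpl; lra. }
assert (Hp : 0 < e / (8 * M + 1)) by (apply Rdiv_lt_0_compat; lra).
eapply Rle_trans; [apply (key _ Hp) | ].
rewrite Rplus_0_l. apply Rmult_le_reg_r with (8 * M + 1); [lra | ].
replace (8 * (e / (8 * M + 1)) * M * (8 * M + 1)) with (e * (8 * M)) by (field; lra). nra.
Qed.

(** * Cauchy's formula and its consequences *)

Definition orect (a b c d : R) (z : C) : Prop := a < Re z < b /\ c < Im z < d.

Lemma quotient_ex_derive (f phi : C -> C) (p z : C) :
  (forall w, f w = (f p + (w - p) * phi w)%C) -> z <> p ->
  ex_derive f z -> ex_derive phi z.
Proof.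
intros Hq Hz Hf.
assert (Hne : locally z (fun w => w - p <> 0)%C).
{ apply (locally_ne0 (fun w => w - p)%C).
  - apply ex_derive_Ccontinuous, ex_derive_Cminus; [apply ex_derive_Cid | apply ex_derive_Cconst].
  - now apply Cminus_eq_contra. }
apply ex_derive_ext_near with (fun w => (f w - f p) / (w - p))%C.
- generalize Hne. apply filter_imp. intros w Hw. rewrite (Hq w). field. exact Hw.
- apply ex_derive_Cdiv.
  + apply ex_derive_Cminus; [exact Hf | apply ex_derive_Cconst].
  + apply ex_derive_Cminus; [apply ex_derive_Cid | apply ex_derive_Cconst].
  + now apply Cminus_eq_contra.
Qed.

Lemma brect_ne (a b c d : R) (w z : C) : orect a b c d w -> brect a b c d z -> (z - w)%C <> 0%C.
Proof.
intros [H1 H2] [H3 H4] E. apply Ceq_minus in E. subst z. lra.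
Qed.

Lemma ex_derive_Cauchy_kernel (w z : C) : (z - w)%C <> 0%C -> ex_derive (fun z => / (z - w))%C z.
Proof.
intros H. apply ex_derive_Cinv; auto.
apply ex_derive_Cminus; [apply ex_derive_Cid | apply ex_derive_Cconst].
Qed.

(** The difference quotient of [f] at [w], completed by the derivative, is
    continuous and differentiable off [w :: l], so that its integral vanishes. *)
Theorem cauchy_formula (f : C -> C) (l : list C) (a b c d : R) (w : C) :
  orect a b c d w -> ccont_on (crect a b c d) f ->
  (forall z, crect a b c d z -> ~ In z l -> ex_derive f z) -> ex_derive f w ->
  boundary_integral (fun z => f z * / (z - w))%C a b c d = (f w * boundary_integral (fun z => / (z - w))%C a b c d)%C.
Proof.
intros Hw Hc Hf Hfw.
assert (ab : a <= b) by (destruct Hw; lra). assert (cd : c <= d) by (destruct Hw; lra).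
apply ex_derive_quotient in Hfw. destruct Hfw as (phi & Hphi & Hq).
assert (Hphi' : forall z, z <> w -> continuous f z -> continuous phi z).
{ intros z Hz Hfz.
  assert (Hzw := Cminus_eq_contra _ _ Hz).
  assert (Hk : continuous (fun z => / (z - w))%C z)
    by (apply ex_derive_Ccontinuous, ex_derive_Cauchy_kernel, Hzw).
  apply (continuous_ext_loc phi (fun z => (f z + - f w) * / (z - w))%C).
  - assert (Hne : locally z (fun w' => w' - w <> 0)%C).
    { apply (locally_ne0 (fun w' => w' - w)%C); auto.
      apply ex_derive_Ccontinuous, ex_derive_Cminus; [apply ex_derive_Cid | apply ex_derive_Cconst]. }
    generalize Hne. apply filter_imp. intros v Hv.
    change ((f v + - f w) * / (v - w) = phi v)%C. rewrite (Hq v). field. exact Hv.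
  - apply continuous_Cmult; auto. apply continuous_Cplus; auto using continuous_Cconst. }
assert (Hphi0 : boundary_integral phi a b c d = 0%C).
{ apply (goursat_exceptional phi (w :: l)); auto.
  - intros z Hz. destruct (Ceq_dec z w) as [-> | n]; auto.
  - intros z Hz Hin. apply (quotient_ex_derive f phi w); auto.
    + intros E. apply Hin. now left.
    + apply Hf; auto. intros E. apply Hin. now right. }
assert (Hk : ccont_on (brect a b c d) (fun z => / (z - w))%C).
{ intros z Hz. apply ex_derive_Ccontinuous, ex_derive_Cauchy_kernel.
  apply (brect_ne a b c d); auto. }
rewrite (boundary_integral_ext _ (fun z => f w * / (z - w) + phi z)%C); auto.
- rewrite boundary_integral_plus; auto.
  + rewrite Hphi0, boundary_integral_scal; auto. ring.
  + intros z Hz. apply continuous_Cmult; auto using continuous_Cconst.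
  + intros z Hz. apply Hphi'.
    * intros E. apply (brect_ne a b c d w z); auto. rewrite E. ring.
    * apply Hc. apply Hz.
- intros z Hz. rewrite (Hq z) at 1. field. apply (brect_ne a b c d); auto.
Qed.

Lemma Im_RInt_pos (g : R -> C) (a b : R) : a < b ->
  (forall t, a <= t <= b -> continuous (T := R_UniformSpace) (U := C_UniformSpace) g t) ->
  (forall t, a <= t <= b -> 0 < Im (g t)) ->
  0 < Im (RInt (V := C_R_CompleteNormedModule) g a b).
Proof.
intros ab Hc Hp.
assert (H := RInt_correct (V := C_R_CompleteNormedModule) g a b
  (ex_RInt_segment g a b (Rlt_le _ _ ab) Hc)).
apply (is_RInt_fct_extend_snd (U := R_NormedModule) (V := R_NormedModule)) in H.
assert (E : RInt (V := R_CompleteNormedModule) (fun t => Im (g t)) a b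
  = Im (RInt (V := C_R_CompleteNormedModule) g a b)) by exact (is_RInt_unique _ _ _ _ H).
rewrite <- E.
apply RInt_gt_0; auto.
- intros x Hx. apply Hp. lra.
- intros x Hx. apply (continuous_comp (V := C_UniformSpace) g snd); auto.
  destruct (g x) as [u v]. apply continuous_snd.
Qed.

Lemma Re_RInt_pos (g : R -> C) (a b : R) : a < b ->
  (forall t, a <= t <= b -> continuous (T := R_UniformSpace) (U := C_UniformSpace) g t) ->
  (forall t, a <= t <= b -> 0 < Re (g t)) ->
  0 < Re (RInt (V := C_R_CompleteNormedModule) g a b).
Proof.
intros ab Hc Hp.
assert (H := RInt_correct (V := C_R_CompleteNormedModule) g a b
  (ex_RInt_segment g a b (Rlt_le _ _ ab) Hc)).
apply (is_RInt_fct_extend_fst (U := R_NormedModule) (V := R_NormedModule)) in H.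
assert (E : RInt (V := R_CompleteNormedModule) (fun t => Re (g t)) a b
  = Re (RInt (V := C_R_CompleteNormedModule) g a b)) by exact (is_RInt_unique _ _ _ _ H).
rewrite <- E.
apply RInt_gt_0; auto.
- intros x Hx. apply Hp. lra.
- intros x Hx. apply (continuous_comp (V := C_UniformSpace) g fst); auto.
  destruct (g x) as [u v]. apply continuous_fst.
Qed.

Lemma Im_Cinv_pos (s : R) (z : C) : 0 < s * - Im z -> 0 < Im (RtoC s * / z)%C.
Proof.
destruct z as [x y]. simpl. intros H.
assert (Hy : y <> 0) by (intros ->; lra).
assert (Hp : 0 < x * (x * 1) + y * (y * 1)).
{ generalize (Rsqr_pos_lt _ Hy) (Rle_0_sqr x). unfold Rsqr. lra. }
replace (s * (- y / (x * (x * 1) + y * (y * 1))) + 0 * (x / (x * (x * 1) + y * (y * 1))))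
  with (s * - y / (x * (x * 1) + y * (y * 1))) by (field; lra).
now apply Rdiv_lt_0_compat.
Qed.

Lemma Re_Cinv_pos (s : R) (z : C) : 0 < s * Re z -> 0 < Re (RtoC s * / z)%C.
Proof.
destruct z as [x y]. simpl. intros H.
assert (Hy : x <> 0) by (intros ->; lra).
assert (Hp : 0 < x * (x * 1) + y * (y * 1)).
{ generalize (Rsqr_pos_lt _ Hy) (Rle_0_sqr y). unfold Rsqr. lra. }
replace (s * (x / (x * (x * 1) + y * (y * 1))) - 0 * (- y / (x * (x * 1) + y * (y * 1))))
  with (s * x / (x * (x * 1) + y * (y * 1))) by (field; lra).
now apply Rdiv_lt_0_compat.
Qed.

(** Each side contributes to the imaginary part the angle under which it is
    seen from [w]. *)
Lemma cauchy_kernel_ne0 (a b c d : R) (w : C) : orect a b c d w ->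
  boundary_integral (fun z => / (z - w))%C a b c d <> 0%C.
Proof.
intros Hw.
assert (Hk : ccont_on (brect a b c d) (fun z => / (z - w))%C).
{ intros z Hz. apply ex_derive_Ccontinuous, ex_derive_Cauchy_kernel.
  apply (brect_ne a b c d); auto. }
destruct w as [w1 w2]. destruct Hw as [Hw1 Hw2]; simpl in Hw1, Hw2.
set (k := fun z => (/ (z - (w1, w2)))%C) in *.
assert (Hh : forall s y, c <= y <= d -> (y = c \/ y = d) ->
   0 < s * (w2 - y) -> 0 < Im (RtoC s * hline_integral k a b y)%C).
{ intros s y Hy Hy' Hs. unfold hline_integral.
  assert (Hc : forall t, a <= t <= b ->
    continuous (T := R_UniformSpace) (U := C_UniformSpace) (fun t => k (t, y)) t).
  { intros t Ht; apply continuous_on_hline, Hk; repeat split; simpl; lra. }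
  rewrite <- (RInt_Cmult_l (fun t => k (t, y)) a b) by (try lra; exact Hc).
  apply Im_RInt_pos; try lra.
  - intros t Ht.
    apply (continuous_comp (U := R_UniformSpace) (V := C_UniformSpace) (W := C_UniformSpace)
      (fun t => k (t, y)) (fun z => RtoC s * z)%C); auto.
    apply continuous_Cmult; [apply continuous_Cconst | apply continuous_Cid].
  - intros t Ht. apply Im_Cinv_pos. simpl. nra. }
assert (Hv : forall s x, a <= x <= b -> (x = a \/ x = b) ->
   0 < s * (x - w1) -> 0 < Re (RtoC s * vline_integral k x c d)%C).
{ intros s x Hx Hx' Hs. unfold vline_integral.
  assert (Hc : forall t, c <= t <= d ->
    continuous (T := R_UniformSpace) (U := C_UniformSpace) (fun t => k (x, t)) t).
  { intros t Ht; apply continuous_on_vline, Hk; repeat split; simpl; lra. }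
  rewrite <- (RInt_Cmult_l (fun t => k (x, t)) c d) by (try lra; exact Hc).
  apply Re_RInt_pos; try lra.
  - intros t Ht.
    apply (continuous_comp (U := R_UniformSpace) (V := C_UniformSpace) (W := C_UniformSpace)
      (fun t => k (x, t)) (fun z => RtoC s * z)%C); auto.
    apply continuous_Cmult; [apply continuous_Cconst | apply continuous_Cid].
  - intros t Ht. apply Re_Cinv_pos. simpl. nra. }
intros E. apply (f_equal Im) in E. unfold boundary_integral in E.
specialize (Hh 1 c ltac:(lra) ltac:(auto) ltac:(lra)) as H1.
specialize (Hh (-1) d ltac:(lra) ltac:(auto) ltac:(lra)) as H2.
specialize (Hv 1 b ltac:(lra) ltac:(auto) ltac:(lra)) as H3.
specialize (Hv (-1) a ltac:(lra) ltac:(auto) ltac:(lra)) as H4.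
destruct (hline_integral k a b c), (hline_integral k a b d), (vline_integral k a c d), (vline_integral k b c d).
simpl in *. lra.
Qed.

Lemma ex_derive_Cpow (f : C -> C) (z : C) (n : nat) :
  ex_derive f z -> ex_derive (fun w => Cpow (f w) n) z.
Proof.
intros H. induction n as [ | n IH]; simpl.
- apply ex_derive_Cconst.
- now apply ex_derive_Cmult.
Qed.

Lemma brect_dist (a b c d : R) (w z : C) (r : R) :
  a + r <= Re w <= b - r -> c + r <= Im w <= d - r -> brect a b c d z -> r <= Cmod (z - w)%C.
Proof.
intros H1 H2 [_ H].
assert (K1 := re_le_Cmod (z - w)). assert (K2 := im_le_Cmod (z - w)).
destruct z as [x y], w as [u v]; simpl in *.
revert K1 K2. unfold Rabs. destruct (Rcase_abs _), (Rcase_abs _); lra.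
Qed.

(** Cauchy's formula bounds [f w] by a constant times the maximum of [f] on
    the boundary; the constant becomes 1 on applying this to the powers of [f]. *)
Theorem maximum_principle (f : C -> C) (a b c d M : R) :
  (forall z, crect a b c d z -> ex_derive f z) ->
  (forall z, brect a b c d z -> Cmod (f z) <= M) ->
  forall w, crect a b c d w -> Cmod (f w) <= M.
Proof.
intros Hf HM w Hw.
destruct (classic (orect a b c d w)) as [Ho | Ho].
2: { apply HM. split; auto. unfold orect, crect in *.
     destruct (Req_dec (Re w) a); auto. destruct (Req_dec (Re w) b); auto.
     destruct (Req_dec (Im w) c); auto. destruct (Req_dec (Im w) d); auto.
     exfalso. apply Ho. lra. }
assert (ab : a <= b) by (destruct Ho; lra). assert (cd : c <= d) by (destruct Ho; lra).
assert (HM0 : 0 <= M).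
{ eapply Rle_trans; [apply Cmod_ge_0 | apply (HM (a, c))]. repeat split; simpl; lra. }
destruct (Rle_lt_dec (Cmod (f w)) M) as [H | Hlt]; auto. exfalso.
set (k := boundary_integral (fun z => / (z - w))%C a b c d).
assert (Hk : 0 < Cmod k) by (apply Cmod_gt_0, cauchy_kernel_ne0; auto).
assert (Hr : exists r, 0 < r /\ a + r <= Re w <= b - r /\ c + r <= Im w <= d - r).
{ exists (Rmin (Rmin (Re w - a) (b - Re w)) (Rmin (Im w - c) (d - Im w))).
  destruct Ho as [Ho1 Ho2].
  split; [repeat apply Rmin_pos; lra | ].
  generalize (Rmin_l (Rmin (Re w - a) (b - Re w)) (Rmin (Im w - c) (d - Im w)))
   (Rmin_r (Rmin (Re w - a) (b - Re w)) (Rmin (Im w - c) (d - Im w)))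
   (Rmin_l (Re w - a) (b - Re w)) (Rmin_r (Re w - a) (b - Re w))
   (Rmin_l (Im w - c) (d - Im w)) (Rmin_r (Im w - c) (d - Im w)). lra. }
destruct Hr as (r & Hr & Hr1 & Hr2).
assert (Hkc : ccont_on (brect a b c d) (fun z => / (z - w))%C).
{ intros z Hz. apply ex_derive_Ccontinuous, ex_derive_Cauchy_kernel.
  apply (brect_ne a b c d); auto. }
set (K := 2 * ((b - a) + (d - c)) * / r).
assert (HK : 0 <= K).
{ apply Rmult_le_pos; [lra | ]. left. now apply Rinv_0_lt_compat. }
set (x := Cmod (f w)) in *.
assert (Hn : forall n, x ^ n * Cmod k <= K * M ^ n).
{ intros n.
  assert (Hfn : forall z, crect a b c d z -> ex_derive (fun z => Cpow (f z) n) z).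
  { intros z Hz. apply ex_derive_Cpow. auto. }
  unfold x. rewrite <- Cmod_pow, <- Cmod_mult. unfold k.
  rewrite <- (cauchy_formula (fun z => Cpow (f z) n) nil a b c d w); auto.
  2: { intros z Hz. apply ex_derive_Ccontinuous. auto. }
  unfold K. rewrite Rmult_assoc. apply boundary_integral_bound; auto.
  - intros z Hz. apply continuous_Cmult; auto.
    apply ex_derive_Ccontinuous, Hfn, Hz.
  - intros z Hz. rewrite Cmod_mult, Cmod_pow, Rmult_comm.
    rewrite Cmod_inv by (apply (brect_ne a b c d); auto).
    apply Rmult_le_compat.
    + left. apply Rinv_0_lt_compat. apply Cmod_gt_0. apply (brect_ne a b c d); auto.
    + apply pow_le, Cmod_ge_0.
    + apply Rinv_le_contravar; auto. apply (brect_dist a b c d); auto.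
    + apply pow_incr. split; [apply Cmod_ge_0 | auto]. }
assert (Hx : 0 < x) by lra.
destruct (pow_lt_1_zero (M / x)) with (y := Cmod k / (K + 1)) as [n Hn'].
- rewrite Rabs_pos_eq.
  + apply Rmult_lt_reg_r with x; auto. unfold Rdiv. rewrite Rmult_assoc, Rinv_l; lra.
  + apply Rmult_le_pos; auto. left. now apply Rinv_0_lt_compat.
- apply Rdiv_lt_0_compat; lra.
- specialize (Hn' n (Nat.le_refl n)). specialize (Hn n).
  assert (Hq : 0 <= (M / x) ^ n).
  { apply pow_le. apply Rmult_le_pos; auto. left. now apply Rinv_0_lt_compat. }
  rewrite Rabs_pos_eq in Hn' by exact Hq.
  set (q := (M / x) ^ n) in *.
  assert (E : M ^ n = q * x ^ n).
  { unfold q. rewrite <- Rpow_mult_distr. f_equal. field. lra. }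
  rewrite E in Hn.
  assert (Hxn : 0 < x ^ n) by now apply pow_lt.
  assert (H1 : Cmod k <= K * q).
  { apply Rmult_le_reg_l with (x ^ n); auto. lra. }
  assert (H2 : q * (K + 1) < Cmod k).
  { apply Rmult_lt_compat_r with (r := K + 1) in Hn'; [ | lra].
    replace (Cmod k / (K + 1) * (K + 1)) with (Cmod k) in Hn' by (field; lra). exact Hn'. }
  nra.
Qed.

(** The square of half side [r] around [p]: closed, open or its boundary
    according to [P]. *)
Definition sqrect (P : R -> R -> R -> R -> C -> Prop) (p : C) (r : R) : C -> Prop :=
  P (Re p - r) (Re p + r) (Im p - r) (Im p + r).

Lemma crect_Cmod (p z : C) (r : R) : sqrect crect p r z -> Cmod (z - p)%C <= 2 * r.
Proof.
intros [H1 H2]. eapply Rle_trans; [apply Cmod_le_abs | ].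
destruct z as [x y], p as [u v]; simpl in *.
unfold Rabs. destruct (Rcase_abs _), (Rcase_abs _); lra.
Qed.

Lemma Cmod_orect (p z : C) (r : R) : Cmod (z - p)%C < r -> sqrect orect p r z.
Proof.
intros H. assert (K1 := re_le_Cmod (z - p)). assert (K2 := im_le_Cmod (z - p)).
destruct z as [x y], p as [u v]; simpl in *.
assert (H1 : Rabs (x + - u) < r) by lra. assert (H2 : Rabs (y + - v) < r) by lra.
apply Rabs_def2 in H1, H2. unfold sqrect, orect; simpl. lra.
Qed.

(** Cauchy integrals are differentiable off the contour: expand
    [/ (z - w)] to second order in [w - p]. *)
Lemma cauchy_integral_ex_derive (g : C -> C) (p : C) (s : R) : 0 < s ->
  ccont_on (sqrect crect p s) g ->
  ex_derive (fun w => boundary_integral (fun z => g z * / (z - w))%C (Re p - s) (Re p + s) (Im p - s) (Im p + s)) p.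
Proof.
intros Hs Hg.
set (a := Re p - s). set (b := Re p + s). set (c := Im p - s). set (d := Im p + s).
assert (ab : a <= b) by (unfold a, b; lra). assert (cd : c <= d) by (unfold c, d; lra).
assert (Epa : Re p = a + s /\ Re p = b - s /\ Im p = c + s /\ Im p = d - s)
  by (unfold a, b, c, d; lra).
unfold sqrect in Hg. fold a b c d in Hg. clearbody a b c d.
destruct (crect_bounded g a b c d ab cd Hg) as [B HB].
assert (Hg' : ccont_on (brect a b c d) g) by (intros z Hz; apply Hg, Hz).
assert (Hbd : forall w z, Cmod (w - p)%C < s / 2 -> brect a b c d z -> s / 2 <= Cmod (z - w)%C).
{ intros w z Hw Hz. apply Cmod_orect in Hw. destruct Hw as [H1 H2].
  apply (brect_dist a b c d); auto; lra. }
assert (Hne : forall w z, Cmod (w - p)%C < s / 2 -> brect a b c d z -> (z - w)%C <> 0%C).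
{ intros w z Hw Hz. apply Cmod_gt_0. specialize (Hbd w z Hw Hz). lra. }
assert (Hpp : Cmod (p - p)%C < s / 2).
{ replace (p - p)%C with (RtoC 0) by ring. rewrite Cmod_0. lra. }
(* The remainder of the expansion, divided by [(w - p) ^ 2]. *)
set (kern := fun w z => (g z * (/ (z - w) * (/ (z - p) * / (z - p))))%C).
assert (Hk1 : forall w, Cmod (w - p)%C < s / 2 -> ccont_on (brect a b c d) (fun z => / (z - w))%C).
{ intros w Hw z Hz. apply ex_derive_Ccontinuous, ex_derive_Cauchy_kernel. auto. }
assert (Hk : forall w, Cmod (w - p)%C < s / 2 -> ccont_on (brect a b c d) (kern w)).
{ intros w Hw z Hz. unfold kern.
  apply (continuous_Cmult g (fun z => / (z - w) * (/ (z - p) * / (z - p)))%C); auto.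
  apply (continuous_Cmult (fun z => / (z - w))%C (fun z => / (z - p) * / (z - p))%C);
    [apply (Hk1 w); auto | ].
  apply (continuous_Cmult (fun z => / (z - p))%C (fun z => / (z - p))%C); apply (Hk1 p); auto. }
set (E := fun w => boundary_integral (kern w) a b c d).
assert (HE : forall w, Cmod (w - p)%C < s / 2 ->
  Cmod (E w) <= 2 * ((b - a) + (d - c)) * (B * (2 / s * (2 / s * (2 / s))))).
{ intros w Hw. apply (boundary_integral_bound (kern w) a b c d ab cd (Hk w Hw)).
  intros z Hz. unfold kern. rewrite !Cmod_mult, !Cmod_inv by auto.
  assert (Hi : forall v, Cmod (v - p)%C < s / 2 -> 0 <= / Cmod (z - v)%C <= 2 / s).
  { intros v Hv. specialize (Hbd v z Hv Hz). split.
    - left; apply Rinv_0_lt_compat; lra.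
    - replace (2 / s) with (/ (s / 2)) by (field; lra). apply Rinv_le_contravar; lra. }
  assert (I1 := Hi w Hw). assert (I2 := Hi p Hpp).
  assert (I3 : 0 < 2 / s) by (apply Rdiv_lt_0_compat; lra).
  apply Rmult_le_compat; try apply Cmod_ge_0; try (apply HB; apply Hz).
  { repeat apply Rmult_le_pos; lra. }
  apply Rmult_le_compat; try lra. { apply Rmult_le_pos; lra. }
  apply Rmult_le_compat; lra. }
set (J := fun w => boundary_integral (fun z => g z * / (z - w))%C a b c d).
set (K := boundary_integral (fun z => g z * (/ (z - p) * / (z - p)))%C a b c d).
assert (Hk2 : ccont_on (brect a b c d) (fun z => g z * (/ (z - p) * / (z - p)))%C).
{ intros z Hz. apply (continuous_Cmult g (fun z => / (z - p) * / (z - p))%C); auto.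
  apply (continuous_Cmult (fun z => / (z - p))%C (fun z => / (z - p))%C); apply (Hk1 p); auto. }
assert (Hk3 : forall w, Cmod (w - p)%C < s / 2 -> ccont_on (brect a b c d) (fun z => g z * / (z - w))%C).
{ intros w Hw z Hz. apply (continuous_Cmult g (fun z => / (z - w))%C); auto. apply (Hk1 w); auto. }
assert (HJ : forall w, Cmod (w - p)%C < s / 2 -> J w = (J p + (w - p) * (K + (w - p) * E w))%C).
{ intros w Hw. unfold J.
  rewrite (boundary_integral_ext _ (fun z => g z * / (z - p) + (w - p) * (g z * (/ (z - p) * / (z - p)) + (w - p) * kern w z))%C); auto.
  - assert (Hk4 : ccont_on (brect a b c d) (fun z => (w - p) * kern w z)%C).
    { intros z Hz. apply (continuous_Cmult (fun _ => w - p)%C (kern w)); auto using continuous_Cconst.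
      apply Hk; auto. }
    assert (Hk5 : ccont_on (brect a b c d) (fun z => g z * (/ (z - p) * / (z - p)) + (w - p) * kern w z)%C).
    { intros z Hz. apply (continuous_Cplus (fun z => g z * (/ (z - p) * / (z - p)))%C
        (fun z => (w - p) * kern w z)%C); auto. }
    rewrite (boundary_integral_plus (fun z => g z * / (z - p))%C); auto.
    + rewrite boundary_integral_scal, boundary_integral_plus, boundary_integral_scal; auto.
    + intros z Hz. apply (continuous_Cmult (fun _ => w - p)%C); auto using continuous_Cconst.
  - intros z Hz. unfold kern. field. split; auto. }
apply ex_derive_ext_near with (fun w => J p + (w - p) * (K + (w - p) * E w))%C.
{ apply locally_Cmod. exists (s / 2). split; [lra | ]. intros w Hw. symmetry. now apply HJ. }
apply ex_derive_quotient. exists (fun w => K + (w - p) * E w)%C. split.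
2: { intros w. replace (p - p)%C with (RtoC 0) by ring. ring. }
apply continuous_Cmod. intros e He.
set (B' := 2 * ((b - a) + (d - c)) * (B * (2 / s * (2 / s * (2 / s))))) in *.
assert (HB' : 0 <= B').
{ eapply Rle_trans; [ | apply (HE p Hpp)]. apply Cmod_ge_0. }
exists (Rmin (s / 2) (e / (B' + 1))).
split; [apply Rmin_pos; [lra | apply Rdiv_lt_0_compat; lra] | ].
intros w Hw.
assert (Hw1 : Cmod (w - p)%C < s / 2) by (eapply Rlt_le_trans; [exact Hw | apply Rmin_l]).
assert (Hw2 : Cmod (w - p)%C < e / (B' + 1)) by (eapply Rlt_le_trans; [exact Hw | apply Rmin_r]).
replace (K + (w - p) * E w - (K + (p - p) * E p))%C with ((w - p) * E w)%C by ring.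
rewrite Cmod_mult.
assert (H1 := HE w Hw1).
apply Rmult_lt_compat_r with (r := B' + 1) in Hw2; [ | lra].
replace (e / (B' + 1) * (B' + 1)) with e in Hw2 by (field; lra).
generalize (Cmod_ge_0 (w - p)%C) (Cmod_ge_0 (E w)). nra.
Qed.

(** On a small square around [p], Cauchy's formula at the points [w <> p]
    expresses [f w] as the quotient of the Cauchy integrals of [f] and of 1, both
    of which are differentiable at [p] as well. *)
Theorem removable_singularity (f : C -> C) (p : C) (r : R) : 0 < r ->
  continuous f p ->
  (forall z, Cmod (z - p)%C < r -> z <> p -> ex_derive f z) -> ex_derive f p.
Proof.
intros Hr Hc Hf. set (s := r / 4).
assert (Hs : 0 < s) by (unfold s; lra).
assert (Hsub : forall z, sqrect crect p s z -> Cmod (z - p)%C < r).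
{ intros z Hz. eapply Rle_lt_trans; [apply crect_Cmod, Hz | unfold s; lra]. }
assert (Hfc : ccont_on (sqrect crect p s) f).
{ intros z Hz. destruct (Ceq_dec z p) as [-> | n]; auto. apply ex_derive_Ccontinuous. auto. }
set (J := fun (g : C -> C) w =>
  boundary_integral (fun z => g z * / (z - w))%C (Re p - s) (Re p + s) (Im p - s) (Im p + s)).
assert (H1 : ex_derive (J f) p) by exact (cauchy_integral_ex_derive f p s Hs Hfc).
assert (H2 : ex_derive (J (fun _ => 1%C)) p).
{ apply (cauchy_integral_ex_derive (fun _ => 1%C) p s Hs). intros z _. apply continuous_Cconst. }
assert (Hk : forall w, sqrect orect p s w -> J (fun _ => 1%C) w <> 0%C).
{ intros w Hw. unfold J. rewrite (boundary_integral_ext _ (fun z => / (z - w))%C); try lra.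
  - apply cauchy_kernel_ne0; auto.
  - intros z _. ring. }
assert (Hp : sqrect orect p s p).
{ unfold sqrect, orect. lra. }
assert (H3 : ex_derive (fun w => J f w / J (fun _ => 1%C) w)%C p).
{ apply (ex_derive_Cdiv (J f) (J (fun _ => 1%C))); auto. }
assert (E : forall w, Cmod (w - p)%C < s -> w <> p -> (J f w / J (fun _ => 1) w)%C = f w).
{ intros w Hw Hwp. apply Cmod_orect in Hw.
  unfold J at 1. rewrite (cauchy_formula f (p :: nil)); auto.
  - rewrite (boundary_integral_ext (fun z => / (z - w))%C (fun z => 1 * / (z - w))%C); try lra.
    + fold (J (fun _ => 1%C) w). field. auto.
    + intros z _. ring.
  - intros z Hz Hin. apply Hf; auto. intros Ez. apply Hin. now left.
  - apply Hf; auto. apply Hsub. destruct Hw; split; lra. }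
pose (F := fun w => (J f w / J (fun _ => 1) w)%C).
change (ex_derive F p) in H3.
assert (Ep : F p = f p).
{ assert (HFc := ex_derive_Ccontinuous _ _ H3).
  rewrite continuous_Cmod in HFc, Hc.
  apply Ceq_minus, Cmod_eq_0, Rle_antisym; [ | apply Cmod_ge_0].
  apply le_epsilon. intros e He.
  destruct (HFc (e / 2)) as (d1 & Hd1 & K1); [lra | ].
  destruct (Hc (e / 2)) as (d2 & Hd2 & K2); [lra | ].
  set (d := Rmin s (Rmin d1 d2)).
  assert (Hd : 0 < d) by (repeat apply Rmin_pos; auto).
  assert (D1 : d <= s) by apply Rmin_l.
  assert (D2 : d <= d1) by (eapply Rle_trans; [apply Rmin_r | apply Rmin_l]).
  assert (D3 : d <= d2) by (eapply Rle_trans; [apply Rmin_r | apply Rmin_r]).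
  destruct (Cmod_shift_right p (d / 2)) as [Hw Hwp]; [lra | ].
  set (w := (p + RtoC (d / 2))%C) in *.
  specialize (K1 w ltac:(lra)). specialize (K2 w ltac:(lra)).
  specialize (E w ltac:(lra) Hwp). change (Cmod (F w - F p)%C < e / 2) in K1. change (F w = f w) in E. rewrite E in K1.
  replace (F p - f p)%C with (- (f w - F p) + (f w - f p))%C by ring.
  eapply Rle_trans; [apply Cmod_triangle | ]. rewrite Cmod_opp. lra. }
apply ex_derive_ext_near with F; auto.
apply locally_Cmod. exists s. split; auto. intros w Hw.
destruct (Ceq_dec w p) as [-> | n]; [exact Ep | exact (E w Hw n)].
Qed.

(** The difference quotient is differentiable at [p] too, by
    [removable_singularity]. *)
Lemma divide_out (f : C -> C) (D : C -> Prop) (p : C) :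
  (forall z, D z -> ex_derive f z) -> locally p D ->
  exists g : C -> C, (forall z, D z -> ex_derive g z) /\
    forall z, f z = (f p + (z - p) * g z)%C.
Proof.
intros Hf HD. assert (Hfp : ex_derive f p) by (apply Hf, locally_singleton, HD).
apply ex_derive_quotient in Hfp. destruct Hfp as (phi & Hphi & Hq).
assert (Hd : forall z, D z -> z <> p -> ex_derive phi z).
{ intros z Hz Hzp. apply (quotient_ex_derive f phi p); auto. }
exists phi. split; auto. intros z Hz.
destruct (Ceq_dec z p) as [-> | n]; auto.
apply locally_Cmod in HD. destruct HD as (r & Hr & HD).
apply (removable_singularity phi p r); auto.
Qed.

Lemma locally_crect (c p : C) (r R : R) : r < R -> sqrect crect c r p ->
  locally p (sqrect crect c R).
Proof.
intros Hr [H1 H2]. apply locally_Cmod. exists (R - r). split; [lra | ].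
intros w Hw. apply Cmod_orect in Hw. destruct Hw as [H3 H4].
unfold sqrect, crect. lra.
Qed.

(** Newton interpolation, splitting off the points [p i] one at a time. On the
    boundary of the large square, of half side [17 r], [z - p i] is at least
    [16 r], so that a division by it multiplies the bound [M] by at most
    [2 / (16 r)], by the maximum principle; on the small square it is at most
    [4 r]. Each point thus gains a factor [/ 2]. *)
Lemma small_at_points (r d : R) : 0 < r -> 0 < d -> forall N, exists K, 0 <= K /\
  forall (c : C) (f : C -> C) (M m : R) (p : nat -> C), 0 <= m ->
  (forall z, sqrect crect c (17 * r) z -> ex_derive f z) ->
  (forall z, sqrect crect c (17 * r) z -> Cmod (f z) <= M) ->
  (forall i, (i < N)%nat -> sqrect crect c r (p i) /\ Cmod (f (p i)) <= m) ->
  (forall i j, (i < j < N)%nat -> d <= Cmod (p j - p i)%C) ->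
  forall z, sqrect crect c r z -> Cmod (f z) <= (/ 2) ^ N * M + K * m.
Proof.
intros Hr Hd. induction N as [ | N (K & HK & IH)].
{ exists 0. split; [lra | ]. intros c f M m p Hm Hf HM _ _ z [H1 H2].
  simpl pow. assert (Cmod (f z) <= M); [ | lra].
  apply HM. unfold sqrect, crect. lra. }
exists (1 + 4 * r * (K * (2 / d))).
assert (H2d : 0 < 2 / d) by (apply Rdiv_lt_0_compat; lra).
split.
{ assert (0 <= K * (2 / d)) by nra. nra. }
intros c f M m p Hm Hf HM Hp Hsep z Hz.
destruct (Hp O) as [Hp0 Hfp0]; [lia | ].
destruct (divide_out f (sqrect crect c (17 * r)) (p O) Hf) as (g & Hg & Hq).
{ apply (locally_crect c (p O) r); [lra | exact Hp0]. }
assert (HMg : forall z, sqrect crect c (17 * r) z -> Cmod (g z) <= M / (8 * r)).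
{ apply (maximum_principle g); auto.
  intros w Hw.
  assert (H16 : 16 * r <= Cmod (w - p O)%C).
  { destruct Hp0 as [H1 H2].
    apply (brect_dist _ _ _ _ (p O) w (16 * r)) in Hw; auto; lra. }
  assert (Hne : (w - p O)%C <> 0%C) by (apply Cmod_gt_0; lra).
  assert (E : g w = ((f w - f (p O)) / (w - p O))%C) by (rewrite (Hq w); field; exact Hne).
  rewrite E, Cmod_div by exact Hne.
  assert (HfM : Cmod (f w - f (p O))%C <= 2 * M).
  { unfold Cminus. eapply Rle_trans; [apply Cmod_triangle | ]. rewrite Cmod_opp.
    assert (Cmod (f w) <= M) by (apply HM, Hw).
    assert (Cmod (f (p O)) <= M).
    { apply HM. destruct Hp0 as [H1 H2]. unfold sqrect, crect; lra. }
    lra. }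
  apply Rle_trans with (2 * M / (16 * r)); [ | right; field; lra].
  unfold Rdiv. apply Rmult_le_compat; auto using Cmod_ge_0.
  - left. apply Rinv_0_lt_compat. lra.
  - apply Rinv_le_contravar; lra. }
assert (IH' : Cmod (g z) <= (/ 2) ^ N * (M / (8 * r)) + K * (2 / d * m)).
{ apply (IH c g (M / (8 * r)) (2 / d * m) (fun i => p (S i))); auto.
  - nra.
  - intros i Hi. destruct (Hp (S i)) as [Hp1 Hp2]; [lia | ]. split; auto.
    assert (Hs : d <= Cmod (p (S i) - p O)%C) by (apply Hsep; lia).
    assert (Hne : (p (S i) - p O)%C <> 0%C) by (apply Cmod_gt_0; lra).
    assert (E : g (p (S i)) = ((f (p (S i)) - f (p O)) / (p (S i) - p O))%C)
      by (rewrite (Hq (p (S i))); field; exact Hne).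
    rewrite E, Cmod_div by exact Hne.
    apply Rle_trans with (2 * m / d); [ | right; field; lra].
    unfold Rdiv. apply Rmult_le_compat; auto using Cmod_ge_0.
    + left. apply Rinv_0_lt_compat. lra.
    + unfold Cminus. eapply Rle_trans; [apply Cmod_triangle | ]. rewrite Cmod_opp. lra.
    + apply Rinv_le_contravar; lra.
  - intros i j Hij. apply Hsep. lia. }
assert (Hz4 : Cmod (z - p O)%C <= 4 * r).
{ eapply Rle_trans; [apply Cmod_le_abs | ]. destruct Hz as [Z1 Z2], Hp0 as [P1 P2].
  destruct z as [x y], (p O) as [u v]; simpl in *.
  unfold Rabs. destruct (Rcase_abs _), (Rcase_abs _); lra. }
rewrite (Hq z). eapply Rle_trans; [apply Cmod_triangle | ]. rewrite Cmod_mult.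
apply Rle_trans with (m + 4 * r * ((/ 2) ^ N * (M / (8 * r)) + K * (2 / d * m))).
- apply Rplus_le_compat; auto. apply Rmult_le_compat; auto using Cmod_ge_0.
- right. simpl pow. field. lra.
Qed.

(** * The spherical metric *)

Definition sinv (w : sphere) : sphere :=
  match w with
  | Infty => Fin 0%C
  | Fin u => if Ceq_dec u 0%C then Infty else Fin (/ u)%C
  end.

(** The Japanese bracket, by which the chordal metric rescales distances. *)
Definition jap (u : C) : R := sqrt (1 + Cmod u ^ 2).

Lemma jap_sqr (u : C) : jap u * jap u = 1 + Cmod u ^ 2.
Proof. unfold jap. apply sqrt_sqrt. assert (H := pow2_ge_0 (Cmod u)). lra. Qed.

Lemma jap_ge_1 (u : C) : 1 <= jap u.
Proof.
unfold jap. rewrite <- sqrt_1 at 1. apply sqrt_le_1_alt. assert (H := pow2_ge_0 (Cmod u)). lra.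
Qed.

Lemma jap_ge_Cmod (u : C) : Cmod u <= jap u.
Proof.
generalize (jap_sqr u) (jap_ge_1 u) (Cmod_ge_0 u). nra.
Qed.

Lemma jap_le (u : C) : jap u <= 1 + Cmod u.
Proof.
generalize (jap_sqr u) (jap_ge_1 u) (Cmod_ge_0 u). nra.
Qed.

Lemma rho_Fin (u v : C) : rho (Fin u) (Fin v) = 2 * Cmod (u - v)%C / (jap u * jap v).
Proof. reflexivity. Qed.

Lemma rho_Fin_Infty (u : C) : rho (Fin u) Infty = 2 / jap u.
Proof. reflexivity. Qed.

Lemma rho_sym (x y : sphere) : rho x y = rho y x.
Proof.
destruct x as [u | ], y as [v | ]; try reflexivity.
rewrite !rho_Fin, Cmod_sub_sym, (Rmult_comm (jap u)). reflexivity.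
Qed.

Lemma rho_refl (x : sphere) : rho x x = 0.
Proof.
destruct x as [u | ]; [ | reflexivity].
rewrite rho_Fin. replace (u - u)%C with (RtoC 0) by ring. rewrite Cmod_0.
unfold Rdiv. ring.
Qed.

Lemma rho_ge_0 (x y : sphere) : 0 <= rho x y.
Proof.
assert (Hj : forall u, 0 < jap u) by (intros u; generalize (jap_ge_1 u); lra).
destruct x as [u | ], y as [v | ]; try rewrite rho_Fin; try (rewrite rho_sym, rho_Fin_Infty);
  try rewrite rho_Fin_Infty; try (simpl; lra).
- apply Rmult_le_pos; [generalize (Cmod_ge_0 (u - v)%C); lra | ].
  left. apply Rinv_0_lt_compat, Rmult_lt_0_compat; auto.
- left. apply Rdiv_lt_0_compat; auto; lra.
- left. apply Rdiv_lt_0_compat; auto; lra.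
Qed.

Lemma cauchy_schwarz_jap (w v : C) : Cmod (1 + Cconj w * v)%C <= jap w * jap v.
Proof.
eapply Rle_trans; [apply Cmod_triangle | ]. rewrite Cmod_1, Cmod_mult, Cmod_conj.
generalize (jap_sqr w) (jap_sqr v) (jap_ge_1 w) (jap_ge_1 v) (Cmod_ge_0 w) (Cmod_ge_0 v).
intros H1 H2 H3 H4 H5 H6.
apply Rsqr_incr_0_var; [ | nra]. unfold Rsqr.
replace (jap w * jap v * (jap w * jap v)) with ((jap w * jap w) * (jap v * jap v)) by ring.
rewrite H1, H2. generalize (pow2_ge_0 (Cmod w - Cmod v)). lra.
Qed.

(** The identity
    [(u - v) (1 + |w|^2) = (u - w) (1 + w' v) + (w - v) (1 + w' u)],
    where [w'] is the conjugate of [w],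
    turns the triangle inequality into the Cauchy-Schwarz inequality. *)
Lemma rho_triangle_Fin (u v w : C) :
  Cmod (u - v)%C * jap w <= Cmod (u - w)%C * jap v + Cmod (w - v)%C * jap u.
Proof.
apply Rmult_le_reg_r with (jap w); [generalize (jap_ge_1 w); lra | ].
rewrite Rmult_assoc, jap_sqr.
replace (Cmod (u - v)%C * (1 + Cmod w ^ 2)) with
  (Cmod ((u - w) * (1 + Cconj w * v) + (w - v) * (1 + Cconj w * u))%C).
- eapply Rle_trans; [apply Cmod_triangle | ]. rewrite !Cmod_mult.
  generalize (cauchy_schwarz_jap w v) (cauchy_schwarz_jap w u)
    (Cmod_ge_0 (u - w)%C) (Cmod_ge_0 (w - v)%C). intros H1 H2 H3 H4.
  apply (Rmult_le_compat_l _ _ _ H3) in H1. apply (Rmult_le_compat_l _ _ _ H4) in H2. lra.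
- replace ((u - w) * (1 + Cconj w * v) + (w - v) * (1 + Cconj w * u))%C
    with ((u - v) * (1 + w * Cconj w))%C by ring.
  rewrite <- Cmod2_conj, <- RtoC_plus, Cmod_mult, Cmod_R, Rabs_pos_eq; auto.
  generalize (pow2_ge_0 (Cmod w)); lra.
Qed.

Lemma jap_lip (u v : C) : jap u <= Cmod (u - v)%C + jap v.
Proof.
assert (H : Cmod u <= Cmod (u - v)%C + Cmod v).
{ replace u with ((u - v) + v)%C at 1 by ring. apply Cmod_triangle. }
generalize (jap_sqr u) (jap_sqr v) (jap_ge_1 u) (jap_ge_1 v) (Cmod_ge_0 u) (Cmod_ge_0 v)
  (jap_ge_Cmod v) (Cmod_ge_0 (u - v)%C).
intros. apply Rsqr_incr_0_var; [ | lra]. unfold Rsqr. nra.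
Qed.

Lemma rho_triangle (x y z : sphere) : rho x z <= rho x y + rho y z.
Proof.
assert (Hj : forall u, 0 < jap u) by (intros u; generalize (jap_ge_1 u); lra).
destruct x as [u | ], z as [v | ], y as [w | ];
  rewrite ?(rho_sym Infty (Fin _)), ?rho_Fin_Infty, ?rho_Fin, ?rho_refl; try lra.
- apply Rmult_le_reg_r with (jap u * jap v * jap w).
  { repeat apply Rmult_lt_0_compat; auto. }
  replace (2 * Cmod (u - v)%C / (jap u * jap v) * (jap u * jap v * jap w))
    with (2 * (Cmod (u - v)%C * jap w)) by (field; split; apply Rgt_not_eq, Hj).
  replace ((2 * Cmod (u - w)%C / (jap u * jap w) + 2 * Cmod (w - v)%C / (jap w * jap v)) *
     (jap u * jap v * jap w))
   with (2 * (Cmod (u - w)%C * jap v + Cmod (w - v)%C * jap u))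
   by (field; repeat split; apply Rgt_not_eq, Hj).
  generalize (rho_triangle_Fin u v w). lra.
- apply Rmult_le_reg_r with (jap u * jap v). { apply Rmult_lt_0_compat; auto. }
  replace (2 * Cmod (u - v)%C / (jap u * jap v) * (jap u * jap v))
    with (2 * Cmod (u - v)%C) by (field; split; apply Rgt_not_eq, Hj).
  replace ((2 / jap u + 2 / jap v) * (jap u * jap v)) with (2 * (jap u + jap v))
    by (field; split; apply Rgt_not_eq, Hj).
  assert (Cmod (u - v)%C <= Cmod u + Cmod v).
  { unfold Cminus. rewrite <- (Cmod_opp v). apply Cmod_triangle. }
  generalize (jap_ge_Cmod u) (jap_ge_Cmod v). lra.
- apply Rmult_le_reg_r with (jap u * jap w). { apply Rmult_lt_0_compat; auto. }
  replace (2 / jap u * (jap u * jap w)) with (2 * jap w) by (field; apply Rgt_not_eq, Hj).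
  replace ((2 * Cmod (u - w)%C / (jap u * jap w) + 2 / jap w) * (jap u * jap w))
    with (2 * (Cmod (u - w)%C + jap u)) by (field; split; apply Rgt_not_eq, Hj).
  generalize (jap_lip w u). rewrite Cmod_sub_sym. lra.
- apply Rmult_le_reg_r with (jap v * jap w). { apply Rmult_lt_0_compat; auto. }
  replace (2 / jap v * (jap v * jap w)) with (2 * jap w) by (field; apply Rgt_not_eq, Hj).
  replace ((2 / jap w + 2 * Cmod (w - v)%C / (jap w * jap v)) * (jap v * jap w))
    with (2 * (Cmod (w - v)%C + jap v)) by (field; split; apply Rgt_not_eq, Hj).
  generalize (jap_lip w v). lra.
- generalize (rho_ge_0 (Fin w) Infty). rewrite rho_Fin_Infty. lra.
Qed.

Lemma sinv_Fin (u : C) : u <> 0%C -> sinv (Fin u) = Fin (/ u)%C.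
Proof. intros H. simpl. destruct (Ceq_dec u 0%C); [easy | reflexivity]. Qed.

Lemma sinv_0 : sinv (Fin 0%C) = Infty.
Proof. simpl. destruct (Ceq_dec 0%C 0%C); [reflexivity | easy]. Qed.

Lemma Cinv_ne_0 (u : C) : u <> 0%C -> (/ u)%C <> 0%C.
Proof.
intros H E. apply C1_nz. rewrite <- (Cinv_r u H), E. ring.
Qed.

Lemma sinv_invol (x : sphere) : sinv (sinv x) = x.
Proof.
destruct x as [u | ].
- destruct (Ceq_dec u 0%C) as [-> | n].
  + rewrite sinv_0. reflexivity.
  + rewrite sinv_Fin, sinv_Fin; auto using Cinv_ne_0. f_equal. field. auto using C1_nz.
- simpl. destruct (Ceq_dec 0%C 0%C); easy.
Qed.

Lemma jap_inv (u : C) : u <> 0%C -> jap (/ u)%C = jap u / Cmod u.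
Proof.
intros H. assert (Hp : 0 < Cmod u) by now apply Cmod_gt_0.
generalize (jap_ge_1 u) (jap_ge_1 (/ u)%C). intros H1 H2.
apply Rsqr_inj; try lra.
{ apply Rmult_le_pos; [lra | ]. left; now apply Rinv_0_lt_compat. }
rewrite Rsqr_div'. unfold Rsqr. rewrite !jap_sqr, Cmod_inv by auto.
field. lra.
Qed.

Lemma rho_sinv (x y : sphere) : rho (sinv x) (sinv y) = rho x y.
Proof.
assert (Hj : forall u, jap u <> 0) by (intros u; generalize (jap_ge_1 u); lra).
assert (Hm : forall u : C, u <> 0%C -> Cmod u <> 0) by (intros u Hu; generalize (proj1 (Cmod_gt_0 u) Hu); lra).
assert (J0 : jap 0%C = 1).
{ unfold jap. rewrite Cmod_0. replace (1 + 0 ^ 2) with 1 by ring. apply sqrt_1. }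
assert (K : forall u : C, u <> 0%C -> rho (Fin (/ u)%C) Infty = rho (Fin u) (Fin 0%C)).
{ intros u Hu. rewrite rho_Fin_Infty, rho_Fin, jap_inv, J0 by auto.
  replace (u - 0)%C with u by ring. field. auto. }
assert (K' : forall u : C, u <> 0%C -> rho (Fin (/ u)%C) (Fin 0%C) = rho (Fin u) Infty).
{ intros u Hu. rewrite rho_Fin_Infty, rho_Fin, jap_inv, J0 by auto.
  replace (/ u - 0)%C with (/ u)%C by ring. rewrite Cmod_inv by auto. field. auto. }
assert (K0 : rho Infty (Fin 0%C) = rho (Fin 0%C) Infty) by reflexivity.
destruct x as [u | ], y as [v | ].
- destruct (Ceq_dec u 0%C) as [-> | nu], (Ceq_dec v 0%C) as [-> | nv];
    rewrite ?sinv_0, ?sinv_Fin, ?rho_refl by auto; auto.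
  + rewrite rho_sym, K by auto. apply rho_sym.
  + rewrite !rho_Fin, !jap_inv by auto.
    replace (/ u - / v)%C with ((v - u) / (u * v))%C by (field; auto).
    rewrite Cmod_div, Cmod_mult, (Cmod_sub_sym v u) by (apply Cmult_neq_0; auto).
    field. auto.
- change (sinv Infty) with (Fin 0%C).
  destruct (Ceq_dec u 0%C) as [-> | nu]; rewrite ?sinv_0, ?sinv_Fin by auto; auto.
- change (sinv Infty) with (Fin 0%C).
  destruct (Ceq_dec v 0%C) as [-> | nu]; rewrite ?sinv_0, ?sinv_Fin by auto; auto.
  rewrite rho_sym, K', rho_sym by auto. reflexivity.
- simpl sinv; rewrite !rho_refl; reflexivity.
Qed.

Lemma rho_le_Cmod (u v : C) : rho (Fin u) (Fin v) <= 2 * Cmod (u - v)%C.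
Proof.
rewrite rho_Fin. generalize (jap_ge_1 u) (jap_ge_1 v) (Cmod_ge_0 (u - v)%C). intros H1 H2 H3.
apply Rmult_le_reg_r with (jap u * jap v); [nra | ].
unfold Rdiv. rewrite Rmult_assoc, Rinv_l by nra.
assert (1 <= jap u * jap v) by nra. nra.
Qed.

Lemma Cmod_le_rho (u v : C) (A : R) : Cmod u <= A -> Cmod v <= A ->
  Cmod (u - v)%C <= (1 + A) ^ 2 * rho (Fin u) (Fin v).
Proof.
intros Hu Hv.
generalize (jap_ge_1 u) (jap_ge_1 v) (Cmod_ge_0 (u - v)%C) (jap_le u) (jap_le v)
  (Cmod_ge_0 u) (Cmod_ge_0 v).
intros H1 H2 H3 H4 H5 H6 H7.
assert (E : Cmod (u - v)%C = (jap u * jap v) * (rho (Fin u) (Fin v) / 2)).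
{ rewrite rho_Fin. field. lra. }
assert (Hr := rho_ge_0 (Fin u) (Fin v)).
rewrite E. apply Rle_trans with ((1 + A) ^ 2 * (rho (Fin u) (Fin v) / 2)).
- apply Rmult_le_compat_r; [lra | ]. nra.
- apply Rmult_le_compat_l; [apply pow2_ge_0 | lra].
Qed.

Lemma rho_0_small (x : sphere) (e : R) : e <= 1 -> rho x (Fin 0%C) < e ->
  exists u, x = Fin u /\ Cmod u <= e.
Proof.
intros He H.
assert (J0 : jap 0%C = 1).
{ unfold jap. rewrite Cmod_0. replace (1 + 0 ^ 2) with 1 by ring. apply sqrt_1. }
destruct x as [u | ].
- exists u. split; auto. rewrite rho_Fin, J0 in H.
  replace (u - 0)%C with u in H by ring.
  assert (H1 := jap_ge_1 u). assert (H2 := jap_le u). assert (H3 := Cmod_ge_0 u).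
  apply Rmult_lt_compat_r with (r := jap u) in H; [ | lra].
  replace (2 * Cmod u / (jap u * 1) * jap u) with (2 * Cmod u) in H by (field; lra).
  assert (0 < e) by nra. nra.
- rewrite rho_sym, rho_Fin_Infty, J0 in H. lra.
Qed.

Lemma rho_Infty_far (x : sphere) (m : R) : 0 < m -> m <= rho x Infty ->
  exists u, x = Fin u /\ Cmod u <= 2 / m.
Proof.
intros Hm H. destruct x as [u | ].
- exists u. split; auto. rewrite rho_Fin_Infty in H.
  assert (H1 := jap_ge_1 u). assert (H2 := jap_ge_Cmod u).
  apply Rmult_le_reg_r with m; auto.
  replace (2 / m * m) with 2 by (field; lra).
  apply Rmult_le_compat_r with (r := jap u) in H; [ | lra].
  replace (2 / jap u * jap u) with 2 in H by (field; lra). nra.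
- rewrite rho_refl in H. lra.
Qed.

Lemma rho_0_Infty : rho (Fin 0%C) Infty = 2.
Proof.
simpl. rewrite Cmod_0. replace (1 + 0 * (0 * 1)) with 1 by ring. rewrite sqrt_1. field.
Qed.

Lemma rho_zero_eq (x y : sphere) : rho x y = 0 -> x = y.
Proof.
assert (Hj : forall u, 0 < jap u) by (intros u; generalize (jap_ge_1 u); lra).
destruct x as [u | ], y as [v | ]; rewrite ?(rho_sym Infty (Fin _)), ?rho_Fin_Infty; auto; intros H.
- f_equal. apply Ceq_minus, Cmod_eq_0. assert (Hu := Cmod_le_rho u v (Rmax (Cmod u) (Cmod v)) (Rmax_l _ _) (Rmax_r _ _)).
  rewrite H in Hu. generalize (Cmod_ge_0 (u - v)%C). lra.
- exfalso. assert (0 < 2 / jap u) by (apply Rdiv_lt_0_compat; auto; lra). lra.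
- exfalso. assert (0 < 2 / jap v) by (apply Rdiv_lt_0_compat; auto; lra). lra.
Qed.

(** Closeness of a quotient [u v] to 1 means closeness on the sphere of [u] and
    the denominator [1 / v], also at the poles of the latter. *)
Lemma rho_inverse_le (u v : C) : rho (Fin u) (sinv (Fin v)) <= 2 * Cmod (u * v - 1)%C.
Proof.
assert (Hju := jap_ge_1 u). assert (Hjv := jap_ge_1 v).
destruct (Ceq_dec v 0%C) as [-> | n].
- rewrite sinv_0, rho_Fin_Infty.
  replace (u * 0 - 1)%C with (- (1))%C by ring. rewrite Cmod_m1.
  apply Rmult_le_reg_r with (jap u); [lra | ].
  unfold Rdiv. rewrite Rmult_assoc, Rinv_l by lra. lra.
- rewrite sinv_Fin, rho_Fin, jap_inv by auto.
  assert (Hv : 0 < Cmod v) by now apply Cmod_gt_0.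
  replace (u - / v)%C with ((u * v - 1) / v)%C by (field; auto).
  rewrite Cmod_div by auto. assert (H0 := Cmod_ge_0 (u * v - 1)%C).
  apply Rmult_le_reg_r with (jap u * jap v); [nra | ].
  replace (2 * (Cmod (u * v - 1)%C / Cmod v) / (jap u * (jap v / Cmod v)) * (jap u * jap v))
    with (2 * Cmod (u * v - 1)%C) by (field; lra).
  assert (1 <= jap u * jap v) by nra. nra.
Qed.

(** * Meromorphic functions *)

Definition sphere_continuous_at (f : C -> sphere) (z : C) : Prop :=
  forall e, 0 < e -> exists d, 0 < d /\ forall w, Cmod (w - z)%C < d -> rho (f w) (f z) < e.

(** Holomorphy as a map to the sphere. Contrary to meromorphy, this is
    invariant under inversion. *)
Definition sphere_holomorphic_at (f : C -> sphere) (z : C) : Prop :=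
  holomorphic_at f z \/ holomorphic_at (fun w => sinv (f w)) z.

Lemma holomorphic_at_iff (f : C -> sphere) (z : C) :
  holomorphic_at f z <->
  exists g : C -> C, locally z (fun w => f w = Fin (g w)) /\ ex_derive g z.
Proof.
split.
- intros [H1 H2]. exists (fun w => fin_part (f w)). split; auto.
  generalize H1. apply filter_imp. intros w Hw. destruct (f w); easy.
- intros (g & H1 & H2). split.
  + generalize H1. apply filter_imp. intros w ->. discriminate.
  + apply ex_derive_ext_near with g; auto.
    generalize H1. apply filter_imp. intros w ->. reflexivity.
Qed.

Lemma holomorphic_at_sinv (f : C -> sphere) (z : C) :
  holomorphic_at f z -> f z <> Fin 0%C -> holomorphic_at (fun w => sinv (f w)) z.
Proof.
rewrite !holomorphic_at_iff. intros (g & H1 & H2) Hz.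
assert (Hgz : g z <> 0%C).
{ intros E. apply Hz. rewrite (locally_singleton _ _ H1), E. reflexivity. }
exists (fun w => / g w)%C. split; [ | now apply ex_derive_Cinv].
assert (Hne := locally_ne0 g z (ex_derive_Ccontinuous _ _ H2) Hgz).
generalize (filter_and _ _ H1 Hne). apply filter_imp.
intros w [-> Hw]. now apply sinv_Fin.
Qed.

Lemma sphere_holomorphic_sinv (f : C -> sphere) (z : C) :
  sphere_holomorphic_at f z -> sphere_holomorphic_at (fun w => sinv (f w)) z.
Proof.
intros [H | H]; [right | left; exact H].
apply holomorphic_at_iff in H. destruct H as (g & H1 & H2). apply holomorphic_at_iff.
exists g. split; auto. generalize H1. apply filter_imp. intros w Hw.
now rewrite sinv_invol.
Qed.

Lemma sphere_holomorphic_finite (f : C -> sphere) (z : C) :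
  sphere_holomorphic_at f z -> f z <> Infty -> holomorphic_at f z.
Proof.
intros [H | H] Hz; auto.
assert (H' : holomorphic_at (fun w => sinv (sinv (f w))) z).
{ apply (holomorphic_at_sinv (fun w => sinv (f w))); auto.
  intros E. apply Hz. rewrite <- (sinv_invol (f z)), E. apply sinv_0. }
apply holomorphic_at_iff in H'. destruct H' as (g & H1 & H2). apply holomorphic_at_iff.
exists g. split; auto. generalize H1. apply filter_imp. intros w Hw.
now rewrite sinv_invol in Hw.
Qed.

Lemma holomorphic_sphere_continuous (f : C -> sphere) (z : C) :
  holomorphic_at f z -> sphere_continuous_at f z.
Proof.
intros H e He. apply holomorphic_at_iff in H. destruct H as (g & H1 & H2).
apply ex_derive_Ccontinuous in H2. rewrite continuous_Cmod in H2.
destruct (H2 (e / 2)) as (d & Hd & Hg); [lra | ].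
assert (Ez := locally_singleton _ _ H1).
apply locally_Cmod in H1. destruct H1 as (d' & Hd' & H1).
exists (Rmin d d'). split; [now apply Rmin_pos | ]. intros w Hw.
rewrite Ez, H1 by (eapply Rlt_le_trans; [exact Hw | apply Rmin_r]).
eapply Rle_lt_trans; [apply rho_le_Cmod | ].
specialize (Hg w (Rlt_le_trans _ _ _ Hw (Rmin_l _ _))). lra.
Qed.

Lemma sphere_holomorphic_continuous (f : C -> sphere) (z : C) :
  sphere_holomorphic_at f z -> sphere_continuous_at f z.
Proof.
intros [H | H]; apply holomorphic_sphere_continuous in H; auto.
intros e He. destruct (H e He) as (d & Hd & Hc). exists d. split; auto.
intros w Hw. rewrite <- rho_sinv. auto.
Qed.

Lemma locally'_Cmod (z : C) (P : C -> Prop) :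
  locally' z P <-> exists d, 0 < d /\ forall w, Cmod (w - z)%C < d -> w <> z -> P w.
Proof. unfold locally', within. apply locally_Cmod. Qed.

Lemma is_lim_sphere_iff (f : C -> sphere) (z : C) (l : sphere) :
  is_lim_sphere f z l <-> forall e, 0 < e -> exists d, 0 < d /\
    forall w, Cmod (w - z)%C < d -> w <> z -> rho (f w) l < e.
Proof.
split.
- intros H e He. apply locally'_Cmod. apply (H (fun x => rho x l < e)).
  exists (mkposreal e He). auto.
- intros H P [e HP]. apply locally'_Cmod.
  destruct (H e (cond_pos e)) as (d & Hd & H'). exists d. split; auto.
Qed.

Lemma is_lim_sphere_unique (f : C -> sphere) (z : C) (l l' : sphere) :
  is_lim_sphere f z l -> is_lim_sphere f z l' -> l = l'.
Proof.
rewrite !is_lim_sphere_iff. intros H H'. apply rho_zero_eq.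
apply Rle_antisym; [ | apply rho_ge_0]. apply le_epsilon. intros e He.
destruct (H (e / 2)) as (d & Hd & K); [lra | ].
destruct (H' (e / 2)) as (d' & Hd' & K'); [lra | ].
assert (Hm : 0 < Rmin d d') by now apply Rmin_pos.
destruct (Cmod_shift_right z (Rmin d d' / 2)) as [Hw Hwz]; [lra | ].
set (w := (z + RtoC (Rmin d d' / 2))%C) in *.
specialize (K w ltac:(generalize (Rmin_l d d'); lra) Hwz).
specialize (K' w ltac:(generalize (Rmin_r d d'); lra) Hwz).
generalize (rho_triangle l (f w) l'). rewrite (rho_sym l (f w)). lra.
Qed.

(** At a pole, [1 / f] extends continuously by 0, hence holomorphically. *)
Lemma meromorphic_sphere_holomorphic (D : C -> Prop) (f : C -> sphere) (z : C) :
  open D -> meromorphic_on D f -> D z -> sphere_holomorphic_at f z.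
Proof.
intros HD Hf Hz. destruct (Hf z Hz) as [H | (H1 & H2 & H3)]; [now left | right].
rewrite is_lim_sphere_iff in H3. apply locally'_Cmod in H2.
assert (HDz := HD z Hz). apply locally_Cmod in HDz.
destruct HDz as (d1 & Hd1 & K1). destruct H2 as (d2 & Hd2 & K2).
destruct (H3 1 Rlt_0_1) as (d3 & Hd3 & K3).
set (d := Rmin d1 (Rmin d2 d3)).
assert (Hd : 0 < d) by (repeat apply Rmin_pos; auto).
assert (L1 : d <= d1) by apply Rmin_l.
assert (L2 : d <= d2) by (eapply Rle_trans; [apply Rmin_r | apply Rmin_l]).
assert (L3 : d <= d3) by (eapply Rle_trans; [apply Rmin_r | apply Rmin_r]).
set (h := fun w => fin_part (sinv (f w))).
assert (Hne0 : forall w, Cmod (w - z)%C < d -> w <> z -> f w <> Fin 0%C).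
{ intros w Hw Hwz E. specialize (K3 w ltac:(lra) Hwz). rewrite E, rho_0_Infty in K3. lra. }
assert (Hfin : forall w, Cmod (w - z)%C < d -> sinv (f w) = Fin (h w)).
{ intros w Hw. unfold h. destruct (Ceq_dec w z) as [-> | n].
  - rewrite H1. reflexivity.
  - specialize (Hne0 w Hw n). destruct (f w) as [u | ]; [ | reflexivity].
    rewrite sinv_Fin; auto. intros ->. auto. }
assert (Hhol : forall w, Cmod (w - z)%C < d -> w <> z -> ex_derive h w).
{ intros w Hw n. destruct (Hf w) as [Hw' | (Hw' & _)].
  - apply K1. lra.
  - apply (holomorphic_at_sinv f w Hw'). auto.
  - exfalso. apply (K2 w); auto. lra. }
apply holomorphic_at_iff. exists h. split.
{ apply locally_Cmod. exists d. split; auto. }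
apply (removable_singularity h z d); auto.
apply continuous_Cmod. intros e He.
destruct (H3 (Rmin 1 (e / 2))) as (d4 & Hd4 & K4); [apply Rmin_pos; lra | ].
assert (Ehz : h z = 0%C) by (unfold h; rewrite H1; reflexivity).
exists (Rmin d d4). split; [now apply Rmin_pos | ]. intros w Hw.
assert (W1 := Rlt_le_trans _ _ _ Hw (Rmin_l _ _)).
assert (W2 := Rlt_le_trans _ _ _ Hw (Rmin_r _ _)).
destruct (Ceq_dec w z) as [-> | n].
{ replace (h z - h z)%C with (RtoC 0) by ring. rewrite Cmod_0. lra. }
specialize (K4 w W2 n). rewrite <- rho_sinv in K4. change (sinv Infty) with (Fin 0%C) in K4.
rewrite (Hfin w W1) in K4.
destruct (rho_0_small (Fin (h w)) _ (Rmin_l 1 (e / 2)) K4) as (u & E & Hu).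
injection E as ->. rewrite Ehz. replace (u - 0)%C with u by ring.
generalize (Rmin_r 1 (e / 2)). lra.
Qed.

Definition Cdisc (p : C) (r : R) (z : C) : Prop := Cmod (z - p)%C < r.

Lemma disc_locally (p : C) (r : R) (z : C) : Cdisc p r z -> locally z (Cdisc p r).
Proof.
intros Hz. unfold Cdisc in Hz. apply locally_Cmod. exists (r - Cmod (z - p)%C). split; [lra | ].
intros w Hw. unfold Cdisc. replace (w - p)%C with ((w - z) + (z - p))%C by ring.
eapply Rle_lt_trans; [apply Cmod_triangle | lra].
Qed.

Lemma disc_center (p : C) (r : R) : 0 < r -> Cdisc p r p.
Proof.
intros H. unfold Cdisc. replace (p - p)%C with (RtoC 0) by ring. now rewrite Cmod_0.
Qed.

(** If every division by [z - p] were possible, the maximum principle on the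
    squares of half side [s] around [p] would give
    [|B z| <= M (|z - p| / s) ^ k] for all [k]. *)
Lemma finite_order (B : C -> C) (p : C) (r : R) : 0 < r ->
  (forall z, Cdisc p r z -> ex_derive B z) ->
  (forall z, Cdisc p r z -> z <> p -> B z <> 0%C) ->
  exists (k : nat) (B1 : C -> C), (forall z, Cdisc p r z -> ex_derive B1 z) /\
    B1 p <> 0%C /\ forall z, B z = (Cpow (z - p) k * B1 z)%C.
Proof.
intros Hr HB Hne. apply NNPP. intros Hno.
assert (Hall : forall k, exists Bk : C -> C, (forall z, Cdisc p r z -> ex_derive Bk z) /\
  forall z, B z = (Cpow (z - p) k * Bk z)%C).
{ induction k as [ | k (Bk & H1 & H2)].
  - exists B. split; auto. intros z. simpl. ring.
  - destruct (divide_out Bk (Cdisc p r) p H1) as (g & Hg & Hq).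
    { apply disc_locally, disc_center, Hr. }
    exists g. split; auto. intros z. rewrite (H2 z), (Hq z).
    destruct (Ceq_dec (Bk p) 0%C) as [-> | n].
    + rewrite Cpow_S. ring.
    + exfalso. apply Hno. exists k, Bk. auto. }
set (s := r / 4).
assert (Hs : 0 < s) by (unfold s; lra).
assert (Hsub : forall z, sqrect crect p s z -> Cdisc p r z).
{ intros z Hz. unfold Cdisc. eapply Rle_lt_trans; [apply crect_Cmod, Hz | unfold s; lra]. }
destruct (crect_bounded B (Re p - s) (Re p + s) (Im p - s) (Im p + s)) as [M HM]; try lra.
{ intros z Hz. apply ex_derive_Ccontinuous, HB, Hsub, Hz. }
destruct (Cmod_shift_right p (s / 2)) as [Hz1 Hz1p]; [lra | ].
set (z1 := (p + RtoC (s / 2))%C) in *.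
assert (Hz1s : sqrect crect p s z1).
{ assert (H : sqrect orect p s z1) by (apply Cmod_orect; lra). destruct H. split; lra. }
assert (HBz1 : B z1 <> 0%C) by (apply Hne; auto).
clearbody z1.
assert (Hk : forall k, Cmod (B z1) <= M * (/ 2) ^ k).
{ intros k. destruct (Hall k) as (Bk & H1 & H2).
  assert (H : Cmod (Bk z1) <= M / s ^ k).
  { apply (maximum_principle Bk (Re p - s) (Re p + s) (Im p - s) (Im p + s)); auto.
    intros w Hw.
    assert (Hwp : s <= Cmod (w - p)%C) by (apply (brect_dist _ _ _ _ p w s) in Hw; auto; lra).
    assert (Hsk : 0 < s ^ k) by now apply pow_lt.
    apply Rmult_le_reg_r with (s ^ k); auto.
    replace (M / s ^ k * s ^ k) with M by (field; lra).
    apply Rle_trans with (Cmod (B w)); [ | apply HM, Hw].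
    rewrite (H2 w), Cmod_mult, Cmod_pow, Rmult_comm.
    apply Rmult_le_compat_r; [apply Cmod_ge_0 | ]. apply pow_incr. lra. }
  assert (Hsk : 0 < s ^ k) by now apply pow_lt.
  rewrite (H2 z1), Cmod_mult, Cmod_pow, Hz1.
  apply Rle_trans with ((s / 2) ^ k * (M / s ^ k)).
  - apply Rmult_le_compat_l; auto. apply pow_le. lra.
  - unfold Rdiv at 1. rewrite Rpow_mult_distr. right. field. lra. }
destruct (halving_small M (Cmod (B z1))) as [n Hn]; [now apply Cmod_gt_0 | ].
specialize (Hk n). lra.
Qed.

(** The isolated singularities of a quotient are removable or poles: common
    factors [z - p] are cancelled until one of the two no longer vanishes. *)
Lemma quotient_singularity (p : C) (r : R) : 0 < r -> forall (k : nat) (A B B1 : C -> C),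
  (forall z, Cdisc p r z -> ex_derive A z) -> (forall z, Cdisc p r z -> ex_derive B1 z) ->
  (forall z, B z = (Cpow (z - p) k * B1 z)%C) -> B1 p <> 0%C ->
  (forall z, Cdisc p r z -> z <> p -> B z <> 0%C) ->
  (exists g : C -> C, ex_derive g p /\ forall z, Cdisc p r z -> z <> p -> (A z / B z)%C = g z) \/
  is_lim_sphere (fun z => Fin (A z / B z)%C) p Infty.
Proof.
intros Hr. induction k as [ | k IH]; intros A B B1 HA HB1 HB HBp Hne.
{ left. exists (fun z => A z / B1 z)%C. split.
  - apply (ex_derive_Cdiv A B1); auto; apply HA || apply HB1; now apply disc_center.
  - intros z Hz Hzp. rewrite (HB z). simpl. f_equal. f_equal. ring. }
assert (Hlp : locally p (Cdisc p r)) by (apply disc_locally, disc_center, Hr).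
destruct (Ceq_dec (A p) 0%C) as [HAp | HAp].
- destruct (divide_out A (Cdisc p r) p HA Hlp) as (A' & HA' & Hq).
  assert (Hne' : forall z, z <> p -> (z - p)%C <> 0%C) by (intros; now apply Cminus_eq_contra).
  assert (HB' : forall z, B z = ((z - p) * (Cpow (z - p) k * B1 z))%C).
  { intros z. rewrite (HB z), Cpow_S. ring. }
  assert (E : forall z, Cdisc p r z -> z <> p -> (A' z / (Cpow (z - p) k * B1 z))%C = (A z / B z)%C).
  { intros z Hz Hzp. specialize (Hne z Hz Hzp). specialize (Hne' z Hzp).
    rewrite (Hq z), HAp. rewrite (HB' z) in Hne |- *.
    assert (Hn : (Cpow (z - p) k * B1 z)%C <> 0%C).
    { intros E. apply Hne. rewrite E. ring. }
    set (q := (Cpow (z - p) k * B1 z)%C) in *. clearbody q. field. auto. }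
  destruct (IH A' (fun z => Cpow (z - p) k * B1 z)%C B1 HA' HB1) as [(g & Hg & Hg') | H]; auto.
  + intros z Hz Hzp E'. apply (Hne z Hz Hzp). rewrite (HB' z), E'. ring.
  + left. exists g. split; auto. intros z Hz Hzp. rewrite <- E; auto.
  + right. rewrite is_lim_sphere_iff in *. intros e He.
    destruct (H e He) as (d & Hd & Hlim). exists (Rmin d r).
    split; [now apply Rmin_pos | ]. intros w Hw Hwp.
    rewrite <- E; auto; [apply Hlim; auto | ].
    * eapply Rlt_le_trans; [exact Hw | apply Rmin_l].
    * unfold Cdisc. eapply Rlt_le_trans; [exact Hw | apply Rmin_r].
- right. apply is_lim_sphere_iff. intros e He.
  assert (HAc : continuous A p) by (apply ex_derive_Ccontinuous, HA, disc_center, Hr).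
  assert (HBc : continuous B p).
  { apply continuous_ext with (fun z => Cpow (z - p) (S k) * B1 z)%C.
    - intros z. symmetry. apply (HB z).
    - apply ex_derive_Ccontinuous.
      apply (ex_derive_Cmult (fun z => Cpow (z - p) (S k)) B1).
      + apply (ex_derive_Cpow (fun z => z - p)%C). C_derivable.
      + apply HB1, disc_center, Hr. }
  rewrite continuous_Cmod in HAc, HBc.
  assert (Hpos : 0 < Cmod (A p)) by now apply Cmod_gt_0.
  destruct (HAc (Cmod (A p) / 2)) as (d1 & Hd1 & K1); [lra | ].
  destruct (HBc (e * Cmod (A p) / 4)) as (d2 & Hd2 & K2); [nra | ].
  exists (Rmin (Rmin d1 d2) r). split; [repeat apply Rmin_pos; auto | ].
  intros w Hw Hwp.
  assert (W1 : Cmod (w - p)%C < d1).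
  { eapply Rlt_le_trans; [exact Hw | ]. eapply Rle_trans; [apply Rmin_l | apply Rmin_l]. }
  assert (W2 : Cmod (w - p)%C < d2).
  { eapply Rlt_le_trans; [exact Hw | ]. eapply Rle_trans; [apply Rmin_l | apply Rmin_r]. }
  assert (W3 : Cdisc p r w) by (eapply Rlt_le_trans; [exact Hw | apply Rmin_r]).
  specialize (K1 w W1). specialize (K2 w W2).
  assert (EB : B p = 0%C).
  { rewrite (HB p). replace (p - p)%C with (RtoC 0) by ring. rewrite Cpow_S. ring. }
  rewrite EB in K2. replace (B w - 0)%C with (B w) in K2 by ring.
  assert (HAw : Cmod (A p) / 2 < Cmod (A w)).
  { assert (Cmod (A p) <= Cmod (A w) + Cmod (A w - A p)%C); [ | lra].
    rewrite (Cmod_sub_sym (A w)). replace (A p) with (A w + (A p - A w))%C at 1 by ring.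
    apply Cmod_triangle. }
  assert (HBw := Hne w W3 Hwp).
  assert (HBw' : 0 < Cmod (B w)) by now apply Cmod_gt_0.
  rewrite rho_Fin_Infty.
  set (q := (A w / B w)%C).
  assert (Hq : Cmod q * Cmod (B w) = Cmod (A w)).
  { unfold q. rewrite Cmod_div by auto. field. lra. }
  assert (Hj := jap_ge_Cmod q). assert (Hj1 := jap_ge_1 q).
  apply Rmult_lt_reg_r with (jap q); [lra | ].
  replace (2 / jap q * jap q) with 2 by (field; lra).
  apply Rlt_le_trans with (e * Cmod q); [ | nra].
  apply Rmult_lt_reg_r with (Cmod (B w)); auto.
  rewrite Rmult_assoc, Hq. nra.
Qed.

(** At a pole take [A = 1] and [B = 1 / f]. *)
Lemma meromorphic_quotient (D : C -> Prop) (f : C -> sphere) (p : C) :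
  open D -> meromorphic_on D f -> D p ->
  exists (A B : C -> C) (r : R), 0 < r /\
   (forall z, Cdisc p r z -> ex_derive A z) /\ (forall z, Cdisc p r z -> ex_derive B z) /\
   (forall z, Cdisc p r z -> z <> p -> B z <> 0%C /\ f z = Fin (A z / B z)%C).
Proof.
intros HD Hf Hp.
assert (Hsp := meromorphic_sphere_holomorphic D f p HD Hf Hp).
assert (Hsp' : locally p (sphere_holomorphic_at f)).
{ generalize (HD p Hp). apply filter_imp. intros w Hw.
  now apply (meromorphic_sphere_holomorphic D). }
destruct (Hf p Hp) as [H | (Hinf & Hfin & Hlim)].
- assert (Hl : locally p (fun z => f z <> Infty)) by apply H.
  generalize (filter_and _ _ Hsp' Hl). intros H'. apply locally_Cmod in H'.
  destruct H' as (r & Hr & H'). exists (fun z => fin_part (f z)), (fun _ => 1%C), r.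
  split; auto. split; [ | split].
  + intros z Hz. destruct (H' z Hz) as [H1 H2].
    now destruct (sphere_holomorphic_finite f z H1 H2).
  + intros z _. apply ex_derive_Cconst.
  + intros z Hz _. split; [apply C1_nz | ]. destruct (H' z Hz) as [H1 H2].
    destruct (f z); [ | easy]. simpl. f_equal. field.
- assert (Hc := sphere_holomorphic_continuous f p Hsp).
  destruct (Hc 1 Rlt_0_1) as (d1 & Hd1 & K1).
  apply locally'_Cmod in Hfin. destruct Hfin as (d2 & Hd2 & K2).
  apply locally_Cmod in Hsp'. destruct Hsp' as (d3 & Hd3 & K3).
  set (d := Rmin d1 (Rmin d2 d3)).
  assert (Hd : 0 < d) by (repeat apply Rmin_pos; auto).
  assert (L1 : d <= d1) by apply Rmin_l.
  assert (L2 : d <= d2) by (eapply Rle_trans; [apply Rmin_r | apply Rmin_l]).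
  assert (L3 : d <= d3) by (eapply Rle_trans; [apply Rmin_r | apply Rmin_r]).
  assert (Hne0 : forall w, Cdisc p d w -> f w <> Fin 0%C).
  { intros w Hw E. unfold Cdisc in Hw. specialize (K1 w ltac:(lra)). rewrite E, Hinf, rho_0_Infty in K1. lra. }
  exists (fun _ => 1%C), (fun z => fin_part (sinv (f z))), d.
  split; auto. split; [ | split].
  + intros z _. apply ex_derive_Cconst.
  + intros z Hz. assert (Hz' : Cmod (z - p)%C < d) by exact Hz.
    assert (H1 : sphere_holomorphic_at (fun z => sinv (f z)) z).
    { apply sphere_holomorphic_sinv, K3. lra. }
    apply sphere_holomorphic_finite in H1; [apply H1 | ].
    intros E. apply (Hne0 z Hz). rewrite <- (sinv_invol (f z)), E. reflexivity.
  + intros z Hz Hzp. assert (Hz' : Cmod (z - p)%C < d) by exact Hz.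
    assert (H1 := K2 z ltac:(lra) Hzp). assert (H2 := Hne0 z Hz).
    destruct (f z) as [u | ]; [ | easy].
    assert (Hu : u <> 0%C) by (intros ->; auto).
    rewrite sinv_Fin by auto. simpl. split; [now apply Cinv_ne_0 | ].
    f_equal. field. auto using C1_nz.
Qed.

Lemma mero_mult_Fin (f g : C -> sphere) (z u v : C) :
  f z = Fin u -> g z = Fin v -> mero_mult f g z = Fin (u * v)%C.
Proof. unfold mero_mult. intros -> ->. reflexivity. Qed.

Lemma mero_mult_limit (f g : C -> sphere) (z : C) (l : sphere) :
  f z = Infty \/ g z = Infty ->
  is_lim_sphere (fun w => Fin (fin_part (f w) * fin_part (g w))%C) z l ->
  mero_mult f g z = l.
Proof.
intros Hz Hl.
set (Q := is_lim_sphere (fun w => Fin (fin_part (f w) * fin_part (g w))%C) z) in *.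
assert (E : mero_mult f g z = epsilon (inhabits Infty) Q).
{ unfold mero_mult. destruct Hz as [-> | ->]; destruct (f z); reflexivity. }
rewrite E.
apply (is_lim_sphere_unique (fun w => Fin (fin_part (f w) * fin_part (g w))%C) z); auto.
apply epsilon_spec. now exists l.
Qed.

(** Near a pole of a factor the product is a quotient of holomorphic functions,
    so that [quotient_singularity] provides the limit that defines its value. *)
Theorem meromorphic_mult (D : C -> Prop) (f1 f2 : C -> sphere) :
  open D -> meromorphic_on D f1 -> meromorphic_on D f2 ->
  meromorphic_on D (mero_mult f1 f2).
Proof.
intros HD H1 H2 p Hp.
destruct (classic (f1 p = Infty \/ f2 p = Infty)) as [Hinf | Hfin].
2: { left. apply holomorphic_at_iff.
  assert (K1 : holomorphic_at f1 p).
  { destruct (H1 p Hp) as [H | [H _]]; auto. exfalso; auto. }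
  assert (K2 : holomorphic_at f2 p).
  { destruct (H2 p Hp) as [H | [H _]]; auto. exfalso; auto. }
  apply holomorphic_at_iff in K1, K2.
  destruct K1 as (g1 & L1 & D1), K2 as (g2 & L2 & D2).
  exists (fun w => g1 w * g2 w)%C. split; [ | now apply ex_derive_Cmult].
  generalize (filter_and _ _ L1 L2). apply filter_imp. intros w [E1 E2].
  now apply mero_mult_Fin. }
destruct (meromorphic_quotient D f1 p HD H1 Hp) as (A1 & B1 & r1 & Hr1 & HA1 & HB1 & Hq1).
destruct (meromorphic_quotient D f2 p HD H2 Hp) as (A2 & B2 & r2 & Hr2 & HA2 & HB2 & Hq2).
set (r := Rmin r1 r2).
assert (Hr : 0 < r) by now apply Rmin_pos.
assert (S1 : forall z, Cdisc p r z -> Cdisc p r1 z).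
{ intros z Hz. eapply Rlt_le_trans; [exact Hz | apply Rmin_l]. }
assert (S2 : forall z, Cdisc p r z -> Cdisc p r2 z).
{ intros z Hz. eapply Rlt_le_trans; [exact Hz | apply Rmin_r]. }
set (A := fun z => (A1 z * A2 z)%C). set (B := fun z => (B1 z * B2 z)%C).
assert (HA : forall z, Cdisc p r z -> ex_derive A z).
{ intros z Hz. apply (ex_derive_Cmult A1 A2); auto. }
assert (HB : forall z, Cdisc p r z -> ex_derive B z).
{ intros z Hz. apply (ex_derive_Cmult B1 B2); auto. }
assert (HBne : forall z, Cdisc p r z -> z <> p -> B z <> 0%C).
{ intros z Hz Hzp. apply Cmult_neq_0; [apply Hq1 | apply Hq2]; auto. }
assert (HF : forall z, Cdisc p r z -> z <> p ->
  mero_mult f1 f2 z = Fin (A z / B z)%C /\ (fin_part (f1 z) * fin_part (f2 z))%C = (A z / B z)%C).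
{ intros z Hz Hzp. destruct (Hq1 z (S1 z Hz) Hzp) as [N1 E1].
  destruct (Hq2 z (S2 z Hz) Hzp) as [N2 E2].
  assert (E : (A1 z / B1 z * (A2 z / B2 z))%C = (A z / B z)%C) by (unfold A, B; field; auto).
  split.
  - rewrite (mero_mult_Fin f1 f2 z _ _ E1 E2). now rewrite E.
  - rewrite E1, E2. exact E. }
assert (Hlim : forall l, is_lim_sphere (fun z => Fin (A z / B z)%C) p l -> mero_mult f1 f2 p = l).
{ intros l Hl. apply mero_mult_limit; auto. rewrite is_lim_sphere_iff in *.
  intros e He. destruct (Hl e He) as (d & Hd & H). exists (Rmin d r).
  split; [now apply Rmin_pos | ]. intros w Hw Hwp.
  destruct (HF w) as [_ E]; auto.
  { eapply Rlt_le_trans; [exact Hw | apply Rmin_r]. }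
  rewrite E. apply H; auto. eapply Rlt_le_trans; [exact Hw | apply Rmin_l]. }
destruct (finite_order B p r Hr HB HBne) as (k & B' & HB' & HBp & HBk).
destruct (quotient_singularity p r Hr k A B B' HA HB' HBk HBp HBne) as [(g & Hg & Hgq) | Hl].
- left. apply holomorphic_at_iff. exists g. split; auto.
  assert (Ep : mero_mult f1 f2 p = Fin (g p)).
  { apply Hlim. apply is_lim_sphere_iff. intros e He.
    apply ex_derive_Ccontinuous in Hg. rewrite continuous_Cmod in Hg.
    destruct (Hg (e / 2)) as (d & Hd & Hc); [lra | ].
    exists (Rmin d r). split; [now apply Rmin_pos | ]. intros w Hw Hwp.
    rewrite Hgq; auto.
    - eapply Rle_lt_trans; [apply rho_le_Cmod | ].
      specialize (Hc w (Rlt_le_trans _ _ _ Hw (Rmin_l _ _))). lra.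
    - eapply Rlt_le_trans; [exact Hw | apply Rmin_r]. }
  apply locally_Cmod. exists r. split; auto. intros w Hw.
  destruct (Ceq_dec w p) as [-> | n]; auto.
  destruct (HF w Hw n) as [E _]. rewrite E. f_equal. now apply Hgq.
- right. assert (Ep := Hlim _ Hl). split; auto. split.
  + apply locally'_Cmod. exists r. split; auto. intros w Hw Hwp.
    destruct (HF w Hw Hwp) as [E _]. rewrite E. discriminate.
  + rewrite is_lim_sphere_iff in *. intros e He.
    destruct (Hl e He) as (d & Hd & H). exists (Rmin d r).
    split; [now apply Rmin_pos | ]. intros w Hw Hwp.
    destruct (HF w) as [E _]; auto.
    { eapply Rlt_le_trans; [exact Hw | apply Rmin_r]. }
    rewrite E. apply H; auto. eapply Rlt_le_trans; [exact Hw | apply Rmin_l].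
Qed.

(** * Almost periodic maps to the sphere *)

Lemma Im_shift (z : C) (t : R) : Im (z + RtoC t)%C = Im z.
Proof. destruct z as [x y]. simpl. ring. Qed.

Lemma Re_shift (z : C) (t : R) : Re (z + RtoC t)%C = Re z + t.
Proof. destruct z as [x y]. reflexivity. Qed.

Lemma strip_shift (a b : Rbar) (z : C) (t : R) :
  strip a b z -> strip a b (z + RtoC t)%C.
Proof. unfold strip. now rewrite Im_shift. Qed.

Lemma strip_substrip (alpha beta : R) (a b : Rbar) (z : C) :
  substrip alpha beta a b -> alpha <= Im z <= beta -> strip a b z.
Proof.
intros (H1 & H2 & H3) Hz. split.
- apply (Rbar_lt_le_trans _ alpha); simpl; tauto.
- apply (Rbar_le_lt_trans _ beta); simpl; tauto.
Qed.

Lemma Rbar_lt_room_l (a : Rbar) (x : R) : Rbar_lt a x ->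
  exists h, 0 < h /\ Rbar_lt a (x - h).
Proof.
destruct a as [a | | ]; simpl; intros H.
- exists ((x - a) / 2). split; lra.
- easy.
- exists 1. split; auto; lra.
Qed.

Lemma Rbar_lt_room_r (b : Rbar) (x : R) : Rbar_lt x b ->
  exists h, 0 < h /\ Rbar_lt (x + h) b.
Proof.
destruct b as [b | | ]; simpl; intros H.
- exists ((b - x) / 2). split; lra.
- exists 1. split; auto; lra.
- easy.
Qed.

Lemma substrip_room (alpha beta : R) (a b : Rbar) : substrip alpha beta a b ->
  exists h, 0 < h /\ substrip (alpha - h) (beta + h) a b.
Proof.
intros (H1 & H2 & H3).
destruct (Rbar_lt_room_l a alpha H1) as (h1 & P1 & K1).
destruct (Rbar_lt_room_r b beta H3) as (h2 & P2 & K2).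
exists (Rmin h1 h2). split; [now apply Rmin_pos | ].
generalize (Rmin_l h1 h2) (Rmin_r h1 h2) (Rmin_pos h1 h2 P1 P2). intros L1 L2 L3.
split; [ | split].
- eapply Rbar_lt_le_trans; [exact K1 | simpl; lra].
- lra.
- eapply Rbar_le_lt_trans; [ | exact K2]. simpl; lra.
Qed.

Lemma substrip_extend (alpha beta : R) (a b : Rbar) (p : C) :
  substrip alpha beta a b -> strip a b p ->
  exists alpha' beta', substrip alpha' beta' a b /\ alpha' <= alpha /\ beta <= beta' /\
    alpha' < Im p < beta'.
Proof.
intros H [P1 P2]. destruct H as (H1 & H2 & H3).
assert (H' : substrip (Rmin alpha (Im p)) (Rmax beta (Im p)) a b).
{ split; [ | split].
  - unfold Rmin. destruct (Rle_dec alpha (Im p)); auto.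
  - generalize (Rmin_l alpha (Im p)) (Rmax_l beta (Im p)). lra.
  - unfold Rmax. destruct (Rle_dec beta (Im p)); auto. }
destruct (substrip_room _ _ _ _ H') as (h & Hh & Hs).
exists (Rmin alpha (Im p) - h), (Rmax beta (Im p) + h). split; auto.
generalize (Rmin_l alpha (Im p)) (Rmax_l beta (Im p)) (Rmin_r alpha (Im p)) (Rmax_r beta (Im p)).
lra.
Qed.

Lemma strip_open (a b : Rbar) : open (strip a b).
Proof.
intros z [H1 H2].
destruct (Rbar_lt_room_l a (Im z) H1) as (h1 & P1 & K1).
destruct (Rbar_lt_room_r b (Im z) H2) as (h2 & P2 & K2).
apply locally_Cmod. exists (Rmin h1 h2). split; [now apply Rmin_pos | ].
intros w Hw. generalize (Rmin_l h1 h2) (Rmin_r h1 h2). intros L1 L2.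
assert (H := im_le_Cmod (w - z)).
replace (Im (w - z)%C) with (Im w - Im z) in H by (destruct z, w; reflexivity).
assert (Hv : Rabs (Im w - Im z) < Rmin h1 h2) by lra. apply Rabs_def2 in Hv. split.
- eapply Rbar_lt_le_trans; [exact K1 | simpl; lra].
- eapply Rbar_le_lt_trans; [ | exact K2]. simpl; lra.
Qed.

Definition almost_period (alpha beta : R) (f : C -> sphere) (e tau : R) : Prop :=
  forall z : C, strip alpha beta z -> rho (f (z + RtoC tau)%C) (f z) < e.

(** Unlike the meromorphic almost periodic functions, this class is stable
    under inversion, as it contains the constant infinity. *)
Definition sphere_almost_periodic (a b : Rbar) (f : C -> sphere) : Prop :=
  (forall z, strip a b z -> sphere_holomorphic_at f z) /\
  forall alpha beta : R, substrip alpha beta a b ->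
  forall e, 0 < e -> relatively_dense (almost_period alpha beta f e).

Lemma mero_sphere_almost_periodic (a b : Rbar) (f : C -> sphere) :
  mero_almost_periodic a b f -> sphere_almost_periodic a b f.
Proof.
intros [H1 H2]. split; [ | exact H2].
intros z Hz. apply (meromorphic_sphere_holomorphic (strip a b)); auto. apply strip_open.
Qed.

Lemma sphere_almost_periodic_sinv (a b : Rbar) (f : C -> sphere) :
  sphere_almost_periodic a b f -> sphere_almost_periodic a b (fun z => sinv (f z)).
Proof.
intros [H1 H2]. split.
- intros z Hz. apply sphere_holomorphic_sinv. auto.
- intros alpha beta Hs e He. destruct (H2 alpha beta Hs e He) as (L & HL & H).
  exists L. split; auto. intros t. destruct (H t) as (tau & Ht & K). exists tau.
  split; auto. intros z Hz. rewrite rho_sinv. auto.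
Qed.

Lemma almost_period_opp (alpha beta : R) (f : C -> sphere) (e t : R) :
  almost_period alpha beta f e t -> almost_period alpha beta f e (- t).
Proof.
intros H z Hz. specialize (H (z + RtoC (- t))%C (strip_shift _ _ _ _ Hz)).
rewrite rho_sym. replace (z + RtoC (- t) + RtoC t)%C with z in H; auto.
rewrite RtoC_opp. ring.
Qed.

Lemma almost_period_add (alpha beta : R) (f : C -> sphere) (e e' t t' : R) :
  almost_period alpha beta f e t -> almost_period alpha beta f e' t' ->
  almost_period alpha beta f (e + e') (t + t').
Proof.
intros H H' z Hz. specialize (H z Hz). specialize (H' (z + RtoC t)%C (strip_shift _ _ _ _ Hz)).
rewrite RtoC_plus, Cplus_assoc.
eapply Rle_lt_trans; [apply (rho_triangle _ (f (z + RtoC t)%C)) | lra].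
Qed.

Lemma almost_period_weaken (alpha beta alpha' beta' : R) (f : C -> sphere) (e e' t : R) :
  alpha' <= alpha -> beta <= beta' -> e' <= e ->
  almost_period alpha' beta' f e' t -> almost_period alpha beta f e t.
Proof.
intros H1 H2 He H z [Z1 Z2]. simpl in *. eapply Rlt_le_trans; [ | exact He].
apply H. split; simpl; lra.
Qed.

(** An almost period moves any pair of nearby points into a fixed rectangle,
    where compactness gives uniform continuity. *)
Theorem almost_periodic_uniformly_continuous (a b : Rbar) (f : C -> sphere) (alpha beta e : R) :
  sphere_almost_periodic a b f -> substrip alpha beta a b -> 0 < e ->
  exists d, 0 < d /\ forall z w, strip alpha beta z -> strip alpha beta w ->
    Cmod (w - z)%C < d -> rho (f w) (f z) < e.
Proof.
intros [Hhol Hap] Hs He.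
destruct (Hap alpha beta Hs (e / 3)) as (L & HL & Hper); [lra | ].
destruct (rectangle_uniform (fun z d => forall w, Cmod (w - z)%C < d -> rho (f w) (f z) < e / 3)
  0 L alpha beta) as (d & Hd & H).
- lra.
- destruct Hs as (_ & H & _). lra.
- intros z d d' Hd H w Hw. apply H. lra.
- intros p [Hp1 Hp2].
  assert (Hc : sphere_continuous_at f p).
  { apply sphere_holomorphic_continuous, Hhol. now apply (strip_substrip alpha beta). }
  destruct (Hc (e / 6)) as (d & Hd & H); [lra | ].
  exists (d / 2). split; [lra | ]. exists (d / 2). split; [lra | ].
  intros z Hz w Hw.
  assert (K1 : rho (f z) (f p) < e / 6) by (apply H; lra).
  assert (K2 : rho (f w) (f p) < e / 6).
  { apply H. replace (w - p)%C with ((w - z) + (z - p))%C by ring.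
    eapply Rle_lt_trans; [apply Cmod_triangle | lra]. }
  eapply Rle_lt_trans; [apply (rho_triangle _ (f p)) | ]. rewrite (rho_sym (f p)). lra.
- exists d. split; auto. intros z w Hz Hw Hwz.
  destruct (Hper (- Re z)) as (tau & Ht & Hp).
  assert (K1 := Hp z Hz). assert (K2 := Hp w Hw).
  assert (K3 : rho (f (w + RtoC tau)%C) (f (z + RtoC tau)%C) < e / 3).
  { apply H.
    - split; rewrite ?Re_shift, ?Im_shift; [lra | ]. destruct Hz as [Z1 Z2]. simpl in *. lra.
    - replace (w + RtoC tau - (z + RtoC tau))%C with (w - z)%C by ring. exact Hwz. }
  eapply Rle_lt_trans; [apply (rho_triangle _ (f (w + RtoC tau)%C)) | ].
  rewrite (rho_sym (f w)).
  eapply Rle_lt_trans; [apply Rplus_le_compat_l, (rho_triangle _ (f (z + RtoC tau)%C)) | ]. lra.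
Qed.

Lemma bounded_representatives (P : nat -> R -> Prop) (n : nat) :
  exists M, 0 <= M /\ forall i t, (i < n)%nat -> P i t -> exists t', Rabs t' <= M /\ P i t'.
Proof.
induction n as [ | n (M & HM & H)].
- exists 0. split; [lra | ]. intros; lia.
- destruct (classic (exists t, P n t)) as [[t0 Ht0] | Hno].
  + exists (Rmax M (Rabs t0)). split; [eapply Rle_trans; [exact HM | apply Rmax_l] | ].
    intros i t Hi Ht. destruct (Nat.eq_dec i n) as [-> | Hin].
    * exists t0. split; auto. apply Rmax_r.
    * destruct (H i t) as (t' & Ht' & K); [lia | auto | ]. exists t'. split; auto.
      eapply Rle_trans; [exact Ht' | apply Rmax_l].
  + exists M. split; auto. intros i t Hi Ht. destruct (Nat.eq_dec i n) as [-> | Hin].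
    * exfalso. apply Hno. now exists t.
    * apply (H i t); auto. lia.
Qed.

(** Every segment of length [L] contains a period [t1] of [f1] and a period
    [t2] of [f2], and [t1 - t2] ranges over [[-L, L]], which is cut into finitely
    many short cells. Two segments with the same cell give, by subtraction,
    periods of [f1] and [f2] that nearly agree; and each cell that occurs is
    represented by a segment at a bounded distance from 0. *)
Theorem common_almost_periods (a b : Rbar) (f1 f2 : C -> sphere) (alpha beta e : R) :
  sphere_almost_periodic a b f1 -> sphere_almost_periodic a b f2 ->
  substrip alpha beta a b -> 0 < e ->
  relatively_dense (fun t => almost_period alpha beta f1 e t /\ almost_period alpha beta f2 e t).
Proof.
intros H1 H2 Hs He.
destruct (almost_periodic_uniformly_continuous a b f2 alpha beta (e / 3) H2 Hs) as (d & Hd & Huc); [lra | ].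
destruct H1 as [_ H1], H2 as [_ H2].
destruct (H1 alpha beta Hs (e / 3)) as (L1 & HL1 & P1); [lra | ].
destruct (H2 alpha beta Hs (e / 3)) as (L2 & HL2 & P2); [lra | ].
set (L := L1 + L2).
assert (HL : 0 < L) by (unfold L; lra).
set (in_cell := fun (i : nat) (t : R) => exists t1 t2,
   t <= t1 <= t + L /\ t <= t2 <= t + L /\
   almost_period alpha beta f1 (e / 3) t1 /\ almost_period alpha beta f2 (e / 3) t2 /\
   INR i * d <= t1 - t2 + L < INR (S i) * d).
destruct (INR_unbounded (2 * L / d)) as [n Hn].
assert (Hn' : 2 * L < INR n * d).
{ apply Rmult_lt_compat_r with (r := d) in Hn; auto.
  replace (2 * L / d * d) with (2 * L) in Hn by (field; lra). exact Hn. }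
assert (Hcell : forall t, exists i, (i < n)%nat /\ in_cell i t).
{ intros t. destruct (P1 t) as (t1 & T1 & Q1). destruct (P2 t) as (t2 & T2 & Q2).
  assert (Hx : 0 <= (t1 - t2 + L) / d).
  { apply Rmult_le_pos; [unfold L; lra | ]. left. now apply Rinv_0_lt_compat. }
  destruct (nfloor_ex _ Hx) as (i & I1 & I2).
  apply Rmult_le_compat_r with (r := d) in I1; [ | lra].
  apply Rmult_lt_compat_r with (r := d) in I2; [ | lra].
  replace ((t1 - t2 + L) / d * d) with (t1 - t2 + L) in I1, I2 by (field; lra).
  exists i. split.
  - apply INR_lt. apply Rmult_lt_reg_r with d; auto. unfold L in *; lra.
  - exists t1, t2. rewrite S_INR. unfold L in *. repeat split; auto; lra. }
destruct (bounded_representatives in_cell n) as (M & HM & Hrep).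
exists (2 * (M + L) + L). split; [lra | ].
(* With this shift [t1 - s1] lies in the required segment, as [|s| <= M]. *)
intros t. set (t0 := t + M + L).
destruct (Hcell t0) as (i & Hi & Hc).
destruct (Hrep i t0 Hi Hc) as (s & Hs' & Hc').
destruct Hc as (t1 & t2 & T1 & T2 & A1 & A2 & D).
destruct Hc' as (s1 & s2 & S1 & S2 & B1 & B2 & D').
apply Rabs_le_between in Hs'.
exists (t1 - s1). split; [unfold t0 in *; lra | ].
assert (C1 := almost_period_add _ _ _ _ _ _ _ A1 (almost_period_opp _ _ _ _ _ B1)).
assert (C2 := almost_period_add _ _ _ _ _ _ _ A2 (almost_period_opp _ _ _ _ _ B2)).
split.
- apply (almost_period_weaken alpha beta alpha beta f1 e (e / 3 + e / 3)); auto; lra.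
- intros z Hz. specialize (C2 z Hz).
  assert (Hu : rho (f2 (z + RtoC (t1 - s1))%C) (f2 (z + RtoC (t2 + - s2))%C) < e / 3).
  { apply Huc; try (apply strip_shift; exact Hz).
    replace (z + RtoC (t1 - s1) - (z + RtoC (t2 + - s2)))%C with (RtoC ((t1 - s1) - (t2 + - s2)))
      by (rewrite RtoC_minus; ring).
    rewrite Cmod_R. rewrite S_INR in D, D'. apply Rabs_def1; lra. }
  eapply Rle_lt_trans; [apply (rho_triangle _ (f2 (z + RtoC (t2 + - s2))%C)) | lra].
Qed.

(** * Smallness propagates *)

Lemma sqrect_strip (alpha beta h r : R) (z w : C) : r < h ->
  strip alpha beta z -> sqrect crect z r w -> strip (alpha - h) (beta + h) w.
Proof.
intros Hr [Z1 Z2] [W1 W2]. simpl in *. split; simpl; lra.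
Qed.

(** By uniform continuity, a value in the unit disc forces the function to be
    bounded by 1 on a square whose size does not depend on the point. *)
Lemma bounded_near_small_value (a b : Rbar) (f : C -> sphere) (alpha beta : R) :
  sphere_almost_periodic a b f -> substrip alpha beta a b ->
  exists r0, 0 < r0 /\ forall r z, r <= r0 -> strip alpha beta z -> rho (f z) (Fin 0%C) < / 2 ->
    (forall w, sqrect crect z r w -> ex_derive (fun w => fin_part (f w)) w) /\
    (forall w, sqrect crect z r w -> f w = Fin (fin_part (f w))) /\
    (forall w, sqrect crect z r w -> Cmod (fin_part (f w)) <= 1).
Proof.
intros Hf Hs. destruct (substrip_room _ _ _ _ Hs) as (h & Hh & Hs').
destruct (almost_periodic_uniformly_continuous a b f _ _ (/ 2) Hf Hs') as (d & Hd & Huc); [lra | ].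
exists (Rmin (h / 2) (d / 4)). split; [apply Rmin_pos; lra | ].
intros r z Hr Hz Hz0.
generalize (Rmin_l (h / 2) (d / 4)) (Rmin_r (h / 2) (d / 4)). intros L1 L2.
assert (Hw : forall w, sqrect crect z r w -> strip (alpha - h) (beta + h) w).
{ intros w Hw. apply (sqrect_strip alpha beta h r z w); auto. lra. }
assert (Hsm : forall w, sqrect crect z r w -> exists u, f w = Fin u /\ Cmod u <= 1).
{ intros w Hwr. apply rho_0_small; [lra | ].
  assert (K : rho (f w) (f z) < / 2).
  { apply Huc; auto.
    - destruct Hz as [Z1 Z2]. simpl in *. split; simpl; lra.
    - eapply Rle_lt_trans; [apply crect_Cmod, Hwr | lra]. }
  eapply Rle_lt_trans; [apply (rho_triangle _ (f z)) | lra]. }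
split; [ | split].
- intros w Hwr. destruct (Hsm w Hwr) as (u & E & _).
  assert (Hh' : sphere_holomorphic_at f w).
  { apply Hf. apply (strip_substrip _ _ _ _ _ Hs'). destruct (Hw w Hwr). simpl in *. lra. }
  apply sphere_holomorphic_finite in Hh'; [apply Hh' | rewrite E; discriminate].
- intros w Hwr. destruct (Hsm w Hwr) as (u & -> & _). reflexivity.
- intros w Hwr. destruct (Hsm w Hwr) as (u & -> & Hu). exact Hu.
Qed.

(** For [N] points in the square of half side [r], [small_at_points] bounds
    [f] by [(/ 2) ^ N + K m]: take first [N] large, then [m] small. *)
Lemma small_at_many_points (a b : Rbar) (f : C -> sphere) (alpha beta : R) :
  sphere_almost_periodic a b f -> substrip alpha beta a b ->
  exists r0, 0 < r0 /\ forall r, 0 < r <= r0 -> forall e, 0 < e ->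
  exists N, (0 < N)%nat /\ forall d, 0 < d -> exists m, 0 < m /\ forall z (p : nat -> C),
    strip alpha beta z ->
    (forall i, (i < N)%nat -> sqrect crect z r (p i) /\ rho (f (p i)) (Fin 0%C) < m) ->
    (forall i j, (i < j < N)%nat -> d <= Cmod (p j - p i)%C) ->
    forall w, sqrect crect z r w -> rho (f w) (Fin 0%C) < e.
Proof.
intros Hf Hs. destruct (substrip_room _ _ _ _ Hs) as (h & Hh & Hs').
destruct (bounded_near_small_value a b f alpha beta Hf Hs) as (r1 & Hr1 & Hb).
destruct (almost_periodic_uniformly_continuous a b f _ _ (/ 4) Hf Hs') as (d1 & Hd1 & Huc); [lra | ].
exists (Rmin (r1 / 17) (Rmin (h / 2) (d1 / 4))). split; [repeat apply Rmin_pos; lra | ].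
intros r [Hr Hr']. intros e He.
assert (L1 : r <= r1 / 17) by (eapply Rle_trans; [exact Hr' | apply Rmin_l]).
assert (L2 : r <= h / 2).
{ eapply Rle_trans; [exact Hr' | ]. eapply Rle_trans; [apply Rmin_r | apply Rmin_l]. }
assert (L3 : r <= d1 / 4).
{ eapply Rle_trans; [exact Hr' | ]. eapply Rle_trans; [apply Rmin_r | apply Rmin_r]. }
destruct (halving_small 1 (e / 4)) as [N HN]; [lra | ].
exists (S N). split; [lia | ]. intros d Hd.
destruct (small_at_points r d Hr Hd (S N)) as (K & HK & Hsmall).
set (m := Rmin (/ 4) (e / (4 * (K + 1)))).
assert (Hm : 0 < m).
{ apply Rmin_pos; [lra | ]. apply Rdiv_lt_0_compat; lra. }
assert (Hm1 : m <= / 4) by apply Rmin_l.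
assert (Hm2 : m * (4 * (K + 1)) <= e).
{ apply Rle_trans with (e / (4 * (K + 1)) * (4 * (K + 1))).
  - apply Rmult_le_compat_r; [lra | apply Rmin_r].
  - right. field. lra. }
clearbody m.
exists m. split; auto. intros z p Hz Hp Hsep w Hw.
assert (Hz0 : rho (f z) (Fin 0%C) < / 2).
{ destruct (Hp O) as [Hp0 Hf0]; [lia | ].
  assert (K1 : rho (f z) (f (p O)) < / 4).
  { apply Huc.
    - apply (sqrect_strip alpha beta h r z); auto; lra.
    - apply (sqrect_strip alpha beta h r z); auto; [lra | ]. unfold sqrect, crect. lra.
    - rewrite Cmod_sub_sym. eapply Rle_lt_trans; [apply crect_Cmod, Hp0 | lra]. }
  eapply Rle_lt_trans; [apply (rho_triangle _ (f (p O))) | lra]. }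
destruct (Hb (17 * r) z) as (B1 & B2 & B3); auto; [lra | ].
assert (Hsub : forall v, sqrect crect z r v -> sqrect crect z (17 * r) v).
{ intros v [V1 V2]. unfold sqrect, crect. lra. }
assert (H := Hsmall z (fun w => fin_part (f w)) 1 m p (Rlt_le _ _ Hm) B1 B3).
rewrite (B2 w (Hsub w Hw)). eapply Rle_lt_trans; [apply rho_le_Cmod | ].
replace (fin_part (f w) - 0)%C with (fin_part (f w)) by ring.
assert (Hfw : Cmod (fin_part (f w)) <= (/ 2) ^ S N * 1 + K * m).
{ apply H; auto. intros i Hi. destruct (Hp i Hi) as [Hpi Hfi]. split; auto.
  destruct (rho_0_small (f (p i)) m) as (u & E & Hu); [lra | auto | ].
  rewrite E. exact Hu. }
simpl pow in Hfw. assert (0 < (/ 2) ^ N) by (apply pow_lt; lra). nra.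
Qed.

Definition small_on (f : C -> sphere) (z : C) (s e : R) : Prop :=
  forall w, sqrect crect z s w -> rho (f w) (Fin 0%C) < e.

(** A square contains arbitrarily many well-separated points, here on the right
    half of its horizontal axis. *)
Lemma small_on_double (a b : Rbar) (f : C -> sphere) (alpha beta : R) :
  sphere_almost_periodic a b f -> substrip alpha beta a b ->
  exists s0, 0 < s0 /\ forall s, 0 < s <= s0 -> forall e, 0 < e -> exists m, 0 < m /\
    forall z, strip alpha beta z -> small_on f z s m -> small_on f z (2 * s) e.
Proof.
intros Hf Hs. destruct (small_at_many_points a b f alpha beta Hf Hs) as (r0 & Hr0 & H).
exists (r0 / 2). split; [lra | ]. intros s Hss e He.
destruct (H (2 * s) ltac:(lra) e He) as (N & HN & H').
assert (HN' : 0 < INR N) by now apply lt_0_INR.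
destruct (H' (s / INR N)) as (m & Hm & H''); [apply Rdiv_lt_0_compat; lra | ].
exists m. split; auto. intros z Hz Hsm.
set (p := fun i : nat => (z + RtoC (INR i * (s / INR N)))%C).
assert (Hi : forall i, (i < N)%nat -> 0 <= INR i * (s / INR N) <= s).
{ intros i Hi. apply lt_INR in Hi. assert (0 <= INR i) by apply pos_INR.
  assert (Hq : 0 < s / INR N) by (apply Rdiv_lt_0_compat; lra).
  split; [nra | ]. replace s with (INR N * (s / INR N)) at 2 by (field; lra).
  apply Rmult_le_compat_r; lra. }
unfold small_on. apply (H'' z p Hz).
- intros i Hi'. specialize (Hi i Hi'). split.
  + unfold p, sqrect, crect. rewrite Re_shift, Im_shift. lra.
  + apply Hsm. unfold p, sqrect, crect. rewrite Re_shift, Im_shift. lra.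
- intros i j [Hij _]. unfold p.
  replace (z + RtoC (INR j * (s / INR N)) - (z + RtoC (INR i * (s / INR N))))%C
    with (RtoC (INR j * (s / INR N) - INR i * (s / INR N))) by (rewrite RtoC_minus; ring).
  rewrite Cmod_R. eapply Rle_trans; [ | apply Rle_abs].
  assert (Hq : 0 < s / INR N) by (apply Rdiv_lt_0_compat; lra).
  assert (Hij' : INR i + 1 <= INR j) by (rewrite <- S_INR; apply le_INR; lia).
  nra.
Qed.

(** The squares are centred on the segment from [z] to [z'], which stays inside
    the strip, and each is contained in the double of the preceding one. *)
Lemma small_on_chain (f : C -> sphere) (alpha beta s : R) : 0 < s ->
  (forall e, 0 < e -> exists m, 0 < m /\
    forall z, strip alpha beta z -> small_on f z s m -> small_on f z (2 * s) e) ->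
  forall (n : nat) e, 0 < e -> exists m, 0 < m /\
    forall z z', strip alpha beta z -> strip alpha beta z' -> sqrect crect z (INR n * s) z' ->
      small_on f z s m -> small_on f z' s e.
Proof.
intros Hs Hstep. induction n as [ | n IH]; intros e He.
- exists e. split; auto. intros z z' _ _ Hz Hsm w Hw. apply Hsm.
  destruct Hz, Hw. simpl in *. split; lra.
- destruct (Hstep e He) as (e' & He' & H1). destruct (IH e' He') as (m & Hm & H2).
  exists m. split; auto. intros z z' Hz Hz' Hzz Hsm.
  assert (Hn : 0 <= INR n) by apply pos_INR.
  rewrite S_INR in Hzz.
  set (q := / (INR n + 1)).
  assert (Hq : 0 < q) by (apply Rinv_0_lt_compat; lra).
  assert (Hq1 : q * (INR n + 1) = 1) by (unfold q; field; lra).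
  assert (Hq2 : q <= 1) by nra.
  (* The last but one centre on the segment. *)
  set (y := (z' + RtoC q * (z - z'))%C).
  assert (Ey : Re y = Re z' + q * (Re z - Re z') /\ Im y = Im z' + q * (Im z - Im z')).
  { unfold y. destruct z, z'. simpl. split; ring. }
  destruct Ey as [E1 E2]. clearbody y q.
  destruct z as [z1 z2], z' as [w1 w2], y as [y1 y2].
  destruct Hz as [Z1 Z2], Hz' as [W1 W2], Hzz as [D1 D2]. simpl in *.
  assert (Hy : strip alpha beta (y1, y2)) by (split; simpl; nra).
  assert (HqD1 : - s <= q * (z1 - w1) <= s) by (split; nra).
  assert (HqD2 : - s <= q * (z2 - w2) <= s) by (split; nra).
  assert (Hyz : small_on f (y1, y2) s e').
  { apply (H2 (z1, z2)); auto; try (split; simpl; lra).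
    unfold sqrect, crect. simpl.
    assert (Eq : (1 - q) * (INR n + 1) = INR n) by lra.
    assert (K1 : y1 - z1 = (1 - q) * (w1 - z1)) by (rewrite E1; ring).
    assert (K2 : y2 - z2 = (1 - q) * (w2 - z2)) by (rewrite E2; ring).
    assert (Eq' : (1 - q) * ((INR n + 1) * s) = INR n * s) by (rewrite <- Rmult_assoc, Eq; ring).
    assert (H0q : 0 <= 1 - q) by lra.
    assert (M1 : (1 - q) * (w1 - z1) <= (1 - q) * ((INR n + 1) * s)) by (apply Rmult_le_compat_l; lra).
    assert (M2 : (1 - q) * (- ((INR n + 1) * s)) <= (1 - q) * (w1 - z1)) by (apply Rmult_le_compat_l; lra).
    assert (M3 : (1 - q) * (w2 - z2) <= (1 - q) * ((INR n + 1) * s)) by (apply Rmult_le_compat_l; lra).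
    assert (M4 : (1 - q) * (- ((INR n + 1) * s)) <= (1 - q) * (w2 - z2)) by (apply Rmult_le_compat_l; lra).
    lra. }
  intros w Hw. apply (H1 (y1, y2) Hy Hyz).
  destruct Hw as [V1 V2]. unfold sqrect, crect. simpl in *. lra.
Qed.

(** A value [f p <> 0] recurs, by almost periodicity, in every rectangle of a
    fixed size, whereas extreme smallness on one square would propagate
    through such a rectangle. *)
Theorem nowhere_small (a b : Rbar) (f : C -> sphere) (alpha beta : R) :
  sphere_almost_periodic a b f -> substrip alpha beta a b ->
  (exists p, strip a b p /\ f p <> Fin 0%C) ->
  forall s, 0 < s -> exists m, 0 < m /\
    forall z, strip alpha beta z -> ~ small_on f z s m.
Proof.
intros Hf Hs (p & Hp & Hfp) s Hs0.
destruct (substrip_extend _ _ _ _ _ Hs Hp) as (alpha' & beta' & Hs' & Ha & Hb & Hpp).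
destruct (small_on_double a b f alpha' beta' Hf Hs') as (s0 & Hs0' & Hdouble).
set (t := Rmin s s0).
assert (Ht : 0 < t) by now apply Rmin_pos.
assert (Hts : t <= s) by apply Rmin_l.
assert (Hc : 0 < rho (f p) (Fin 0%C)).
{ destruct (Rle_lt_or_eq_dec _ _ (rho_ge_0 (f p) (Fin 0%C))) as [H | H]; auto.
  exfalso. apply Hfp, rho_zero_eq. auto. }
set (c := rho (f p) (Fin 0%C)) in *.
destruct (proj2 Hf alpha' beta' Hs' (c / 2)) as (L & HL & Hper); [lra | ].
destruct (INR_unbounded ((L + (beta' - alpha')) / t)) as [n Hn].
assert (Hn' : L + (beta' - alpha') < INR n * t).
{ apply Rmult_lt_compat_r with (r := t) in Hn; auto.
  replace ((L + (beta' - alpha')) / t * t) with (L + (beta' - alpha')) in Hn by (field; lra).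
  exact Hn. }
destruct (small_on_chain f alpha' beta' t Ht) with (n := n) (e := c / 2) as (m & Hm & Hchain).
{ apply Hdouble. split; auto. apply Rmin_r. }
{ lra. }
exists m. split; auto. intros z Hz Hsm.
destruct (Hper (Re z - Re p)) as (tau & Htau & Hap).
assert (Hps : strip alpha' beta' p) by (split; simpl; lra).
assert (Hzs : strip alpha' beta' z) by (destruct Hz; split; simpl in *; lra).
specialize (Hap p Hps).
assert (H : rho (f (p + RtoC tau)%C) (Fin 0%C) < c / 2).
{ apply (Hchain z (p + RtoC tau)%C); auto.
  - now apply strip_shift.
  - unfold sqrect, crect. rewrite Re_shift, Im_shift.
    destruct Hzs; simpl in *. lra.
  - intros w [W1 W2]. apply Hsm. unfold sqrect, crect. lra.
  - unfold sqrect, crect. lra. }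
assert (c <= rho (f p) (f (p + RtoC tau)%C) + rho (f (p + RtoC tau)%C) (Fin 0%C))
  by apply rho_triangle.
rewrite (rho_sym (f p)) in H0. lra.
Qed.

(** * Contours avoiding the neighbourhood of zeros and poles *)

Definition bounded_below_on (f : C -> sphere) (z : C) (r m : R) : Prop :=
  forall w, sqrect brect z r w -> m <= rho (f w) (Fin 0%C).

Lemma concentric_dist (z w w' : C) (r r' : R) :
  sqrect brect z r w -> sqrect brect z r' w' -> Rabs (r - r') <= Cmod (w' - w)%C.
Proof.
intros [W1 W2] [W1' W2'].
assert (K1 := re_le_Cmod (w' - w)). assert (K2 := im_le_Cmod (w' - w)).
destruct z as [z1 z2], w as [x y], w' as [x' y']. simpl in *.
destruct W1 as [W1 W3], W1' as [W1' W3']. simpl in *.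
revert K1 K2. unfold Rabs. destruct (Rcase_abs _), (Rcase_abs _), (Rcase_abs _); lra.
Qed.

(** Otherwise [f] is very small at one point of each of the [N] squares, and by
    [small_at_many_points] this contradicts [nowhere_small]. *)
Lemma contour_among_many (a b : Rbar) (f : C -> sphere) (alpha beta : R) :
  sphere_almost_periodic a b f -> substrip alpha beta a b ->
  (exists p, strip a b p /\ f p <> Fin 0%C) ->
  exists r0, 0 < r0 /\ forall r, 0 < r <= r0 -> exists N, (0 < N)%nat /\
  forall d, 0 < d -> exists m, 0 < m /\ forall z (rad : nat -> R), strip alpha beta z ->
    (forall i, (i < N)%nat -> 0 < rad i <= r) ->
    (forall i j, (i < j < N)%nat -> d <= Rabs (rad i - rad j)) ->
    exists i, (i < N)%nat /\ bounded_below_on f z (rad i) m.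
Proof.
intros Hf Hs Hp. destruct (small_at_many_points a b f alpha beta Hf Hs) as (r0 & Hr0 & H).
exists r0. split; auto. intros r Hr.
destruct (nowhere_small a b f alpha beta Hf Hs Hp r) as (e & He & Hns); [lra | ].
destruct (H r Hr e He) as (N & HN & HN'). exists N. split; auto.
intros d Hd. destruct (HN' d Hd) as (m & Hm & Hall). exists m. split; auto.
intros z rad Hz Hrad Hsep. apply NNPP. intros Hno. apply (Hns z Hz).
assert (Hbad : forall i, exists w, (i < N)%nat ->
   sqrect brect z (rad i) w /\ rho (f w) (Fin 0%C) < m).
{ intros i. destruct (classic (i < N)%nat) as [Hi | Hi]; [ | exists z; intros; easy].
  apply NNPP. intros Hno'. apply Hno. exists i. split; auto.
  intros w Hw. apply Rnot_lt_le. intros Hlt. apply Hno'. exists w. auto. }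
destruct (choice _ Hbad) as [p Hpp].
intros w Hw. apply (Hall z p Hz); auto.
- intros i Hi. destruct (Hpp i Hi) as [K1 K2]. split; auto.
  destruct K1 as [[K1 K3] _]. specialize (Hrad i Hi). unfold sqrect, crect. lra.
- intros i j Hij. eapply Rle_trans; [apply (Hsep i j Hij) | ].
  apply (concentric_dist z); apply Hpp; lia.
Qed.

(** Several functions at once: inside blocks of squares one picks a square for
    the first function, and among those squares one for the other functions. *)
Lemma contour_for_list (a b : Rbar) (l : list (C -> sphere)) (alpha beta : R) :
  substrip alpha beta a b ->
  (forall f, In f l -> sphere_almost_periodic a b f /\ exists p, strip a b p /\ f p <> Fin 0%C) ->
  exists r0, 0 < r0 /\ forall r, 0 < r <= r0 -> exists N, (0 < N)%nat /\
  forall d, 0 < d -> exists m, 0 < m /\ forall z (rad : nat -> R), strip alpha beta z ->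
    (forall i, (i < N)%nat -> 0 < rad i <= r) ->
    (forall i j, (i < j < N)%nat -> d <= Rabs (rad i - rad j)) ->
    exists i, (i < N)%nat /\ forall f, In f l -> bounded_below_on f z (rad i) m.
Proof.
intros Hs. induction l as [ | f l IH]; intros Hl.
{ exists 1. split; [lra | ]. intros r _. exists 1%nat. split; [lia | ]. intros d _.
  exists 1. split; [lra | ]. intros z rad _ _ _. exists O. split; [lia | ]. intros f []. }
destruct (Hl f (or_introl eq_refl)) as [Hf Hp].
destruct (contour_among_many a b f alpha beta Hf Hs Hp) as (r1 & Hr1 & H1).
destruct IH as (r2 & Hr2 & H2). { intros g Hg. apply Hl. now right. }
exists (Rmin r1 r2). split; [now apply Rmin_pos | ]. intros r [Hr Hr'].
destruct (H1 r) as (N1 & HN1 & K1). { generalize (Rmin_l r1 r2). lra. }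
destruct (H2 r) as (N2 & HN2 & K2). { generalize (Rmin_r r1 r2). lra. }
exists (N2 * N1)%nat. split; [nia | ]. intros d Hd.
destruct (K1 d Hd) as (m1 & Hm1 & M1). destruct (K2 d Hd) as (m2 & Hm2 & M2).
exists (Rmin m1 m2). split; [now apply Rmin_pos | ].
intros z rad Hz Hrad Hsep.
assert (Hblock : forall q, exists j, (q < N2)%nat ->
  (j < N1)%nat /\ bounded_below_on f z (rad (q * N1 + j)%nat) m1).
{ intros q. destruct (classic (q < N2)%nat) as [Hq | Hq]; [ | exists O; intros; easy].
  destruct (M1 z (fun j => rad (q * N1 + j)%nat) Hz) as (j & Hj & Hj').
  - intros i Hi. apply Hrad. nia.
  - intros i j Hij. apply Hsep. nia.
  - exists j. auto. }
destruct (choice _ Hblock) as [J HJ].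
destruct (M2 z (fun q => rad (q * N1 + J q)%nat) Hz) as (q & Hq & Hq').
- intros q Hq. destruct (HJ q Hq) as [HJq _]. apply Hrad. nia.
- intros q q' Hqq. destruct (HJ q) as [HJq _]; [lia | ]. destruct (HJ q') as [HJq' _]; [lia | ].
  apply Hsep. nia.
- destruct (HJ q Hq) as [HJq HJb]. exists (q * N1 + J q)%nat. split; [nia | ].
  intros g [<- | Hg] w Hw.
  + eapply Rle_trans; [apply Rmin_l | now apply HJb].
  + eapply Rle_trans; [apply Rmin_r | now apply (Hq' g Hg)].
Qed.

Theorem uniform_contours (a b : Rbar) (l : list (C -> sphere)) (alpha beta : R) :
  substrip alpha beta a b ->
  (forall f, In f l -> sphere_almost_periodic a b f /\ exists p, strip a b p /\ f p <> Fin 0%C) ->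
  exists r0, 0 < r0 /\ forall r, 0 < r <= r0 -> exists m, 0 < m /\
    forall z, strip alpha beta z -> exists r', 0 < r' <= r /\
      forall f, In f l -> bounded_below_on f z r' m.
Proof.
intros Hs Hl. destruct (contour_for_list a b l alpha beta Hs Hl) as (r0 & Hr0 & H).
exists r0. split; auto. intros r Hr.
destruct (H r Hr) as (N & HN & HN').
assert (HNp : 0 < INR N) by now apply lt_0_INR.
(* The radii tried are the multiples of [d] up to [N d = r]. *)
set (d := r / INR N).
assert (Hd : 0 < d) by (apply Rdiv_lt_0_compat; lra).
assert (EN : INR N * d = r) by (unfold d; field; lra).
destruct (HN' d Hd) as (m & Hm & K). exists m. split; auto. intros z Hz.
assert (Hrad : forall i, (i < N)%nat -> 0 < INR (S i) * d <= r).
{ intros i Hi. assert (1 <= INR (S i)) by (apply (le_INR 1); lia).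
  split; [nra | ]. rewrite <- EN. apply Rmult_le_compat_r; [lra | ]. apply le_INR. lia. }
destruct (K z (fun i => INR (S i) * d) Hz Hrad) as (i & Hi & Hall).
- intros i j [Hij _]. rewrite Rabs_minus_sym. eapply Rle_trans; [ | apply Rle_abs].
  assert (INR (S i) + 1 <= INR (S j)) by (rewrite <- S_INR; apply le_INR; lia). nra.
- exists (INR (S i) * d). split; auto.
Qed.

(** * Comparison of two functions inside a contour *)

Lemma rho_0_far (x : sphere) (m : R) : 0 < m -> m <= rho x (Fin 0%C) ->
  x <> Fin 0%C /\ exists v, sinv x = Fin v /\ Cmod v <= 2 / m.
Proof.
intros Hm H. split.
- intros ->. rewrite rho_refl in H. lra.
- apply rho_Infty_far; auto. rewrite <- rho_sinv, sinv_invol. exact H.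
Qed.

Lemma sphere_holomorphic_omits_Infty (G : C -> sphere) (z : C) :
  sphere_holomorphic_at G z -> G z <> Infty ->
  ex_derive (fun w => fin_part (G w)) z /\ G z = Fin (fin_part (G z)).
Proof.
intros H Hz. split.
- now destruct (sphere_holomorphic_finite G z H Hz).
- destruct (G z); easy.
Qed.

(** If [H] omits infinity, the maximum principle applies to [G - H]; if it
    omits 0, to [G / H - 1]. *)
Lemma contour_comparison_finite (G H : C -> sphere) (z : C) (r c k : R) :
  0 < r -> 0 < c ->
  (forall w, sqrect crect z r w -> sphere_holomorphic_at G w) ->
  (forall w, sqrect crect z r w -> sphere_holomorphic_at H w) ->
  (forall w, sqrect crect z r w -> G w <> Infty) ->
  (forall w, sqrect crect z r w -> H w <> Infty) \/
    (forall w, sqrect crect z r w -> H w <> Fin 0%C) ->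
  (forall w, sqrect brect z r w -> rho (G w) (H w) <= k) ->
  (forall w, sqrect brect z r w -> c <= rho (G w) Infty) ->
  (forall w, sqrect brect z r w -> c <= rho (H w) Infty /\ c <= rho (H w) (Fin 0%C)) ->
  rho (G z) (H z) <= 2 * (1 + 2 / c) ^ 3 * k.
Proof.
intros Hr Hc HG HH HGo HHo Hk HGc HHc.
set (A := 2 / c). assert (HA : 0 < A) by (apply Rdiv_lt_0_compat; lra).
set (g := fun w => fin_part (G w)).
assert (Hz : sqrect crect z r z) by (unfold sqrect, crect; lra).
assert (Hk0 : 0 <= k).
{ eapply Rle_trans; [apply (rho_ge_0 (G (z + RtoC r)%C) (H (z + RtoC r)%C)) | apply Hk].
  unfold sqrect, brect, crect. rewrite Re_shift, Im_shift. lra. }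
assert (Hg : forall w, sqrect crect z r w -> ex_derive g w /\ G w = Fin (g w)).
{ intros w Hw. apply sphere_holomorphic_omits_Infty; auto. }
assert (Hgb : forall w, sqrect brect z r w -> Cmod (g w) <= A).
{ intros w Hw. destruct (rho_Infty_far (G w) c Hc (HGc w Hw)) as (u & E & Hu).
  unfold g. rewrite E. exact Hu. }
assert (HA2 : 0 <= (1 + A) ^ 2) by apply pow2_ge_0.
assert (Hdiff : forall w h, sqrect brect z r w -> H w = Fin h -> Cmod h <= A ->
  Cmod (g w - h)%C <= (1 + A) ^ 2 * k).
{ intros w h Hw E Hh. eapply Rle_trans; [apply (Cmod_le_rho _ _ A); auto | ].
  apply Rmult_le_compat_l; auto. rewrite <- E.
  destruct (Hg w (proj1 Hw)) as [_ <-]. auto. }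
destruct (Hg z Hz) as [_ EGz]. rewrite EGz.
assert (Epow : 2 * (1 + A) ^ 3 * k = 2 * ((1 + A) ^ 2 * k) * (1 + A)) by ring.
assert (Hk2 : 0 <= (1 + A) ^ 2 * k) by (apply Rmult_le_pos; auto).
destruct HHo as [HHo | HHo].
- set (h := fun w => fin_part (H w)).
  assert (Hh : forall w, sqrect crect z r w -> ex_derive h w /\ H w = Fin (h w)).
  { intros w Hw. apply sphere_holomorphic_omits_Infty; auto. }
  destruct (Hh z Hz) as [_ EHz]. rewrite EHz.
  eapply Rle_trans; [apply rho_le_Cmod | ].
  assert (HM : Cmod (g z - h z)%C <= (1 + A) ^ 2 * k).
  { apply (maximum_principle (fun w => g w - h w)%C
      (Re z - r) (Re z + r) (Im z - r) (Im z + r)); auto.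
    - intros w Hw. apply (ex_derive_Cminus g h); [apply Hg | apply Hh]; exact Hw.
    - intros w Hw. destruct (Hh w (proj1 Hw)) as [_ E]. apply (Hdiff w); auto.
      destruct (rho_Infty_far (H w) c Hc (proj1 (HHc w Hw))) as (u & E' & Hu).
      rewrite E' in E. injection E as <-. exact Hu. }
  rewrite Epow. nra.
- set (h := fun w => fin_part (sinv (H w))).
  assert (Hh : forall w, sqrect crect z r w -> ex_derive h w /\ sinv (H w) = Fin (h w)).
  { intros w Hw. apply (sphere_holomorphic_omits_Infty (fun w => sinv (H w))).
    - apply sphere_holomorphic_sinv. auto.
    - intros E. apply (HHo w Hw). rewrite <- (sinv_invol (H w)), E. reflexivity. }
  destruct (Hh z Hz) as [_ EHz]. rewrite <- (sinv_invol (H z)), EHz.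
  eapply Rle_trans; [apply rho_inverse_le | ].
  assert (HM : Cmod (g z * h z - 1)%C <= (1 + A) ^ 2 * k * A).
  { apply (maximum_principle (fun w => g w * h w - 1)%C
      (Re z - r) (Re z + r) (Im z - r) (Im z + r)); auto.
    - intros w Hw. apply (ex_derive_Cminus (fun w => g w * h w)%C (fun _ => 1%C)).
      + apply (ex_derive_Cmult g h); [apply Hg | apply Hh]; exact Hw.
      + apply ex_derive_Cconst.
    - intros w Hw. destruct (HHc w Hw) as [C1 C2].
      destruct (rho_Infty_far (H w) c Hc C1) as (u & E & Hu).
      destruct (rho_0_far (H w) c Hc C2) as (Hne & v & E' & Hv).
      destruct (Hh w (proj1 Hw)) as [_ E2]. rewrite E' in E2. injection E2 as E2.
      rewrite <- E2.
      assert (Hu0 : u <> 0%C) by (intros ->; auto).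
      rewrite E, sinv_Fin in E' by exact Hu0. injection E' as E'.
      replace (g w * v - 1)%C with ((g w - u) * v)%C
        by (rewrite <- E'; field; exact Hu0).
      rewrite Cmod_mult. apply Rmult_le_compat; auto using Cmod_ge_0. }
  rewrite Epow. nra.
Qed.

(** Inversion, an isometry of the sphere, reduces the case where [G] omits 0
    to the case where it omits infinity. *)
Lemma contour_comparison (G H : C -> sphere) (z : C) (r c k : R) :
  0 < r -> 0 < c ->
  (forall w, sqrect crect z r w -> sphere_holomorphic_at G w) ->
  (forall w, sqrect crect z r w -> sphere_holomorphic_at H w) ->
  (forall w, sqrect crect z r w -> G w <> Infty) \/
    (forall w, sqrect crect z r w -> G w <> Fin 0%C) ->
  (forall w, sqrect crect z r w -> H w <> Infty) \/
    (forall w, sqrect crect z r w -> H w <> Fin 0%C) ->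
  (forall w, sqrect brect z r w -> rho (G w) (H w) <= k) ->
  (forall w, sqrect brect z r w -> c <= rho (G w) Infty /\ c <= rho (G w) (Fin 0%C)) ->
  (forall w, sqrect brect z r w -> c <= rho (H w) Infty /\ c <= rho (H w) (Fin 0%C)) ->
  rho (G z) (H z) <= 2 * (1 + 2 / c) ^ 3 * k.
Proof.
intros Hr Hc HG HH [HGo | HGo] HHo Hk HGc HHc.
- apply (contour_comparison_finite G H z r c k); auto. intros w Hw. now apply HGc.
- rewrite <- rho_sinv.
  assert (Hne : forall x, x <> Fin 0%C -> sinv x <> Infty).
  { intros x Hx E. apply Hx. rewrite <- (sinv_invol x), E. reflexivity. }
  assert (Hne' : forall x, x <> Infty -> sinv x <> Fin 0%C).
  { intros x Hx E. apply Hx. rewrite <- (sinv_invol x), E. apply sinv_0. }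
  assert (E0 : forall x, rho (sinv x) Infty = rho x (Fin 0%C)).
  { intros x. rewrite <- sinv_0. apply rho_sinv. }
  assert (E1 : forall x, rho (sinv x) (Fin 0%C) = rho x Infty).
  { intros x. change (Fin 0%C) with (sinv Infty). apply rho_sinv. }
  apply (contour_comparison_finite (fun w => sinv (G w)) (fun w => sinv (H w)) z r c k); auto.
  + intros w Hw. apply sphere_holomorphic_sinv. auto.
  + intros w Hw. apply sphere_holomorphic_sinv. auto.
  + destruct HHo as [HHo | HHo]; [right | left]; auto.
  + intros w Hw. rewrite rho_sinv. auto.
  + intros w Hw. rewrite E0. now apply HGc.
  + intros w Hw. rewrite E0, E1. destruct (HHc w Hw). auto.
Qed.

Lemma sphere_holomorphic_shift (f : C -> sphere) (z t : C) :
  sphere_holomorphic_at f (z + t)%C -> sphere_holomorphic_at (fun w => f (w + t)%C) z.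
Proof.
assert (K : forall h : C -> sphere, holomorphic_at h (z + t)%C -> holomorphic_at (fun w => h (w + t)%C) z).
{ intros h Hh. apply holomorphic_at_iff in Hh. destruct Hh as (g & H1 & H2).
  apply holomorphic_at_iff. exists (fun w => g (w + t)%C). split.
  - apply locally_Cmod in H1. destruct H1 as (d & Hd & H1). apply locally_Cmod.
    exists d. split; auto. intros w Hw. apply H1.
    replace (w + t - (z + t))%C with (w - z)%C by ring. exact Hw.
  - apply ex_derive_quotient in H2. destruct H2 as (phi & Hc & Hq).
    apply ex_derive_quotient. exists (fun w => phi (w + t)%C). split.
    + rewrite continuous_Cmod in *. intros e He. destruct (Hc e He) as (d & Hd & H).
      exists d. split; auto. intros w Hw. apply H.
      replace (w + t - (z + t))%C with (w - z)%C by ring. exact Hw.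
    + intros w. rewrite (Hq (w + t)%C). ring. }
intros [H | H]; [left | right]; [apply K, H | ].
apply (K (fun w => sinv (f w))), H.
Qed.

(** * Products of almost periodic functions *)

Lemma far_from_0_Infty (u : C) (B : R) : u <> 0%C -> Cmod u <= B -> Cmod (/ u)%C <= B ->
  2 / (1 + B) <= rho (Fin u) Infty /\ 2 / (1 + B) <= rho (Fin u) (Fin 0%C).
Proof.
assert (K : forall v, Cmod v <= B -> 2 / (1 + B) <= rho (Fin v) Infty).
{ intros v Hv. rewrite rho_Fin_Infty. generalize (jap_ge_1 v) (jap_le v) (Cmod_ge_0 v). intros.
  apply Rmult_le_compat_l; [lra | ]. apply Rinv_le_contravar; lra. }
intros H0 H1 H2. split; auto. rewrite <- rho_sinv, sinv_0, sinv_Fin; auto.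
Qed.

(** On a contour where the factors stay away from 0 and infinity,
    multiplication is Lipschitz for the spherical metric. *)
Lemma rho_mult_le (x1 x2 y1 y2 : sphere) (m k : R) : 0 < m ->
  m <= rho x1 (Fin 0%C) /\ m <= rho x1 Infty -> m <= rho x2 (Fin 0%C) /\ m <= rho x2 Infty ->
  m <= rho y1 (Fin 0%C) /\ m <= rho y1 Infty -> m <= rho y2 (Fin 0%C) /\ m <= rho y2 Infty ->
  rho x1 y1 <= k -> rho x2 y2 <= k ->
  exists u1 u2 v1 v2, (x1 = Fin u1 /\ x2 = Fin u2 /\ y1 = Fin v1 /\ y2 = Fin v2) /\
   let B := 2 / m in let c := 2 / (1 + B * B) in
   rho (Fin (u1 * u2)%C) (Fin (v1 * v2)%C) <= 4 * B * (1 + B) ^ 2 * k /\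
   (c <= rho (Fin (u1 * u2)%C) Infty /\ c <= rho (Fin (u1 * u2)%C) (Fin 0%C)) /\
   (c <= rho (Fin (v1 * v2)%C) Infty /\ c <= rho (Fin (v1 * v2)%C) (Fin 0%C)).
Proof.
intros Hm X1 X2 Y1 Y2 K1 K2.
assert (Hx : forall x, m <= rho x (Fin 0%C) /\ m <= rho x Infty ->
  exists u, x = Fin u /\ u <> 0%C /\ Cmod u <= 2 / m /\ Cmod (/ u)%C <= 2 / m).
{ intros x [H0 Hi]. destruct (rho_Infty_far x m Hm Hi) as (u & -> & Hu).
  destruct (rho_0_far (Fin u) m Hm H0) as (Hne & v & E & Hv).
  assert (Hu0 : u <> 0%C) by (intros ->; auto).
  rewrite sinv_Fin in E by auto. injection E as <-. exists u. auto. }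
destruct (Hx x1 X1) as (u1 & -> & N1 & U1 & I1).
destruct (Hx x2 X2) as (u2 & -> & N2 & U2 & I2).
destruct (Hx y1 Y1) as (v1 & -> & N3 & V1 & J1).
destruct (Hx y2 Y2) as (v2 & -> & N4 & V2 & J2).
exists u1, u2, v1, v2. split; auto.
set (B := 2 / m) in *. assert (HB : 0 < B) by (apply Rdiv_lt_0_compat; lra). clearbody B.
intros B' c. subst B'.
split; [ | split].
- eapply Rle_trans; [apply rho_le_Cmod | ].
  replace (u1 * u2 - v1 * v2)%C with ((u1 - v1) * u2 + v1 * (u2 - v2))%C by ring.
  assert (D1 := Cmod_le_rho u1 v1 B U1 V1). assert (D2 := Cmod_le_rho u2 v2 B U2 V2).
  assert (HB2 : 0 <= (1 + B) ^ 2) by apply pow2_ge_0.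
  assert (D1' : Cmod (u1 - v1)%C <= (1 + B) ^ 2 * k) by (eapply Rle_trans; [exact D1 | ]; nra).
  assert (D2' : Cmod (u2 - v2)%C <= (1 + B) ^ 2 * k) by (eapply Rle_trans; [exact D2 | ]; nra).
  assert (P1 : Cmod ((u1 - v1) * u2)%C <= (1 + B) ^ 2 * k * B).
  { rewrite Cmod_mult. apply Rmult_le_compat; auto using Cmod_ge_0. }
  assert (P2 : Cmod (v1 * (u2 - v2))%C <= B * ((1 + B) ^ 2 * k)).
  { rewrite Cmod_mult. apply Rmult_le_compat; auto using Cmod_ge_0. }
  assert (H := Cmod_triangle ((u1 - v1) * u2)%C (v1 * (u2 - v2))%C). lra.
- apply far_from_0_Infty; [now apply Cmult_neq_0 | | ].
  + rewrite Cmod_mult. apply Rmult_le_compat; auto using Cmod_ge_0.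
  + replace (/ (u1 * u2))%C with (/ u1 * / u2)%C by (field; auto).
    rewrite Cmod_mult. apply Rmult_le_compat; auto using Cmod_ge_0.
- apply far_from_0_Infty; [now apply Cmult_neq_0 | | ].
  + rewrite Cmod_mult. apply Rmult_le_compat; auto using Cmod_ge_0.
  + replace (/ (v1 * v2))%C with (/ v1 * / v2)%C by (field; auto).
    rewrite Cmod_mult. apply Rmult_le_compat; auto using Cmod_ge_0.
Qed.

Lemma separated_inside_iff (a b : Rbar) (N P : C -> Prop) :
  separated_inside a b N P <-> forall alpha beta, substrip alpha beta a b ->
   exists d, 0 < d /\ forall z z', N z -> strip alpha beta z -> P z' -> strip alpha beta z' ->
     d <= Cmod (z - z')%C.
Proof.
split; intros H alpha beta Hs; specialize (H alpha beta Hs).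
- set (E := fun d : R => exists z z', (N z /\ strip alpha beta z) /\ (P z' /\ strip alpha beta z') /\
    d = Cmod (z - z')%C) in *.
  destruct (Glb_Rbar_correct E) as [Hlb _].
  assert (HE : forall z z', N z -> strip alpha beta z -> P z' -> strip alpha beta z' ->
     E (Cmod (z - z')%C)).
  { intros z z' H1 H2 H3 H4. exists z, z'. auto. }
  destruct (Glb_Rbar E) as [g | | ]; simpl in H.
  + exists g. split; auto. intros z z' H1 H2 H3 H4. apply (Hlb (Cmod (z - z')%C)). auto.
  + exists 1. split; [lra | ]. intros z z' H1 H2 H3 H4. exfalso.
    apply (Hlb (Cmod (z - z')%C)). auto.
  + easy.
- destruct H as (d & Hd & H).
  apply Rbar_lt_le_trans with d; [exact Hd | ].
  apply Glb_Rbar_correct. intros x (z & z' & [H1 H2] & [H3 H4] & ->). simpl. auto.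
Qed.

Lemma almost_periodic_separated (a b : Rbar) (F : C -> sphere) :
  sphere_almost_periodic a b F ->
  separated_inside a b (zeros (strip a b) F) (poles (strip a b) F).
Proof.
intros HF. apply separated_inside_iff. intros alpha beta Hs.
destruct (almost_periodic_uniformly_continuous a b F alpha beta 2 HF Hs) as (d & Hd & H); [lra | ].
exists d. split; auto. intros z z' [_ E] Hz [_ E'] Hz'.
apply Rnot_lt_le. intros Hlt. specialize (H z' z Hz' Hz Hlt).
rewrite E, E', rho_0_Infty in H. lra.
Qed.

Lemma meromorphic_not_Infty (a b : Rbar) (f : C -> sphere) (z : C) :
  meromorphic_on (strip a b) f -> strip a b z -> exists p, strip a b p /\ f p <> Infty.
Proof.
intros Hf Hz. destruct (Hf z Hz) as [[H _] | (_ & H & _)].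
- exists z. split; auto. apply (locally_singleton _ _ H).
- apply locally'_Cmod in H. destruct H as (d & Hd & H).
  destruct (Cmod_shift_right z (d / 2)) as [Hw Hwz]; [lra | ].
  exists (z + RtoC (d / 2))%C. split; [now apply strip_shift | ]. apply H; [lra | exact Hwz].
Qed.

Lemma mero_mult_zero (a b : Rbar) (f1 f2 : C -> sphere) (z : C) :
  (forall p, strip a b p -> f1 p = Fin 0%C) \/ (forall p, strip a b p -> f2 p = Fin 0%C) ->
  strip a b z -> mero_mult f1 f2 z = Fin 0%C.
Proof.
intros H Hz.
destruct (classic (f1 z = Infty \/ f2 z = Infty)) as [Hi | Hi].
- apply mero_mult_limit; auto. apply is_lim_sphere_iff. intros e He.
  assert (Hl := strip_open a b z Hz). apply locally_Cmod in Hl.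
  destruct Hl as (d & Hd & Hl). exists d. split; auto. intros w Hw _.
  replace (fin_part (f1 w) * fin_part (f2 w))%C with (RtoC 0).
  + now rewrite rho_refl.
  + destruct H as [H | H]; rewrite (H w (Hl w Hw)); simpl; ring.
- destruct (f1 z) as [u | ] eqn:E1; [ | exfalso; auto].
  destruct (f2 z) as [v | ] eqn:E2; [ | exfalso; auto].
  rewrite (mero_mult_Fin f1 f2 z u v E1 E2). f_equal.
  destruct H as [H | H]; rewrite (H z Hz) in *; [injection E1 as <- | injection E2 as <-]; ring.
Qed.

(** The contours of [uniform_contours] are used inside squares so small that, by
    separation, the product omits 0 or infinity there. *)
Theorem separated_product_almost_periodic (a b : Rbar) (f1 f2 : C -> sphere) :
  mero_almost_periodic a b f1 -> mero_almost_periodic a b f2 ->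
  separated_inside a b
    (zeros (strip a b) (mero_mult f1 f2)) (poles (strip a b) (mero_mult f1 f2)) ->
  mero_almost_periodic a b (mero_mult f1 f2).
Proof.
intros H1 H2 Hsep. set (F := mero_mult f1 f2) in *.
assert (HF : meromorphic_on (strip a b) F).
{ apply meromorphic_mult; [apply strip_open | apply H1 | apply H2]. }
split; auto. intros alpha beta Hs e He.
destruct (classic ((forall p, strip a b p -> f1 p = Fin 0%C) \/ (forall p, strip a b p -> f2 p = Fin 0%C)))
  as [H0 | H0].
{ (* No contour avoids the zeros of a factor that vanishes identically. *)
  exists 1. split; [lra | ]. intros t. exists t. split; [lra | ]. intros z Hz.
  assert (Hz' : strip a b z).
  { apply (strip_substrip _ _ _ _ _ Hs). destruct Hz; simpl in *; lra. }
  unfold F. rewrite !(mero_mult_zero a b f1 f2 _ H0) by (auto using strip_shift).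
  now rewrite rho_refl. }
assert (HFh : forall z, strip a b z -> sphere_holomorphic_at F z).
{ intros z Hz. apply (meromorphic_sphere_holomorphic (strip a b)); auto. apply strip_open. }
assert (A1 := mero_sphere_almost_periodic _ _ _ H1).
assert (A2 := mero_sphere_almost_periodic _ _ _ H2).
assert (Hpt : exists p0, strip a b p0).
{ exists (0, alpha). apply (strip_substrip _ _ _ _ _ Hs). destruct Hs as (_ & Hs & _). simpl; lra. }
destruct Hpt as [p0 Hp0].
destruct (substrip_room _ _ _ _ Hs) as (h & Hh & Hs').
rewrite separated_inside_iff in Hsep. destruct (Hsep _ _ Hs') as (d & Hd & Hsep').
(* The inverses serve to bound [f1] and [f2] away from infinity. *)
set (l := f1 :: f2 :: (fun z => sinv (f1 z)) :: (fun z => sinv (f2 z)) :: nil).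
destruct (uniform_contours a b l alpha beta Hs) as (r0 & Hr0 & Hcont).
{ assert (Hnz : forall f, ~ (forall p, strip a b p -> f p = Fin 0%C) ->
    exists p, strip a b p /\ f p <> Fin 0%C).
  { intros f Hf. apply NNPP. intros Hno. apply Hf. intros p Hp. apply NNPP. intros Hfp.
    apply Hno. now exists p. }
  assert (Hni : forall f, meromorphic_on (strip a b) f ->
    exists p, strip a b p /\ sinv (f p) <> Fin 0%C).
  { intros f Hf. destruct (meromorphic_not_Infty a b f p0 Hf Hp0) as (p & Hp & Hfp).
    exists p. split; auto. intros E. apply Hfp. rewrite <- (sinv_invol (f p)), E. apply sinv_0. }
  intros f [<- | [<- | [<- | [<- | []]]]]; split; auto using sphere_almost_periodic_sinv.
  - apply Hni, H1.
  - apply Hni, H2. }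
(* Points of a square of half side [r] are at distance at most [4 r < d]. *)
set (r := Rmin r0 (Rmin (h / 2) (d / 8))).
assert (Hr : 0 < r) by (repeat apply Rmin_pos; lra).
assert (R1 : r <= r0) by apply Rmin_l.
assert (R2 : r <= h / 2) by (eapply Rle_trans; [apply Rmin_r | apply Rmin_l]).
assert (R3 : r <= d / 8) by (eapply Rle_trans; [apply Rmin_r | apply Rmin_r]).
clearbody r.
destruct (Hcont r (conj Hr R1)) as (m & Hm & Hgood).
(* [B] bounds the factors, their inverses and those of their translates on the
   contour; [c] is the resulting distance of the products to 0 and infinity. *)
set (B := 2 / (m / 2)). set (c := 2 / (1 + B * B)).
assert (HB : 0 < B) by (apply Rdiv_lt_0_compat; lra).
assert (Hc : 0 < c) by (apply Rdiv_lt_0_compat; nra).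
set (K := 2 * (1 + 2 / c) ^ 3 * (4 * B * (1 + B) ^ 2)).
assert (HK : 0 < K).
{ assert (0 < 2 / c) by (apply Rdiv_lt_0_compat; lra).
  assert (0 < (1 + 2 / c) ^ 3) by (apply pow_lt; lra).
  assert (0 < (1 + B) ^ 2) by (apply pow_lt; lra).
  unfold K. apply Rmult_lt_0_compat; apply Rmult_lt_0_compat; auto; lra. }
set (k := Rmin (m / 2) (e / (2 * K))).
assert (Hk : 0 < k) by (apply Rmin_pos; [lra | apply Rdiv_lt_0_compat; lra]).
assert (Hk1 : k <= m / 2) by apply Rmin_l.
assert (Hk2 : K * k < e).
{ apply Rle_lt_trans with (K * (e / (2 * K))).
  - apply Rmult_le_compat_l; [lra | apply Rmin_r].
  - replace (K * (e / (2 * K))) with (e / 2) by (field; lra). lra. }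
clearbody k.
destruct (common_almost_periods a b f1 f2 _ _ k A1 A2 Hs' Hk) as (L & HL & Hper).
exists L. split; auto. intros t. destruct (Hper t) as (tau & Ht & P1 & P2).
exists tau. split; auto. intros z Hz.
destruct (Hgood z Hz) as (r' & Hr' & Hb).
assert (Q : forall w, sqrect crect z r' w -> strip (alpha - h) (beta + h) w).
{ intros w Hw. apply (sqrect_strip alpha beta h r' z); auto. lra. }
assert (Q' : forall w, strip (alpha - h) (beta + h) w -> strip a b w).
{ intros w [W1 W2]. apply (strip_substrip _ _ _ _ _ Hs'). simpl in *. lra. }
assert (Hom : forall s, (forall w, sqrect crect z r' w -> F (w + RtoC s)%C <> Infty) \/
  (forall w, sqrect crect z r' w -> F (w + RtoC s)%C <> Fin 0%C)).
{ intros s. apply NNPP. intros Hno. apply not_or_and in Hno. destruct Hno as [N1 N2].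
  apply not_all_ex_not in N1, N2. destruct N1 as [w N1], N2 as [w' N2].
  apply imply_to_and in N1, N2. destruct N1 as [W1 N1], N2 as [W2 N2].
  apply NNPP in N1, N2.
  assert (D : d <= Cmod (w' + RtoC s - (w + RtoC s))%C).
  { apply Hsep'; [split; [ | exact N2] | | split; [ | exact N1] | ]; apply strip_shift; auto. }
  replace (w' + RtoC s - (w + RtoC s))%C with ((w' - z) + - (w - z))%C in D by ring.
  assert (T := Cmod_triangle (w' - z)%C (- (w - z))%C). rewrite Cmod_opp in T.
  assert (T1 := crect_Cmod _ _ _ W1). assert (T2 := crect_Cmod _ _ _ W2). lra. }
assert (Hbd : forall w, sqrect brect z r' w ->
  rho (F (w + RtoC tau)%C) (F w) <= 4 * B * (1 + B) ^ 2 * k /\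
  (c <= rho (F (w + RtoC tau)%C) Infty /\ c <= rho (F (w + RtoC tau)%C) (Fin 0%C)) /\
  (c <= rho (F w) Infty /\ c <= rho (F w) (Fin 0%C))).
{ intros w Hw. assert (Hws := Q w (proj1 Hw)).
  specialize (P1 w Hws). specialize (P2 w Hws).
  assert (Hfar : forall f, In f l -> In (fun z => sinv (f z)) l ->
    m <= rho (f w) (Fin 0%C) /\ m <= rho (f w) Infty).
  { intros f Hf Hf'. split; [now apply (Hb f) | ].
    rewrite <- rho_sinv. exact (Hb _ Hf' w Hw). }
  destruct (Hfar f1) as [F1 F1']; [now left | now right; right; left | ].
  destruct (Hfar f2) as [F2 F2']; [now right; left | now right; right; right; left | ].
  assert (Hnear : forall x y q, m <= rho x q -> rho y x < k -> m / 2 <= rho y q).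
  { intros x y q Hq Hxy. assert (T := rho_triangle x y q). rewrite (rho_sym x y) in T. lra. }
  destruct (rho_mult_le (f1 (w + RtoC tau)%C) (f2 (w + RtoC tau)%C) (f1 w) (f2 w) (m / 2) k)
    as (u1 & u2 & v1 & v2 & (E1 & E2 & E3 & E4) & Hres); try lra.
  - split; [apply (Hnear (f1 w)) | apply (Hnear (f1 w))]; auto.
  - split; [apply (Hnear (f2 w)) | apply (Hnear (f2 w))]; auto.
  - unfold F. rewrite (mero_mult_Fin f1 f2 _ u1 u2 E1 E2), (mero_mult_Fin f1 f2 _ v1 v2 E3 E4).
    exact Hres. }
apply Rle_lt_trans with (K * k); auto. unfold K. rewrite Rmult_assoc.
apply (contour_comparison (fun w => F (w + RtoC tau)%C) F z r' c); auto; try (apply Hr').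
- intros w Hw. apply sphere_holomorphic_shift, HFh, strip_shift. auto.
- destruct (Hom 0) as [H | H]; [left | right]; intros w Hw; specialize (H w Hw);
    now rewrite Cplus_0_r in H.
- intros w Hw. apply (Hbd w Hw).
- intros w Hw. apply (Hbd w Hw).
- intros w Hw. apply (Hbd w Hw).
Qed.

Theorem theorem5 (a b : Rbar) (hab : Rbar_lt a b) (f1 f2 : C -> sphere)
    (hf1 : mero_almost_periodic a b f1) (hf2 : mero_almost_periodic a b f2) :
  mero_almost_periodic a b (mero_mult f1 f2) <->
  separated_inside a b
    (zeros (strip a b) (mero_mult f1 f2)) (poles (strip a b) (mero_mult f1 f2)).
Proof.
split.
- intros H. now apply almost_periodic_separated, mero_sphere_almost_periodic.
- now apply separated_product_almost_periodic.
Qed.
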